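(* Let $G$ be a compact Hausdorff group, let $E$ be a complex Banach space, let $(\gamma(\sigma))_{\sigma\in\widehat{G}}$ be a family of nonnegative real numbers, and let $s\in[0,\infty)$. If $$\sum_{\sigma\in\widehat{G}}\frac{d_\sigma^3}{(1+\gamma(\sigma)^2)^s}<\infty,$$ then $H_\gamma^s(G,E)$ is continuously embedded in $\mathcal{C}(G,E)$.
   Context: $G$ is a compact Hausdorff group (not necessarily abelian), and $dx$ is its normalized Haar measure. $\widehat{G}$ denotes the unitary dual of $G$, the set of equivalence classes of continuous irreducible unitary representations of $G$. For each $\sigma\in\widehat{G}$ a representative, also denoted $\sigma$, is fixed, acting on a Hilbert space $H_\sigma$ of finite dimension $d_\sigma$ with inner product $\langle\cdot,\cdot\rangle_\sigma$ (linear in the first variable), and an orthonormal basis $\{\xi_1^\sigma,\dots,\xi_{d_\sigma}^\sigma\}$ of $H_\sigma$ is fixed. $L^2(G,E)$ is the space of $E$-valued Bochner square integrable functions on $G$ (modulo a.e. equality). For $f\in L^2(G,E)$ and $\sigma\in\widehat{G}$, the Fourier transform $\widehat{f}(\sigma)$ is the $E$-valued sesquilinear map on $H_\sigma\times H_\sigma$ given by $\widehat{f}(\sigma)(\xi,\eta)=\int_G\langle\sigma(x)^*\xi,\eta\rangle_\sigma f(x)\,dx$. The Sobolev space $H_\gamma^s(G,E)$ is the subspace of all $f\in L^2(G,E)$ such that $$\|f\|_{H_\gamma^s}:=\left(\sum_{\sigma\in\widehat{G}}d_\sigma(1+\gamma(\sigma)^2)^s\sum_{i=1}^{d_\sigma}\sum_{j=1}^{d_\sigma}\|\widehat{f}(\sigma)(\xi_j^\sigma,\xi_i^\sigma)\|_E^2\right)^{1/2}<\infty.$$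 $\mathcal{C}(G,E)$ is the space of $E$-valued continuous functions on $G$ with the norm $\|f\|_\infty=\sup\{\|f(x)\|_E:x\in G\}$. An element of $L^2(G,E)$ is regarded as belonging to $\mathcal{C}(G,E)$ when it is a.e. equal to a continuous function, with which it is identified. ''Continuously embedded'' means that the space is contained in the other and the inclusion map is bounded for the given norms. *)

(* Defs.v *)
From HB Require Import structures.
From mathcomp Require Import all_boot all_order all_algebra.
From mathcomp Require Import all_classical all_reals all_analysis.
From mathcomp Require Import complex.

Set Implicit Arguments.
Unset Strict Implicit.
Unset Printing Implicit Defensive.

Import Order.TTheory GRing.Theory Num.Theory.
Import numFieldNormedType.Exports.

Local Open Scope classical_set_scope.
Local Open Scope ring_scope.
Local Open Scope complex_scope.

(* Not necessarily commutative, hence multiplicative [groupType]; the analysis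
   library only has topological Z-modules. *)
HB.mixin Record isTopologicalGroup G & Topological G & Group G := {
  mulg_continuous : continuous (fun p : G * G => (p.1 * p.2)%g);
  invg_continuous : continuous (fun x : G => (x^-1)%g)
}.

(* The distinguished point is arbitrary: it is there only because measurable
   types are pointed, and it plays no other role. *)
#[short(type="topGroupType")]
HB.structure Definition TopologicalGroup :=
  {G of PointedTopological G & Group G & isTopologicalGroup G}.

Definition borel (G : topGroupType) := g_sigma_algebraType (@open G).

(* Left invariant Radon probability measure. *)
Definition haar_probability (R : realType) (G : topGroupType)
    (mu : probability (borel G) R) : Prop :=
  [/\ forall (x : G) (A : set G), measurable (A : set (borel G)) ->
        mu [set (x * y)%g | y in A] = mu A,
      forall A : set G, measurable (A : set (borel G)) ->
        mu A = ereal_inf [set mu U | U in [set U : set G | open U /\ A `<=` U]] &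
      forall U : set G, open U ->
        mu U = ereal_sup [set mu K | K in [set K : set G | compact K /\ K `<=` U]]].

(* The norm of a normed module over [R[i]] takes its values in [R[i]]; they are
   nonnegative reals, read here in [R]. *)
Definition rnorm (R : realType) (E : normedModType R[i]) (u : E) : R :=
  complex.Re `|u|.

Section Bochner.
Context {R : realType} {d : measure_display} {T : measurableType d}.
Context {E : completeNormedModType R[i]} (mu : probability T R).

Definition simple_fun (h : T -> E) : Prop :=
  finite_set (range h) /\ forall v, measurable (h @^-1` [set v]).

Definition simple_integral (h : T -> E) : E :=
  \sum_(v \in range h) (fine (mu (h @^-1` [set v])))%:C *: v.

Definition strongly_measurable (f : T -> E) : Prop :=
  exists h : nat -> T -> E, (forall n, simple_fun (h n)) /\
    {ae mu, forall x, h n x @[n --> \oo] --> f x}.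

Definition is_bochner_integral (f : T -> E) (v : E) : Prop :=
  exists h : nat -> T -> E,
    [/\ forall n, simple_fun (h n),
        {ae mu, forall x, h n x @[n --> \oo] --> f x},
        (\int[mu]_x (rnorm (f x - h n x))%:E)%E @[n --> \oo] --> 0%E &
        simple_integral (h n) @[n --> \oo] --> v].

(* Junk value 0 when f is not Bochner integrable. *)
Definition bochner_integral (f : T -> E) : E :=
  xget 0 [set v | is_bochner_integral f v].

Definition L2_fun (f : T -> E) : Prop :=
  strongly_measurable f /\ (\int[mu]_x (rnorm (f x) ^+ 2)%:E < +oo)%E.

End Bochner.

(* {dot H for Num.conj} is linear in the first variable and conjugate linear in
   the second one. *)
Record hilbertSpace (R : realType) := HilbertSpace {
  hilbert_sort :> completeNormedModType R[i];
  inner : {dot hilbert_sort for Num.conj};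
  inner_norm : forall u, inner u u = `|u| ^+ 2
}.

Section Hilbert.
Context {R : realType}.

Definition unitary_map (H K : hilbertSpace R) (U : H -> K) : Prop :=
  [/\ linear U,
      forall u v, inner K (U u) (U v) = inner H u v &
      forall w, exists u, U u = w].

Definition adjoint (H : hilbertSpace R) (A : H -> H) (xi : H) : H :=
  xget 0 [set w | forall v, inner H w v = inner H xi (A v)].

Definition orthonormal_basis (H : hilbertSpace R) (n : nat) (xi : 'I_n -> H) :
    Prop :=
  (forall i j, inner H (xi i) (xi j) = (i == j)%:R) /\
  (forall v, exists c : 'I_n -> R[i], v = \sum_(i < n) c i *: xi i).

End Hilbert.

(* Continuity is strong continuity. *)
Record unitaryRep (R : realType) (G : topGroupType) := UnitaryRep {
  rep_space : hilbertSpace R;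
  rep_op :> G -> rep_space -> rep_space;
  rep_unitary : forall x, unitary_map (rep_op x);
  rep_mul : forall x y v, rep_op (x * y)%g v = rep_op x (rep_op y v);
  rep_continuous : forall v, continuous (fun x => rep_op x v)
}.

Section Representations.
Context {R : realType} {G : topGroupType}.

Definition irreducible_rep (pi : unitaryRep R G) : Prop :=
  (exists v : rep_space pi, v <> 0) /\
  forall W : set (rep_space pi), closed W -> W 0 ->
    (forall (a : R[i]) u v, W u -> W v -> W (a *: u + v)) ->
    (forall x u, W u -> W (pi x u)) ->
    W = [set 0] \/ W = setT.

Definition equivalent_rep (pi rho : unitaryRep R G) : Prop :=
  exists U : rep_space pi -> rep_space rho,
    unitary_map U /\ forall x v, U (pi x v) = rho x (U v).

End Representations.

(* The unitary dual, presented by the fixed choice of representatives: an index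
   type in bijection with the equivalence classes of irreducible
   representations, on Hilbert spaces of arbitrary dimension. *)
Record unitaryDual (R : realType) (G : topGroupType) := UnitaryDual {
  dual_sort :> choiceType;
  dual_rep : dual_sort -> unitaryRep R G;
  dual_irreducible : forall sigma, irreducible_rep (dual_rep sigma);
  dual_inj : forall sigma tau,
    equivalent_rep (dual_rep sigma) (dual_rep tau) -> sigma = tau;
  dual_surj : forall pi : unitaryRep R G, irreducible_rep pi ->
    exists sigma, equivalent_rep (dual_rep sigma) pi;
  dual_dim : dual_sort -> nat;
  dual_basis : forall sigma, 'I_(dual_dim sigma) -> rep_space (dual_rep sigma);
  dual_basisP : forall sigma, orthonormal_basis (@dual_basis sigma)
}.

Arguments dual_basis {R G u} sigma i.

Section Sobolev.
Context {R : realType} {G : topGroupType} {E : completeNormedModType R[i]}.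
Variables (mu : probability (borel G) R) (Gh : unitaryDual R G).

Definition fourier (f : G -> E) (sigma : Gh)
    (xi eta : rep_space (dual_rep sigma)) : E :=
  bochner_integral mu (fun x : borel G =>
    inner (rep_space (dual_rep sigma)) (adjoint (dual_rep sigma x) xi) eta
      *: f x).

Definition sobolev_norm (gamma : Gh -> R) (s : R) (f : G -> E) : \bar R :=
  sqrte (\esum_(sigma in [set: Gh])
    ((dual_dim sigma)%:R * (1 + gamma sigma ^+ 2) `^ s *
     \sum_(i < dual_dim sigma) \sum_(j < dual_dim sigma)
       rnorm (fourier f (dual_basis sigma j) (dual_basis sigma i)) ^+ 2)%:E)%E.

(* Functions rather than a.e. classes: [fourier], [L2_fun] and [sobolev_norm]
   do not see null sets. *)
Definition sobolev (gamma : Gh -> R) (s : R) : set (G -> E) :=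
  [set f | L2_fun mu (f : borel G -> E) /\ (sobolev_norm gamma s f < +oo)%E].

Definition sup_norm (g : G -> E) : \bar R :=
  ereal_sup (range (fun x => (rnorm (g x))%:E)).

(* A space F of a.e. classes, given by an a.e. invariant set of functions, with
   norm N. *)
Definition continuously_embedded_in_C (F : set (G -> E))
    (N : (G -> E) -> \bar R) : Prop :=
  (forall f, F f -> exists g : G -> E,
     continuous g /\ {ae mu, forall x : borel G, f x = g x}) /\
  exists2 C : R, 0 <= C & forall f g : G -> E, F f -> continuous g ->
     {ae mu, forall x : borel G, f x = g x} -> (sup_norm g <= C%:E * N f)%E.

End Sobolev.

(* Main.v *)
(* Peter-Weyl, followed by summation of the Fourier series.  Convolution with a
   nonnegative symmetric continuous kernel is a selfadjoint operator on C(G),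
   compact by equicontinuity, so on the functions orthogonal to all matrix
   coefficients it is zero or has an eigenvector; the eigenspace is
   translation-stable and finite dimensional by Bessel's inequality, and a
   minimal stable subspace of it is an irreducible representation whose
   coefficients are not orthogonal to it, a contradiction.  Kernels concentrated
   near 1 then show that the matrix coefficients are uniformly dense, so, by
   regularity of the Haar measure, an integrable E-valued function with vanishing
   Fourier coefficients is null.  With w = (1 + gamma^2)^s, the Cauchy-Schwarz
   inequality bounds the sum of the norms of the terms of the Fourier series of f
   by (sum d^3 / w)^(1/2) times the Sobolev norm of f.  The series therefore
   converges uniformly, to a continuous function which by Schur orthogonality has
   the Fourier coefficients of f, hence equals f a.e. *)
Require Import Defs.
From HB Require Import structures.
From mathcomp Require Import all_boot all_order all_algebra.
From mathcomp Require Import all_classical all_reals all_analysis.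
From mathcomp Require Import complex finmap measurable_realfun.
From mathcomp Require Import ring lra.

Set Implicit Arguments.
Unset Strict Implicit.
Unset Printing Implicit Defensive.

Import Order.TTheory GRing.Theory Num.Theory.
Import numFieldNormedType.Exports HBNNSimple.

Local Open Scope classical_set_scope.
Local Open Scope ring_scope.
Local Open Scope complex_scope.

(** The Hilbert space arguments take place in the space of continuous functions with the inner
    product [ip], which is not complete; what replaces completeness is that convolution turns a
    bound in the norm of [ip] into a uniform bound and equicontinuity. As [G] need not be
    metrizable, simple approximations come from finite covers, cluster points come from
    ultrafilters, and Fubini's theorem is proved for continuous kernels. The eigenvalue problem is
    solved for the square of the convolution operator, so that no sign of an eigenvalue has to be
    chosen. For a Banach-valued function, vanishing is obtained by comparing its norm with its
    distance to simple functions. Matrix coefficients appear conjugated because the adjoint in the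
    Fourier transform conjugates them. The Cauchy-Schwarz inequality is used in the form
    [t * a + b / t] for all [t > 0]: [t = 1] supplies a summable majorant, and a well-chosen [t]
    supplies the constant of the embedding. *)

Lemma complexE_ge0 (R : realType) (z : R[i]) : 0 <= z -> z = (complex.Re z)%:C.
Proof. by case: z => a b; rewrite lecE /= => /andP[/eqP -> _]. Qed.

Definition cabs (R : realType) (z : R[i]) : R := complex.Re `|z|.

(** * Norms and moduli read as real numbers *)

Section RealNorm.
Context {R : realType} {E : normedModType R[i]}.
Implicit Types (u v : E) (a : R[i]).

Lemma rnormE u : (rnorm u)%:C = `|u|.
Proof. by rewrite /rnorm -complexE_ge0. Qed.

Lemma cabsE a : (cabs a)%:C = `|a|.
Proof. by rewrite /cabs -complexE_ge0. Qed.

Lemma rnorm_ge0 u : 0 <= rnorm u.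
Proof. by rewrite -ler0c rnormE. Qed.

Lemma rnormD u v : rnorm (u + v) <= rnorm u + rnorm v.
Proof. by rewrite -lecR rmorphD /= !rnormE ler_normD. Qed.

Lemma rnormZ a u : rnorm (a *: u) = cabs a * rnorm u.
Proof.
by apply: complexI; rewrite rmorphM /= rnormE cabsE rnormE normrZ.
Qed.

Lemma rnorm0 : rnorm (0 : E) = 0.
Proof. by rewrite /rnorm normr0. Qed.

Lemma rnormN u : rnorm (- u) = rnorm u.
Proof. by rewrite /rnorm normrN. Qed.

Lemma rnormB u v : rnorm (u - v) <= rnorm u + rnorm v.
Proof. by rewrite (le_trans (rnormD _ _))// rnormN. Qed.

Lemma rnorm_distC u v : rnorm (u - v) = rnorm (v - u).
Proof. by rewrite -rnormN opprB. Qed.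

Lemma rnorm_distD w u v : rnorm (u - v) <= rnorm (u - w) + rnorm (w - v).
Proof. by rewrite (le_trans _ (rnormD _ _))// addrA subrK. Qed.

Lemma rnorm_distB u v : `|rnorm u - rnorm v| <= rnorm (u - v).
Proof.
rewrite ler_distl; apply/andP; split.
- rewrite lerBlDr -{1}(subrK u v) (le_trans (rnormD _ _))//.
  by rewrite rnorm_distC addrC.
- by rewrite -{1}(subrK v u) addrC (le_trans (rnormD _ _))// addrC.
Qed.

Lemma rnorm_eq0 u : rnorm u = 0 -> u = 0.
Proof. by move=> u0; apply/eqP; rewrite -normr_eq0 -rnormE u0. Qed.

Lemma rnorm_small_eq0 u : (forall e : R, 0 < e -> rnorm u <= e) -> u = 0.
Proof.
move=> h; apply: rnorm_eq0; apply/eqP; rewrite eq_le rnorm_ge0 andbT.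
by apply/ler_addgt0Pl => e e0; rewrite addr0 h.
Qed.

Lemma rnorm_sum I (r : seq I) (P : pred I) (F : I -> E) :
  rnorm (\sum_(i <- r | P i) F i) <= \sum_(i <- r | P i) rnorm (F i).
Proof.
elim/big_ind2 : _ => [|x u y v xu yv|//]; first by rewrite rnorm0.
by rewrite (le_trans (rnormD _ _))// lerD.
Qed.

Lemma gt0_complexR (e : R[i]) : 0 < e -> 0 < complex.Re e /\ e = (complex.Re e)%:C.
Proof.
move=> e0; have eE := complexE_ge0 (ltW e0); split=> //.
by rewrite -ltcR -eE.
Qed.

Lemma cvg_rnormP (T : Type) (F : set_system T) (FF : Filter F) (f : T -> E) u :
  (f @ F --> u) <->
  (forall e : R, 0 < e -> \forall x \near F, rnorm (u - f x) < e).
Proof.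
split=> [/cvgrPdist_lt fu e e0|fu].
- have := fu e%:C; rewrite ltcR => /(_ e0); apply: filterS => x.
  by rewrite -rnormE ltcR.
- apply/cvgrPdist_lt => e /gt0_complexR[e0 ->].
  by apply: filterS (fu _ e0) => x; rewrite -rnormE ltcR.
Qed.

End RealNorm.

Lemma continuous_rnormP (R : realType) (E : normedModType R[i])
    (T : topologicalType) (f : T -> E) :
  continuous f <-> (forall x (e : R), 0 < e ->
    \forall y \near x, rnorm (f x - f y) < e).
Proof.
split=> [fc x|fc x]; first by have /cvg_rnormP := fc x.
by apply/cvg_rnormP; exact: fc.
Qed.

Section Cabs.
Context {R : realType}.
Implicit Types (a b : R[i]).

Lemma cabs_ge0 a : 0 <= cabs a.
Proof. by rewrite -ler0c cabsE. Qed.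

Lemma cabsM a b : cabs (a * b) = cabs a * cabs b.
Proof. by apply: complexI; rewrite rmorphM /= !cabsE normrM. Qed.

Lemma cabsD a b : cabs (a + b) <= cabs a + cabs b.
Proof. by rewrite -lecR rmorphD /= !cabsE ler_normD. Qed.

Lemma cabsN a : cabs (- a) = cabs a.
Proof. by rewrite /cabs normrN. Qed.

Lemma cabs_le_sqr a (M : R) : 0 <= M -> (cabs a <= M) = (cabs a ^+ 2 <= M ^+ 2).
Proof. by move=> M0; rewrite ler_pXn2r// nnegrE cabs_ge0. Qed.

Lemma cabsR (r : R) : cabs r%:C = `|r|.
Proof. by apply: complexI; rewrite cabsE normc_def /= expr0n addr0 sqrtr_sqr. Qed.

Lemma cabs_conj a : cabs (Num.conj a) = cabs a.
Proof. by rewrite /cabs norm_conjC. Qed.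

Lemma cabs2E a : ((cabs a ^+ 2)%:C : R[i]) = a * Num.conj a.
Proof. by rewrite rmorphXn /= cabsE normCK. Qed.

Lemma ler_Re_cabs a : `|complex.Re a| <= cabs a.
Proof.
rewrite -lecR cabsE normc_def lecR; case: a => x y /=.
by rewrite -sqrtr_sqr ler_wsqrtr// lerDl sqr_ge0.
Qed.

Lemma ler_Im_cabs a : `|complex.Im a| <= cabs a.
Proof.
rewrite -lecR cabsE normc_def lecR; case: a => x y /=.
by rewrite -sqrtr_sqr ler_wsqrtr// lerDr sqr_ge0.
Qed.

Lemma cabs_le_ReIm a : cabs a <= `|complex.Re a| + `|complex.Im a|.
Proof.
rewrite -lecR cabsE normc_def lecR; case: a => x y /=.
rewrite -(ler_pXn2r (_ : 0 < 2)%N)// ?nnegrE ?sqrtr_ge0 ?addr_ge0//.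
rewrite sqr_sqrtr ?addr_ge0 ?sqr_ge0// sqrrD !real_normK ?num_real//.
by rewrite addrAC ler_wpDr// mulrn_wge0// mulr_ge0.
Qed.

End Cabs.

(* [R[i]^o] has no complete normed module structure in the library, and the
   key [GRing.regular] is taken by [R^o], hence an alias. *)
Definition cpx (R : realType) : Type := R[i]^o.
HB.instance Definition _ (R : realType) := NormedModule.copy (cpx R) R[i]^o.

Lemma rnorm_cpx (R : realType) (a : cpx R) : rnorm a = cabs (a : R[i]).
Proof. by []. Qed.

Lemma cpx_complete (R : realType) (F : set_system (cpx R)) :
  ProperFilter F -> cauchy F -> cvg F.
Proof.
move=> FF /cauchyP Fc.
have cvgreal (p : cpx R -> R) :
    (forall a b, `|p a - p b| <= cabs (a - b : R[i])) -> cvg (p @ F).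
  move=> pB; apply/cauchy_cvgP/cauchy_exP => e e0.
  have [a Fa] : exists a, F (ball a (e%:C : R[i]));
    first by apply: Fc; rewrite ltcR.
  exists (p a); apply: (@filterS _ F _ _ _ _ Fa) => b.
  rewrite -ball_normE /= => ab.
  rewrite /ball/= (le_lt_trans (pB _ _))//.
  by rewrite -ltcR cabsE.
have := cvgreal (fun a => complex.Re (a : R[i])).
have := cvgreal (fun a => complex.Im (a : R[i])).
move=> cIm cRe.
have {}cIm : cvg ((fun a : cpx R => complex.Im (a : R[i])) @ F).
  by apply: cIm => a b; rewrite -raddfB; exact: ler_Im_cabs.
have {}cRe : cvg ((fun a : cpx R => complex.Re (a : R[i])) @ F).
  by apply: cRe => a b; rewrite -raddfB; exact: ler_Re_cabs.
move: cRe cIm => /cvg_ex[/= x Fx] /cvg_ex[/= y Fy].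
apply/cvg_ex; exists ((x +i* y) : cpx R).
apply/(@cvg_rnormP R (cpx R) _ F _ id) => e e0.
have e20 : 0 < e / 2 by rewrite divr_gt0.
move/cvgrPdist_lt : Fx => /(_ _ e20) Fx.
move/cvgrPdist_lt : Fy => /(_ _ e20) Fy.
near=> a; rewrite rnorm_cpx (le_lt_trans (cabs_le_ReIm _))//.
rewrite (splitr e) ltrD//.
- rewrite (_ : complex.Re _ = x - complex.Re (a : R[i])); first by near: a.
  by case: (a) => ? ?.
- rewrite (_ : complex.Im _ = y - complex.Im (a : R[i])); first by near: a.
  by case: (a) => ? ?.
Unshelve. all: by end_near. Qed.

HB.instance Definition _ (R : realType) :=
  Uniform_isComplete.Build (cpx R) (@cpx_complete R).

(** * The Bochner integral *)

Section LowerIntegral.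
Local Open Scope ereal_scope.
Context {R : realType} {d : measure_display} {T : measurableType d}.
Variable mu : {measure set T -> \bar R}.

(* No measurability: the integral of a nonnegative function is the supremum of
   the integrals of the simple functions below it. *)
Lemma ae_le_lower_integral (F G : T -> \bar R) :
  (forall x, 0 <= F x) -> (forall x, 0 <= G x) ->
  {ae mu, forall x, F x <= G x} -> \int[mu]_x F x <= \int[mu]_x G x.
Proof.
move=> F0 G0 [N [mN N0 NFG]].
rewrite !ge0_integralTE//; apply: ge_ereal_sup => _ [h hF <-].
pose h' := mul_nnsfun h (indic_nnsfun R (measurableC mN)).
have -> : sintegral mu h = sintegral mu h'.
  rewrite -!integralT_nnsfun; apply: ge0_ae_eq_integral => //.
  - exact/measurable_EFinP/measurable_funTS.
  - exact/measurable_EFinP/measurable_funTS.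
  - by move=> x _; rewrite lee_fin.
  - by move=> x _; rewrite lee_fin.
  - exists N; split=> // x /=; apply: contra_notP => Nx _.
    by rewrite /= /mindic indicE mem_set//= mulr1.
apply: ereal_sup_ubound; exists h' => // x /=.
rewrite /mindic indicE; have [Nx|Nx] := pselect (N x).
  by rewrite memNset/= ?mulr0//; apply.
rewrite mem_set//= mulr1 (le_trans (hF x))//.
by apply: contrapT => FG; apply: Nx; apply: NFG.
Qed.

Lemma ae_eq_lower_integral (F G : T -> \bar R) :
  (forall x, 0 <= F x) -> (forall x, 0 <= G x) ->
  {ae mu, forall x, F x = G x} -> \int[mu]_x F x = \int[mu]_x G x.
Proof.
move=> F0 G0 FG; apply/eqP; rewrite eq_le; apply/andP; split;
  by apply: ae_le_lower_integral => //; apply: filterS FG => x ->.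
Qed.

End LowerIntegral.

(** This is [simple_fun] with values in any type: Booleans, indices, points of [G], and above all
    pairs. A simple map through which several functions factor plays the role of a common
    partition. *)
Definition fsimple d (T : measurableType d) (X : Type) (h : T -> X) : Prop :=
  finite_set (range h) /\ forall v, measurable (h @^-1` [set v]).

Section FSimple.
Context {R : realType} {d : measure_display} {T : measurableType d}.
Variable mu : probability T R.

Lemma fsimple_preimage (X : Type) (h : T -> X) (A : set X) :
  fsimple h -> measurable (h @^-1` A).
Proof.
move=> [fh mh].
rewrite (_ : _ @^-1` _ = \bigcup_(v in range h `&` A) (h @^-1` [set v])).
  by apply: fin_bigcup_measurable => // ; exact: finite_setIl.
apply/seteqP; split => x /=; last by move=> [v [_ Av]] /= ->.
by move=> Ahx; exists (h x) => //; split => //; exists x.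
Qed.

Lemma fsimple_comp (X Y : Type) (h : T -> X) (F : X -> Y) :
  fsimple h -> fsimple (F \o h).
Proof.
move=> hh; split; last by move=> v; exact: (fsimple_preimage (F @^-1` [set v])).
rewrite (_ : range _ = F @` range h); last by rewrite image_comp.
by apply: finite_image; have [] := hh.
Qed.

Lemma fsimple_pair (X Y : Type) (h : T -> X) (k : T -> Y) :
  fsimple h -> fsimple k -> fsimple (fun x => (h x, k x)).
Proof.
move=> [fh mh] [fk mk]; split.
  apply: (sub_finite_set (B := range h `*` range k)); last exact: finite_setX.
  by move=> _ [x _ <-]; split; exists x.
move=> [v w]; rewrite (_ : _ @^-1` _ = h @^-1` [set v] `&` k @^-1` [set w]).
  exact: measurableI.
by apply/seteqP; split => x /= => [[-> ->]|[-> ->]].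
Qed.

Lemma fsimple_cst (X : Type) (c : X) : fsimple (fun _ : T => c).
Proof.
split; first by apply: (sub_finite_set _ (finite_set1 c)) => _ [x _ <-].
move=> v; have [->|cv] := pselect (c = v).
  by rewrite (_ : _ @^-1` _ = setT)//; apply/seteqP; split.
by rewrite (_ : _ @^-1` _ = set0)//; apply/seteqP; split.
Qed.

Lemma fsimple_bool (A : set T) : measurable A -> fsimple (fun x => `[<A x>]).
Proof.
move=> mA; split; first exact: finite_finset.
case.
  rewrite (_ : _ @^-1` _ = A)//.
  by apply/seteqP; split => x /= => [/asboolP//|Ax]; apply/asboolP.
rewrite (_ : _ @^-1` _ = ~` A); first exact: measurableC.
by apply/seteqP; split => x /= => [/negbT/asboolPn//|Ax]; apply/negbTE/asboolPn.
Qed.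

Lemma fine_muD_sum (X : choiceType) (h : T -> X) (P : pred X) : fsimple h ->
  fine (mu [set x | P (h x)]) =
  \sum_(v <- fset_set (range h) | P v) fine (mu (h @^-1` [set v])).
Proof.
move=> hh; have [fh mh] := hh.
rewrite (_ : [set x | _] =
    \bigcup_(v in range h `&` [set v | P v]) (h @^-1` [set v])); last first.
  apply/seteqP; split => x /=; last by move=> [v [_ Av]] /= ->.
  by move=> Ahx; exists (h x) => //; split => //; exists x.
have fI : finite_set (range h `&` [set v | P v]) by exact: finite_setIl.
rewrite measure_fin_bigcup//; last first.
  by move=> v w _ _ [x [/= <- <-]].
rewrite fsbig_mkcondr fsbig_finite//= -sum_fine; last first.
  by move=> v _; rewrite /patch; case: ifP => // _; rewrite fin_num_measure.
rewrite [RHS]big_mkcond/=; apply: eq_bigr => v _.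
rewrite /patch; case: (boolP (P v)) => Pv; first by rewrite mem_set.
by rewrite memNset//=; exact/negP.
Qed.

Lemma integral_fsimple (X : choiceType) (h : T -> X) (g : X -> R) :
  fsimple h -> (forall v, 0 <= g v) ->
  (\int[mu]_x (g (h x))%:E)%E =
  (\sum_(v <- fset_set (range h)) fine (mu (h @^-1` [set v])) * g v)%:E.
Proof.
move=> hh g0; have [fh mh] := hh.
transitivity (\int[mu]_x \sum_(v <- fset_set (range h))
    (g v * \1_(h @^-1` [set v]) x)%:E)%E.
  apply: eq_integral => x _; rewrite sumEFin; congr EFin.
  rewrite (bigD1_seq (h x))//=; last first.
    by rewrite in_fset_set// mem_set//; exists x.
  rewrite indicE mem_set//= mulr1 big1 ?addr0// => v vx.
  by rewrite indicE memNset ?mulr0// => /= hv; rewrite hv eqxx in vx.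
rewrite ge0_integral_sum//; last 2 first.
- move=> v; apply/measurable_EFinP; apply: measurable_funM => //.
- by move=> v x _; rewrite lee_fin mulr_ge0.
rewrite -sumEFin; apply: eq_bigr => v _.
under eq_integral do rewrite EFinM.
rewrite ge0_integralZl//; last 2 first.
- by apply/measurable_EFinP.
- by rewrite lee_fin.
rewrite integral_indic// setIT mulrC EFinM fineK//.
by rewrite fin_num_measure.
Qed.

Context {E : completeNormedModType R[i]}.

(** Summing over the values of [h] rather than those of [F \o h] integrates several functions of one
    simple map over the same partition; linearity follows by taking a pair for [h]. *)
Lemma simple_integral_comp (X : choiceType) (h : T -> X) (F : X -> E) :
  fsimple h -> simple_integral mu (F \o h) =
  \sum_(v <- fset_set (range h)) (fine (mu (h @^-1` [set v])))%:C *: F v.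
Proof.
move=> hh; have hFh := fsimple_comp F hh.
rewrite /simple_integral fsbig_finite//=; last by have [] := hFh.
under eq_bigr => w _.
  rewrite (_ : _ @^-1` _ = [set x | F (h x) == w]); last first.
    by apply/seteqP; split => x /= => [->//|/eqP].
  rewrite (fine_muD_sum (fun v => F v == w) hh) rmorph_sum scaler_suml /=.
  over.
rewrite (exchange_big_dep predT)//=; apply: eq_big_seq => v.
rewrite in_fset_set; last by have [] := hh.
move=> /set_mem[x _ <-].
rewrite big_mkcond (bigD1_seq (F (h x)) _ (fset_uniq _))//=; last first.
  rewrite in_fset_set; last by have [] := hFh.
  by rewrite mem_set//; exists x.
rewrite eqxx big1 ?addr0// => w /negbTE.
by rewrite eq_sym => ->.
Qed.

Lemma rnorm_simple_integral (X : choiceType) (h : T -> X) (F : X -> E) :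
  fsimple h ->
  ((rnorm (simple_integral mu (F \o h)))%:E <=
   \int[mu]_x (rnorm (F (h x)))%:E)%E.
Proof.
move=> hh; rewrite simple_integral_comp//.
rewrite (integral_fsimple hh (g := fun v => rnorm (F v))) => [|v]; last first.
  exact: rnorm_ge0.
rewrite lee_fin (le_trans (rnorm_sum _ _ _))//; apply: ler_sum => v _.
by rewrite rnormZ cabsR ger0_norm// fine_ge0.
Qed.

Lemma simple_integral_linear (a : R[i]) (h k : T -> E) :
  fsimple h -> fsimple k ->
  simple_integral mu (fun x => a *: h x + k x) =
  a *: simple_integral mu h + simple_integral mu k.
Proof.
move=> hh hk; have hp := fsimple_pair hh hk.
have -> : simple_integral mu h =
    simple_integral mu (fst \o (fun x => (h x, k x))) by [].
have -> : simple_integral mu k =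
    simple_integral mu (snd \o (fun x => (h x, k x))) by [].
have -> : (fun x => a *: h x + k x) =
    (fun p => a *: p.1 + p.2) \o (fun x => (h x, k x)) by [].
rewrite !simple_integral_comp// scaler_sumr -big_split/=.
by apply: eq_bigr => p _; rewrite scalerDr !scalerA mulrC.
Qed.

End FSimple.

Lemma ge0_cvge0P (R : realType) (u : nat -> \bar R) : (forall n, (0 <= u n)%E) ->
  (u @ \oo --> 0%E) <->
  (forall e : R, 0 < e -> \forall n \near \oo, (u n <= e%:E)%E).
Proof.
move=> u0; split=> [/fine_cvgP[ufin /cvgr0Pnorm_le u_0] e e0|ue].
  near=> n; have un : u n \is a fin_num by near: n.
  rewrite -(fineK un) lee_fin (le_trans (ler_norm _))//.
  by near: n; exact: u_0.
have ufin : \forall n \near \oo, u n \is a fin_num.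
  apply: filterS (ue 1 ltr01) => n un.
  by rewrite ge0_fin_numE// (le_lt_trans un)// ltry.
apply/fine_cvgP; split => //; apply/cvgr0Pnorm_le => e e0.
near=> n; rewrite /= ger0_norm ?fine_ge0// -lee_fin fineK; first by near: n; exact: ue.
by near: n.
Unshelve. all: by end_near. Qed.

(** * Bochner integrals: linearity, norm bound, existence *)

Section BochnerTheory.
Context {R : realType} {d : measure_display} {T : measurableType d}.
Variable mu : probability T R.
Context {E : completeNormedModType R[i]}.
Implicit Types (f g : T -> E) (h k : nat -> T -> E) (v w : E).

(** Convergence holds everywhere here. A strongly measurable function is changed on a null set to
    reach this form, after which pointwise arguments carry no exceptional set. *)
Definition limsimple f : Prop := exists h, (forall n, fsimple (h n)) /\
  forall x, h n x @[n --> \oo] --> f x.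

Definition inorm f : \bar R := (\int[mu]_x (rnorm (f x))%:E)%E.

Lemma inorm_ge0 f : (0 <= inorm f)%E.
Proof. by apply: integral_ge0 => x _; rewrite lee_fin rnorm_ge0. Qed.

Lemma ae_eq_inorm f g : {ae mu, forall x, f x = g x} -> inorm f = inorm g.
Proof.
move=> fg; apply: ae_eq_lower_integral => [x|x|].
- by rewrite lee_fin rnorm_ge0.
- by rewrite lee_fin rnorm_ge0.
- by apply: filterS fg => x ->.
Qed.

Lemma fsimple_limsimple (f : T -> E) : fsimple f -> limsimple f.
Proof. by move=> sf; exists (fun=> f); split => // x; exact: cvg_cst. Qed.

Lemma fsimple_bounded f : fsimple f -> exists2 M : R, 0 < M & forall x, rnorm (f x) <= M.
Proof.
move=> [fh _]; exists (\sum_(v <- fset_set (range f)) rnorm v + 1).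
  by rewrite ltr_wpDl// sumr_ge0// => v _; exact: rnorm_ge0.
move=> x; rewrite (bigD1_seq (f x) _ (fset_uniq _))/=; last first.
  by rewrite in_fset_set// mem_set//; exists x.
by rewrite -addrA lerDl addr_ge0// sumr_ge0// => v _; exact: rnorm_ge0.
Qed.

Lemma fsimple_linear (a : R[i]) f g : fsimple f -> fsimple g ->
  fsimple (fun x => a *: f x + g x).
Proof.
move=> sf sg.
exact: (fsimple_comp (fun p : E * E => a *: p.1 + p.2) (fsimple_pair sf sg)).
Qed.

Lemma limsimple_linear (a : R[i]) f g : limsimple f -> limsimple g ->
  limsimple (fun x => a *: f x + g x).
Proof.
move=> [h [sh hf]] [k [sk kg]]; exists (fun n x => a *: h n x + k n x).
split=> [n|x]; first exact: fsimple_linear.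
by apply: cvgD => //; exact: cvgZr.
Qed.

Lemma limsimpleB f g : limsimple f -> limsimple g ->
  limsimple (fun x => f x - g x).
Proof.
move=> lf lg; rewrite (_ : (fun _ => _) = (fun x => (-1) *: g x + f x)).
  exact: limsimple_linear.
by apply/funext => x; rewrite scaleN1r addrC.
Qed.

Lemma measurable_fsimple (f : T -> R) : fsimple f -> measurable_fun setT f.
Proof. by move=> sf _ Y _; rewrite setTI; exact: fsimple_preimage. Qed.

Lemma cvg_rnorm (F : set_system nat) {FF : Filter F} (u : nat -> E) (l : E) :
  u @ F --> l -> rnorm (u n) @[n --> F] --> rnorm l.
Proof.
move=> /cvg_rnormP ul; apply/cvgrPdist_lt => e /ul; apply: filterS => n.
exact/le_lt_trans/rnorm_distB.
Qed.

Lemma measurable_rnorm f : limsimple f -> measurable_fun setT (fun x => rnorm (f x)).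
Proof.
move=> [h [sh hf]]; apply: (measurable_fun_cvg (h := fun n x => rnorm (h n x))).
  by move=> n; apply: measurable_fsimple; exact: (fsimple_comp (@rnorm R E)).
by move=> x _; apply: cvg_rnorm; exact: hf.
Qed.

Lemma measurable_ernorm f : limsimple f ->
  measurable_fun setT (fun x => (rnorm (f x))%:E).
Proof. by move=> lf; apply/measurable_EFinP; exact: measurable_rnorm. Qed.

Lemma le_inorm f g : limsimple f -> limsimple g ->
  (forall x, rnorm (f x) <= rnorm (g x)) -> (inorm f <= inorm g)%E.
Proof.
move=> lf lg fg; apply: ae_le_lower_integral => [x|x|].
- by rewrite lee_fin rnorm_ge0.
- by rewrite lee_fin rnorm_ge0.
- by apply: aeW => x; rewrite lee_fin.
Qed.

Lemma le_inorm_lin (a b : R) f g1 g2 : 0 <= a -> 0 <= b ->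
  limsimple g1 -> limsimple g2 ->
  (forall x, rnorm (f x) <= a * rnorm (g1 x) + b * rnorm (g2 x)) ->
  (inorm f <= a%:E * inorm g1 + b%:E * inorm g2)%E.
Proof.
move=> a0 b0 l1 l2 fg.
rewrite -!ge0_integralZl//; try by [exact: measurable_ernorm|
  move=> x _; rewrite lee_fin rnorm_ge0].
rewrite -ge0_integralD//; last 4 first.
- by move=> x _; rewrite lee_fin mulr_ge0// rnorm_ge0.
- by apply: measurable_funeM; exact: measurable_ernorm.
- by move=> x _; rewrite lee_fin mulr_ge0// rnorm_ge0.
- by apply: measurable_funeM; exact: measurable_ernorm.
apply: ae_le_lower_integral => [x|x|].
- by rewrite lee_fin rnorm_ge0.
- by rewrite lee_fin addr_ge0// mulr_ge0// rnorm_ge0.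
- by apply: aeW => x; rewrite lee_fin.
Qed.

Lemma le_inormD f g1 g2 : limsimple g1 -> limsimple g2 ->
  (forall x, rnorm (f x) <= rnorm (g1 x) + rnorm (g2 x)) ->
  (inorm f <= inorm g1 + inorm g2)%E.
Proof.
move=> l1 l2 fg.
have := @le_inorm_lin 1 1 f g1 g2 ler01 ler01 l1 l2.
by rewrite !mul1e; apply => x; rewrite !mul1r.
Qed.

Definition bochner_approx f h v : Prop :=
  [/\ forall n, fsimple (h n),
      forall x, h n x @[n --> \oo] --> f x,
      inorm (fun x => f x - h n x) @[n --> \oo] --> 0%E &
      simple_integral mu (h n) @[n --> \oo] --> v].

Lemma is_bochner_integral_ae f g v : {ae mu, forall x, f x = g x} ->
  is_bochner_integral mu f v -> is_bochner_integral mu g v.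
Proof.
move=> fg [h [sh hf ih hv]]; exists h; split=> //.
  by apply: filterS2 fg hf => x ->.
apply: cvg_trans ih; apply: near_eq_cvg; apply: nearW => n.
apply: (ae_eq_inorm (f := fun x => f x - h n x)).
by apply: filterS fg => x ->.
Qed.

Lemma fsimple_restrict (A : set T) (f : T -> E) : measurable A -> fsimple f ->
  fsimple (fun x => if `[<A x>] then f x else 0).
Proof.
move=> mA sf.
exact: (fsimple_comp (fun p : bool * E => if p.1 then p.2 else 0)
  (fsimple_pair (fsimple_bool mA) sf)).
Qed.

Lemma strongly_measurableP f : strongly_measurable mu f <->
  exists2 f', limsimple f' & {ae mu, forall x, f x = f' x}.
Proof.
split=> [[h [sh [N [mN N0 hfN]]]]|[f' [h [sh hf']] ff']]; last first.
  by exists h; split => //; apply: filterS ff' => x ->.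
exists (fun x => if `[<(~` N) x>] then f x else 0).
  exists (fun n x => if `[<(~` N) x>] then h n x else 0); split=> [n|x].
    by apply: (fsimple_restrict (measurableC mN)); exact: sh.
  case: asboolP => [Nx|_]; last exact: cvg_cst.
  by apply: contrapT => hx; apply: Nx; apply: hfN.
exists N; split => // x /=; apply: contra_notP => Nx.
by rewrite asboolT.
Qed.

Lemma simple_integral_ae_eq (h k : T -> E) : fsimple h -> fsimple k ->
  {ae mu, forall x, h x = k x} -> simple_integral mu h = simple_integral mu k.
Proof.
move=> sh sk hk; apply/subr0_eq/rnorm_eq0/eqP.
rewrite eq_le rnorm_ge0 andbT -lee_fin.
have -> : simple_integral mu h - simple_integral mu k =
    simple_integral mu (id \o (fun x => (-1) *: k x + h x)).
  by rewrite simple_integral_linear// scaleN1r addrC.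
apply: (le_trans (rnorm_simple_integral _ _ _)); first exact: fsimple_linear.
rewrite (_ : (\int[mu]_x _)%E = inorm (fun=> 0)).
  by rewrite /inorm rnorm0 integral0.
apply: ae_eq_inorm; apply: filterS hk => x ->.
by rewrite scaleN1r addNr.
Qed.

Lemma is_bochner_integralP f v : is_bochner_integral mu f v <->
  exists f' h, {ae mu, forall x, f x = f' x} /\ bochner_approx f' h v.
Proof.
split=> [[h [sh [N [mN N0 hfN]] ih hv]]|[f' [h [ff' [sh hf ih hv]]]]]; last first.
  apply: is_bochner_integral_ae; first by apply: filterS ff' => x; exact: esym.
  by exists h; split => //; exact: aeW.
(* Setting everything to 0 on the null set [N] turns almost everywhere convergence into convergence
   everywhere and changes no integral. *)
pose r (g : T -> E) x := if `[<(~` N) x>] then g x else 0.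
have re g : {ae mu, forall x, g x = r g x}.
  by exists N; split => // x /=; apply: contra_notP => Nx; rewrite /r asboolT.
have rs n : fsimple (r (h n)) by apply: (fsimple_restrict (measurableC mN)); exact: sh.
exists (r f), (fun n => r (h n)); split => //; split => //.
- move=> x; rewrite /r; case: asboolP => [Nx|_]; last exact: cvg_cst.
  by apply: contrapT => hx; apply: Nx; apply: hfN.
- apply: cvg_trans ih; apply: near_eq_cvg; apply: nearW => n.
  apply: (ae_eq_inorm (f := fun x => f x - h n x)).
  by apply: filterS2 (re f) (re (h n)) => x <- <-.
- apply: cvg_trans hv; apply: near_eq_cvg; apply: nearW => n.
  by apply: simple_integral_ae_eq => //; exact: sh.
Qed.

Lemma bochner_approx_limsimple f h v : bochner_approx f h v -> limsimple f.
Proof. by move=> [sh hf _ _]; exists h. Qed.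

Lemma is_bochner_integral_linear (a : R[i]) f g v w :
  is_bochner_integral mu f v -> is_bochner_integral mu g w ->
  is_bochner_integral mu (fun x => a *: f x + g x) (a *: v + w).
Proof.
move=> /is_bochner_integralP[f' [h [ff' bf]]].
move=> /is_bochner_integralP[g' [k [gg' bg]]].
have lf := bochner_approx_limsimple bf; have lg := bochner_approx_limsimple bg.
case: bf => sh hf /ge0_cvge0P ih hv; case: bg => sk kg /ge0_cvge0P ik kw.
apply/is_bochner_integralP; exists (fun x => a *: f' x + g' x).
exists (fun n x => a *: h n x + k n x); split.
  by apply: filterS2 ff' gg' => x -> ->.
split.
- by move=> n; exact: fsimple_linear.
- by move=> x; apply: cvgD => //; exact: cvgZr.
- apply/ge0_cvge0P => [n|e e0]; first exact: inorm_ge0.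
  have a1 : 0 < cabs a + 1 by rewrite ltr_wpDl// cabs_ge0.
  have e1 : 0 < e / 2 / (cabs a + 1) by rewrite !divr_gt0.
  have e2 : 0 < e / 2 by rewrite divr_gt0.
  near=> n.
  have lh : limsimple (fun x => f' x - h n x).
    by apply: limsimpleB => //; exact: fsimple_limsimple.
  have lk : limsimple (fun x => g' x - k n x).
    by apply: limsimpleB => //; exact: fsimple_limsimple.
  have := @le_inorm_lin (cabs a + 1) 1
    (fun x => a *: f' x + g' x - (a *: h n x + k n x)) _ _ (ltW a1) ler01 lh lk.
  move/(_ _)/le_trans; apply.
    move=> x; rewrite opprD addrACA -scalerBr (le_trans (rnormD _ _))// rnormZ.
    by rewrite mul1r lerD// ler_wpM2r ?rnorm_ge0// lerDl.
  rewrite mul1e [in leRHS](splitr e) (EFinD (e / 2)) leeD//; last by near: n; apply: ik => // n; exact: inorm_ge0.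
  apply: (@le_trans _ _ ((cabs a + 1)%:E * (e / 2 / (cabs a + 1))%:E)%E).
    rewrite lee_pmul2l//; near: n; apply: ih => // n; exact: inorm_ge0.
  by rewrite -EFinM lee_fin mulrC divfK// gt_eqF.
- rewrite (_ : (fun n => _) = (fun n => a *: simple_integral mu (h n) +
      simple_integral mu (k n))).
    by apply: cvgD => //; exact: cvgZr.
  by apply/funext => n; rewrite simple_integral_linear.
Unshelve. all: by end_near. Qed.

Lemma is_bochner_integral_bound f v : is_bochner_integral mu f v ->
  ((rnorm v)%:E <= inorm f)%E.
Proof.
move=> /is_bochner_integralP[f' [h [ff' bf]]]; rewrite (ae_eq_inorm ff').
have lf := bochner_approx_limsimple bf.
case: bf => sh hf /ge0_cvge0P ih /cvg_rnormP hv.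
apply/lee_addgt0Pr => e e0; have e2 : 0 < e / 2 by rewrite divr_gt0.
near \oo => n.
have -> : v = simple_integral mu (h n) + (v - simple_integral mu (h n)).
  by rewrite addrC subrK.
apply: (@le_trans _ _ ((rnorm (simple_integral mu (h n)))%:E + (e / 2)%:E)%E).
  rewrite -EFinD lee_fin (le_trans (rnormD _ _))// lerD2l ltW//.
  by near: n; exact: hv.
rewrite [in leRHS](splitr e) EFinD addeA leeD2r//.
apply: (le_trans (rnorm_simple_integral mu id (sh n))).
apply: (le_trans (@le_inormD (h n) f' (fun x => f' x - h n x) _ _ _)) => //.
- by apply: limsimpleB => //; exact: fsimple_limsimple.
- move=> x; rewrite -{1}(subKr (f' x) (h n x)) (le_trans (rnormB _ _))//.
- by rewrite leeD2l//; near: n; apply: ih => // n; exact: inorm_ge0.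
Unshelve. all: by end_near. Qed.

Lemma is_bochner_integral_unique f v w :
  is_bochner_integral mu f v -> is_bochner_integral mu f w -> v = w.
Proof.
move=> fv fw; apply/subr0_eq/rnorm_eq0/eqP.
rewrite eq_le rnorm_ge0 andbT -lee_fin.
have := is_bochner_integral_bound (is_bochner_integral_linear (-1) fw fv).
rewrite scaleN1r addrC => /le_trans; apply.
rewrite (_ : inorm _ = inorm (fun=> 0)).
  by rewrite /inorm rnorm0 integral0.
by congr inorm; apply/funext => x; rewrite scaleN1r addNr.
Qed.

Lemma bochner_integralE f v :
  is_bochner_integral mu f v -> bochner_integral mu f = v.
Proof.
move=> fv; rewrite /bochner_integral; case: xgetP => [w -> /=|/(_ v)//].
by move/is_bochner_integral_unique; exact.
Qed.

Lemma is_bochner_integral_simple f : fsimple f ->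
  is_bochner_integral mu f (simple_integral mu f).
Proof.
move=> sf; exists (fun=> f); split => //.
- by apply: aeW => x; exact: cvg_cst.
- under eq_fun => n. under eq_integral do rewrite subrr rnorm0. rewrite integral0. over.
  exact: cvg_cst.
- exact: cvg_cst.
Qed.

Definition L1_fun f : Prop := strongly_measurable mu f /\ (inorm f < +oo)%E.

(** Bochner's criterion. Each approximant is cut to 0 where its norm exceeds twice that of the
    limit, which provides the dominating function [3 * rnorm (f' x)]; by dominated convergence the
    simple integrals are then Cauchy, and [E] is complete. *)
Lemma L1_is_bochner_integral f : L1_fun f ->
  is_bochner_integral mu f (bochner_integral mu f).
Proof.
move=> [/strongly_measurableP[f' lf' ff']]; rewrite (ae_eq_inorm ff') => if'.
suff [v bv] : exists v, is_bochner_integral mu f v by rewrite (bochner_integralE bv).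
suff [v bv] : exists v, is_bochner_integral mu f' v.
  exists v; apply: is_bochner_integral_ae bv.
  by apply: filterS ff' => x; exact: esym.
case: (lf') => h [sh hf].
have mf' := measurable_rnorm lf'.
pose A n := [set x | rnorm (h n x) <= 2 * rnorm (f' x)].
have mA n : measurable (A n).
  rewrite -[A n]setTI; apply: measurable_fun_le => //.
    by apply: measurable_rnorm; exact: fsimple_limsimple.
  by apply: measurable_funM.
pose k n x := if `[<A n x>] then h n x else 0.
have sk n : fsimple (k n) by exact: fsimple_restrict.
have kf x : k n x @[n --> \oo] --> f' x.
  (* Where [f' x = 0] the cut forces [k n x = 0]. Elsewhere [h n x] is eventually closer to [f' x]
     than [rnorm (f' x)], so it is kept. *)
  have [fx0|fx0] := eqVneq (f' x) 0.
    rewrite fx0 (_ : (fun n => _) = cst 0); first exact: cvg_cst.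
    apply/funext => n; rewrite /k; case: asboolP => //.
    by rewrite /A/= fx0 rnorm0 mulr0 => rh; apply: rnorm_eq0; apply/eqP; rewrite eq_le rh rnorm_ge0.
  have fx1 : 0 < rnorm (f' x).
    by rewrite lt_neqAle rnorm_ge0 andbT; apply: contra_neq fx0 => /esym/rnorm_eq0.
  apply: cvg_trans (hf x); apply: near_eq_cvg.
  move/cvg_rnormP : (hf x) => /(_ _ fx1); apply: filterS => n fh.
  rewrite /k asboolT//= /A/= -[h n x](subKr (f' x)) (le_trans (rnormB _ _))//.
  by rewrite mulr2n mulrDl mul1r lerD2l ltW.
have kle n x : rnorm (f' x - k n x) <= 3 * rnorm (f' x).
  rewrite (le_trans (rnormB _ _))// (_ : 3 = 1 + 2 :> R); last by rewrite nat1r.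
  rewrite mulrDl mul1r lerD2l /k; case: asboolP => // _.
  by rewrite rnorm0 mulr_ge0// rnorm_ge0.
have lk n : limsimple (fun x => f' x - k n x).
  by apply: limsimpleB => //; exact: fsimple_limsimple.
have ik : inorm (fun x => f' x - k n x) @[n --> \oo] --> 0%E.
  have [] := @dominated_convergence _ T R mu setT measurableT
    (fun n x => (rnorm (f' x - k n x))%:E) (cst 0%E)
    (fun x => (3 * rnorm (f' x))%:E).
  - by move=> n; exact: measurable_ernorm.
  - exact: measurable_cst.
  - apply: aeW => x _; apply: cvg_EFin; first exact: nearW.
    rewrite -(@rnorm0 R E) -(subrr (f' x)).
    by apply: cvg_rnorm; apply: cvgB => //; exact: cvg_cst.
  - apply/integrableP; split.
      by apply/measurable_EFinP; exact: measurable_funM.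
    under eq_integral => x _.
      rewrite gee0_abs ?lee_fin ?mulr_ge0 ?rnorm_ge0// EFinM. over.
    rewrite ge0_integralZl//; last 2 first.
    - exact: measurable_ernorm.
    - by move=> x _; rewrite lee_fin rnorm_ge0.
    by rewrite lte_mul_pinfty// lee_fin.
  - by apply: aeW => x n _; rewrite gee0_abs ?lee_fin ?rnorm_ge0.
  move=> _ _; rewrite integral0; apply: cvg_trans.
  by apply: near_eq_cvg; exact: nearW.
move/ge0_cvge0P : (ik) => /(_ (fun n => inorm_ge0 _)) ik0.
suff /cvg_ex[v kv] : cvg (simple_integral mu (k n) @[n --> \oo]).
  by exists v; apply/is_bochner_integralP; exists f', k; split => //; exact: aeW.
apply/cauchy_cvgP/cauchy_exP => e /gt0_complexR[e0 ->].
have e2 : 0 < complex.Re e / 3 by rewrite divr_gt0.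
near \oo => N; exists (simple_integral mu (k N)).
have : \forall n \near \oo, ball (simple_integral mu (k N))
  (complex.Re e)%:C (simple_integral mu (k n)); last by [].
near=> n; rewrite -ball_normE/= -rnormE ltcR.
rewrite -lte_fin; apply: (@le_lt_trans _ _ ((complex.Re e / 3) + complex.Re e / 3)%:E); last first.
  by rewrite lte_fin; lra.
have -> : simple_integral mu (k N) - simple_integral mu (k n) =
    simple_integral mu (id \o (fun x => (-1) *: k n x + k N x)).
  by rewrite simple_integral_linear// scaleN1r addrC.
apply: (le_trans (rnorm_simple_integral _ _ _)); first exact: fsimple_linear.
apply: (le_trans (@le_inormD (fun x => (-1) *: k n x + k N x) _ _ (lk N) (lk n) _)).
  move=> x /=; rewrite scaleN1r (_ : - _ + _ = (f' x - k n x) - (f' x - k N x)).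
    by rewrite (le_trans (rnormB _ _))// addrC.
  by rewrite opprB [RHS]addrC addrA subrK addrC.
rewrite EFinD leeD//.
  by near: N; exact: ik0.
by near: n; exact: (ik0 _).
Unshelve. all: by end_near. Qed.

End BochnerTheory.

(** * Integration over a compact group *)

Lemma fsimple_find d (T : measurableType d) (X : Type) (A : X -> set T)
    (s : seq X) : (forall x, measurable (A x)) ->
  fsimple (fun y => find (fun x => `[<A x y>]) s).
Proof.
move=> mA; elim: s => [|x s ih] /=; first exact: fsimple_cst.
exact: (fsimple_comp (fun p : bool * nat => if p.1 then 0%N else p.2.+1)
  (fsimple_pair (fsimple_bool (mA x)) ih)).
Qed.

Section CompactSelection.
Context {G : topGroupType}.
Hypothesis cG : compact [set: G].

Lemma open_borel (U : set G) : open U -> measurable (U : set (borel G)).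
Proof. by move=> oU; apply: sub_sigma_algebra. Qed.

Lemma finite_subcover (U : G -> set G) : (forall x, nbhs x (U x)) ->
  exists s : seq G, forall y, has (fun x => `[<U x y>]) s.
Proof.
move=> nU; move: cG; rewrite compact_cover => /(_ G setT (fun x => (U x)^°)).
case=> [x _|x _|D _ DU]; first exact: open_interior.
  by exists x => //; exact: nU.
exists D => y; have [//|x xD /interior_subset Uy] := DU y.
by apply/hasP; exists x => //; apply/asboolP.
Qed.

(** A point is sent to the first centre of a finite subcover whose neighbourhood contains it. This
    discretizes a variable of [G] by a Borel simple map; interiors are taken so that the sets
    involved are Borel. *)
Lemma finite_selection (U : G -> set G) : (forall x, nbhs x (U x)) ->
  exists2 sel : G -> G, fsimple (sel : borel G -> G) & forall y, U (sel y) y.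
Proof.
move=> nU; have [|s sU] := @finite_subcover (fun x => (U x)^°).
  by move=> x; apply: nbhs_interior; exact: nU.
pose A x : set (borel G) := (U x)^°.
exists (nth point s \o (fun y => find (fun x => `[<A x y>]) s)).
  apply: fsimple_comp; apply: fsimple_find => x.
  by apply: open_borel; exact: open_interior.
by move=> y; have /(nth_find point)/asboolP/interior_subset := sU y.
Qed.

Lemma near_uniform (T : topologicalType) (P : T -> G -> Prop) (t : T) :
  (forall y : G, \forall y' \near y & t' \near t, P t' y') ->
  \forall t' \near t, forall y, P t' y.
Proof.
move=> nP; have /compact_near_coveringP := cG.
move=> /(_ _ (nbhs t) P) H; have {}H := H (nbhs_filter t) (fun y _ => nP y).
by apply: filterS H => t' + y => /(_ y Logic.I).
Qed.

(** Uniformity in the compact variable is what makes integrals over [y] continuous in the parameter,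
    and what lets a kernel be discretized in one variable. *)
Lemma tube (R : realType) (E : normedModType R[i]) (T : topologicalType)
    (k : T * G -> E) (t : T) (e : R) : continuous k -> 0 < e ->
  \forall t' \near t, forall y, rnorm (k (t, y) - k (t', y)) < e.
Proof.
move=> ck e0; apply: near_uniform => y.
have e2 : 0 < e / 2 by rewrite divr_gt0.
have /continuous_rnormP/(_ (t, y) _ e2) [[/= A B] [nA nB] AB] := ck.
exists (B, A); first by split.
move=> [y' t'] /= [By' At'].
rewrite (le_lt_trans (rnorm_distD (k (t, y)) _ _))// (splitr e) ltrD//.
  rewrite rnorm_distC; apply: (AB (t, y')); split => //=; exact: nbhs_singleton.
by apply: (AB (t', y')).
Qed.

End CompactSelection.

Section HaarIntegral.
Context {R : realType} {G : topGroupType} {E : completeNormedModType R[i]}.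
Hypothesis cG : compact [set: G].
Variable mu : probability (borel G) R.
Implicit Types (f g : G -> E).

Definition haarI f : E := bochner_integral mu (f : borel G -> E).

(** [f] is sampled at the selected centres. Continuous functions are thus strongly measurable with a
    uniform error, and identities between their integrals reduce to finite sums. *)
Lemma cont_usimple f (e : R) : continuous f -> 0 < e ->
  exists2 h : G -> E, fsimple (h : borel G -> E) &
    forall x, rnorm (f x - h x) < e.
Proof.
move=> /continuous_rnormP cf e0.
have [sel ssel U] := finite_selection cG (fun x => cf x e e0).
exists (f \o sel); first exact: fsimple_comp.
by move=> y; rewrite rnorm_distC /=; exact: U.
Qed.

Lemma cont_bounded f : continuous f -> exists2 M : R, 0 < M & forall x, rnorm (f x) <= M.
Proof.
move=> /cont_usimple => /(_ 1 ltr01)[h sh fhx]; have [M M0 hM] := fsimple_bounded sh.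
exists (M + 1) => [|x]; first by rewrite addr_gt0.
rewrite -(subrK (h x) (f x)) addrC (le_trans (rnormD _ _))// lerD ?hM//.
by rewrite ltW.
Qed.

Lemma cont_limsimple f : continuous f -> limsimple (f : borel G -> E).
Proof.
move=> cf; have /choice[h hf] (n : nat) : exists h : borel G -> E, fsimple h /\
    forall x, rnorm (f x - h x) < n.+1%:R^-1.
  have [|h] := cont_usimple cf (e := n.+1%:R^-1); first by rewrite invr_gt0.
  by exists h.
exists h; split=> [n|x]; first by have [] := hf n.
apply/cvg_rnormP => e e0; near=> n.
rewrite (lt_trans ((hf n).2 x))//.
near: n; exact: near_infty_natSinv_lt (PosNum e0).
Unshelve. all: by end_near. Qed.

Lemma inorm_le_cst f (M : R) :
  (forall x, rnorm (f x) <= M) -> (inorm mu (f : borel G -> E) <= M%:E)%E.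
Proof.
move=> fM; have M0 : 0 <= M by rewrite (le_trans _ (fM point))// rnorm_ge0.
apply: (@le_trans _ _ (\int[mu]_x (cst M%:E x))%E); last first.
  by rewrite integral_cst//= [X in (_ * X)%E](_ : _ = 1%E) ?mule1//; exact: probability_setT.
apply: ae_le_lower_integral => [x|x|].
- by rewrite lee_fin rnorm_ge0.
- by rewrite lee_fin.
- by apply: aeW => x; rewrite lee_fin.
Qed.

Lemma cont_L1 f : continuous f -> L1_fun mu (f : borel G -> E).
Proof.
move=> cf; split.
  by apply/strongly_measurableP; exists f; [exact: cont_limsimple|exact: aeW].
by have [M _ fM] := cont_bounded cf; rewrite (le_lt_trans (inorm_le_cst fM))// ltry.
Qed.

Lemma haarI_is f : continuous f -> is_bochner_integral mu (f : borel G -> E) (haarI f).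
Proof. by move=> cf; apply: L1_is_bochner_integral; exact: cont_L1. Qed.

Lemma haarI_linear (a : R[i]) f g : continuous f -> continuous g ->
  haarI (fun x => a *: f x + g x) = a *: haarI f + haarI g.
Proof.
by move=> cf cg; apply/bochner_integralE/is_bochner_integral_linear; exact: haarI_is.
Qed.

Lemma haarI_cst v : haarI (fun=> v) = v.
Proof.
apply: bochner_integralE; have sv := @fsimple_cst _ (borel G) _ v.
rewrite [X in is_bochner_integral _ _ X](_ : v = simple_integral mu (fun=> v)).
  exact: is_bochner_integral_simple.
rewrite /simple_integral (_ : range _ = [set v]); last first.
  by apply/seteqP; split => [_ [x _ <-]//|_ ->]; exists point.
rewrite fsbig_set1 (_ : _ @^-1` _ = setT); last by apply/seteqP; split.
by rewrite probability_setT/= scale1r.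
Qed.

Lemma haarI0 : haarI (fun=> 0) = 0.
Proof. exact: haarI_cst. Qed.

Lemma haarID f g : continuous f -> continuous g ->
  haarI (fun x => f x + g x) = haarI f + haarI g.
Proof.
move=> cf cg; have := haarI_linear 1 cf cg; rewrite scale1r => <-.
by congr haarI; apply/funext => x; rewrite scale1r.
Qed.

Lemma haarIZ (a : R[i]) f : continuous f ->
  haarI (fun x => a *: f x) = a *: haarI f.
Proof.
move=> cf; have c0 : continuous (fun _ : G => 0 : E) by move=> x; exact: cvg_cst.
have := haarI_linear a cf c0.
rewrite haarI0 addr0 => <-.
by congr haarI; apply/funext => x; rewrite addr0.
Qed.

Lemma haarIB f g : continuous f -> continuous g ->
  haarI (fun x => f x - g x) = haarI f - haarI g.
Proof.
move=> cf cg; have := haarI_linear (-1) cg cf; rewrite scaleN1r addrC => <-.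
by congr haarI; apply/funext => x; rewrite scaleN1r addrC.
Qed.

Lemma haarI_bound f (M : R) : continuous f -> (forall x, rnorm (f x) <= M) ->
  rnorm (haarI f) <= M.
Proof.
move=> cf fM; rewrite -lee_fin.
exact: (le_trans (is_bochner_integral_bound (haarI_is cf)) (inorm_le_cst fM)).
Qed.

Lemma haarI_approx f (h : G -> E) (e : R) : continuous f ->
  fsimple (h : borel G -> E) -> (forall x, rnorm (f x - h x) <= e) ->
  rnorm (haarI f - simple_integral mu (h : borel G -> E)) <= e.
Proof.
move=> cf sh fh; rewrite -lee_fin.
have /is_bochner_integral_bound :=
  is_bochner_integral_linear (-1) (is_bochner_integral_simple mu sh) (haarI_is cf).
rewrite scaleN1r addrC => /le_trans; apply.
rewrite (_ : inorm _ _ = inorm mu ((fun x => f x - h x) : borel G -> E)).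
  exact: inorm_le_cst.
by congr inorm; apply/funext => x; rewrite scaleN1r addrC.
Qed.

End HaarIntegral.

Section ContinuousFunctions.
Context {R : realType} {T : topologicalType} {E : normedModType R[i]}.

Lemma continuous_cst (v : E) : continuous (fun _ : T => v).
Proof. by move=> x; exact: cvg_cst. Qed.

Lemma continuous_lin (a : R[i]) (f g : T -> E) : continuous f -> continuous g ->
  continuous (fun x => a *: f x + g x).
Proof. by move=> cf cg x; apply: cvgD; [apply: cvgZ; [exact: cvg_cst|exact: cf]|exact: cg]. Qed.

Lemma continuous_sub (f g : T -> E) : continuous f -> continuous g ->
  continuous (fun x => f x - g x).
Proof. by move=> cf cg x; apply: cvgB; [exact: cf|exact: cg]. Qed.

Lemma continuous_scale (a : R[i]) (f : T -> E) : continuous f ->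
  continuous (fun x => a *: f x).
Proof. by move=> cf x; apply: cvgZ; [exact: cvg_cst|exact: cf]. Qed.

Lemma continuous_bigsum I (s : seq I) (P : pred I) (F : I -> T -> E) :
  (forall i, continuous (F i)) -> continuous (fun x => \sum_(i <- s | P i) F i x).
Proof.
move=> cF; elim: s => [|i s ih].
  by under eq_fun do rewrite big_nil; exact: continuous_cst.
under eq_fun do rewrite big_cons; case: (P i) => //.
by move=> x; apply: cvgD; [exact: cF|exact: ih].
Qed.

End ContinuousFunctions.

(** * Left invariance and iterated integrals of continuous functions *)

Section HaarInvariance.
Context {R : realType} {G : topGroupType} {E : completeNormedModType R[i]}.
Hypothesis cG : compact [set: G].
Variable mu : probability (borel G) R.
Hypothesis mu_haar : haar_probability mu.
Implicit Types (f g : G -> E) (a x y : G).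

Lemma haarI_bigsum I (s : seq I) (P : pred I) (F : I -> G -> E) :
  (forall i, continuous (F i)) ->
  haarI mu (fun x => \sum_(i <- s | P i) F i x) =
  \sum_(i <- s | P i) haarI mu (F i).
Proof.
move=> cF; elim: s => [|i s ih].
  by under eq_fun do rewrite big_nil; rewrite big_nil haarI0.
under eq_fun do rewrite big_cons; rewrite big_cons; case: (P i) => //.
by rewrite -ih; apply: haarID => //; exact: continuous_bigsum.
Qed.

Lemma mulg_left_continuous a : continuous (fun x => (a * x)%g).
Proof.
move=> x; apply: (@continuous_comp _ _ _ (fun x => (a, x)) (fun p => (p.1 * p.2)%g)).
  by apply: cvg_pair => /=; [exact: cvg_cst|exact: cvg_id].
exact: mulg_continuous.
Qed.

Lemma measurable_mulg_left a :
  measurable_fun setT ((fun x => (a * x)%g) : borel G -> borel G).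
Proof.
apply: (@measurability _ _ (borel G) (borel G) setT _ (@open G)) => // _ [U oU <-]; rewrite setTI.
by apply: open_borel; apply: open_comp => // x _; exact: mulg_left_continuous.
Qed.

Lemma fsimple_left a (h : G -> E) : fsimple (h : borel G -> E) ->
  fsimple ((fun x => h (a * x)%g) : borel G -> E) /\
  simple_integral mu ((fun x => h (a * x)%g) : borel G -> E) =
  simple_integral mu (h : borel G -> E).
Proof.
move=> [fh mh].
have pre v : (fun x => h (a * x)%g) @^-1` [set v] =
    [set (a^-1 * y)%g | y in h @^-1` [set v]].
  apply/seteqP; split => [y /= hy|_ [y /= hy <-]]; last by rewrite /= mulVKg.
  by exists (a * y)%g => //; rewrite mulKg.
have rg : range (fun x => h (a * x)%g) = range h.
  apply/seteqP; split => [_ [x _ <-]|_ [x _ <-]]; first by exists (a * x)%g.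
  by exists (a^-1 * x)%g => //; rewrite mulVKg.
have [inv _ _] := mu_haar.
split.
  split; first by rewrite rg.
  move=> v; rewrite -[X in measurable X]setTI.
  by apply: (measurable_mulg_left a measurableT (mh v)).
rewrite /simple_integral rg; apply: eq_fsbigr => v _.
by rewrite pre inv.
Qed.

Lemma continuous_left a f : continuous f -> continuous (fun x => f (a * x)%g).
Proof.
move=> cf x; apply: (@continuous_comp _ _ _ (fun x => (a * x)%g) f).
  exact: mulg_left_continuous.
exact: cf.
Qed.

Lemma haarI_left a f : continuous f ->
  haarI mu (fun x => f (a * x)%g) = haarI mu f.
Proof.
move=> cf; apply/subr0_eq/rnorm_small_eq0 => e e0.
have e2 : 0 < e / 2 by rewrite divr_gt0.
have [h sh fh] := cont_usimple cG cf e2.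
have [sah sE] := fsimple_left a sh.
rewrite (splitr e).
apply: (le_trans (rnorm_distD (simple_integral mu (h : borel G -> E)) _ _)).
apply: lerD; last first.
  rewrite rnorm_distC; apply: (haarI_approx cG mu cf sh) => x.
  exact: ltW.
rewrite -sE; refine (haarI_approx cG mu (continuous_left (a := a) cf) sah _) => x.
exact: ltW.
Qed.

Lemma continuous_slicer (k : G * G -> E) x : continuous k ->
  continuous (fun y => k (x, y)).
Proof.
move=> ck y; apply: (@continuous_comp _ _ _ (fun y => (x, y)) k); last exact: ck.
by apply: cvg_pair => /=; [exact: cvg_cst|exact: cvg_id].
Qed.

Lemma continuous_slicel (k : G * G -> E) y : continuous k ->
  continuous (fun x => k (x, y)).
Proof.
move=> ck x; apply: (@continuous_comp _ _ _ (fun x => (x, y)) k); last exact: ck.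
by apply: cvg_pair => /=; [exact: cvg_id|exact: cvg_cst].
Qed.

Lemma continuous_haarI (k : G * G -> E) : continuous k ->
  continuous (fun x => haarI mu (fun y => k (x, y))).
Proof.
move=> ck; apply/continuous_rnormP => x e e0.
have e2 : 0 < e / 2 by rewrite divr_gt0.
near=> x'; rewrite -haarIB//; try exact: continuous_slicer.
apply: (@le_lt_trans _ _ (e / 2)); last by rewrite ltr_pdivrMr// ltr_pMr// ltr1n.
apply: (haarI_bound cG).
  by move=> y; apply: cvgB; exact: continuous_slicer.
move=> y; apply: ltW; move: y; near: x'; exact: (tube cG).
Unshelve. all: by end_near. Qed.

(* A continuous kernel is uniformly close to one that depends on its first
   variable through a simple map; this avoids the product sigma-algebra, which
   may be smaller than the Borel one. *)
Lemma haarI_Fubini (k : G * G -> E) : continuous k ->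
  haarI mu (fun x => haarI mu (fun y => k (x, y))) =
  haarI mu (fun y => haarI mu (fun x => k (x, y))).
Proof.
move=> ck; apply/subr0_eq/rnorm_small_eq0 => e e0.
have e2 : 0 < e / 2 by rewrite divr_gt0.
have [sel ssel selE] := finite_selection cG (fun x => tube cG x ck e2).
pose F x := haarI mu (fun y => k (x, y)).
have cF : continuous F by exact: continuous_haarI.
have sF : fsimple (F \o sel : borel G -> E) by exact: fsimple_comp.
(* [S] is within [e / 2] of both iterated integrals: being a finite sum over the selected points, it
   is also the integral of [Fy]. *)
pose S := simple_integral mu (F \o sel : borel G -> E).
have cS y : continuous (fun x => k (x, y)) by exact: continuous_slicel.
have cR x : continuous (fun y => k (x, y)) by exact: continuous_slicer.
have H1 : rnorm (haarI mu F - S) <= e / 2.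
  apply: (haarI_approx cG mu cF sF) => x /=; rewrite rnorm_distC -haarIB//.
  apply: (haarI_bound cG).
    by move=> y; apply: cvgB; exact: cR.
  by move=> y; apply: ltW; exact: selE.
pose Fy y := simple_integral mu ((fun x => k (sel x, y)) : borel G -> E).
have FyE y : Fy y = \sum_(v <- fset_set (range sel))
    (fine (mu (sel @^-1` [set v])))%:C *: k (v, y).
  exact: (simple_integral_comp mu (fun x => k (x, y)) ssel).
have cFy : continuous Fy.
  rewrite (_ : Fy = fun y => \sum_(v <- fset_set (range sel))
    (fine (mu (sel @^-1` [set v])))%:C *: k (v, y)); last exact/funext.
  by apply: continuous_bigsum => v; apply: continuous_scale; exact: cR.
have SE : haarI mu Fy = S.
  rewrite /S simple_integral_comp//.
  under eq_bigr do rewrite -(haarIZ cG mu _ (cR _)).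
  rewrite -(haarI_bigsum _ predT); last first.
    by move=> v; apply: continuous_scale; exact: cR.
  by congr haarI; exact/funext.
rewrite -/F (splitr e).
apply: (le_trans (rnorm_distD S _ _)); apply: lerD => //.
rewrite -SE -haarIB//; last first.
  have := @continuous_haarI (fun p => k (p.2, p.1)); apply.
  move=> p; apply: (@continuous_comp _ _ _ (fun p => (p.2, p.1)) k); last exact: ck.
  by apply: cvg_pair => /=; [exact: cvg_snd|exact: cvg_fst].
apply: (haarI_bound cG).
  move=> y; apply: cvgB; first exact: cFy.
  have := @continuous_haarI (fun p => k (p.2, p.1)); apply.
  move=> p; apply: (@continuous_comp _ _ _ (fun p => (p.2, p.1)) k); last exact: ck.
  by apply: cvg_pair => /=; [exact: cvg_snd|exact: cvg_fst].
move=> y; rewrite rnorm_distC; apply: (haarI_approx cG mu (cS y)).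
  exact: (fsimple_comp (fun x => k (x, y)) ssel).
by move=> x; rewrite rnorm_distC; apply: ltW; exact: selE.
Qed.

End HaarInvariance.

Section RealLinearMap.
Context {R : realType} {G : topGroupType} {E F : completeNormedModType R[i]}.
Hypothesis cG : compact [set: G].
Variable mu : probability (borel G) R.
Variables (L : E -> F) (K : R).
Hypothesis LD : forall u v, L (u + v) = L u + L v.
Hypothesis LZ : forall (r : R) u, L (r%:C *: u) = r%:C *: L u.
Hypothesis LK : forall u, rnorm (L u) <= K * rnorm u.

Lemma real_linear0 : L 0 = 0.
Proof. by have := LZ 0 0; rewrite !scale0r. Qed.

Lemma real_linearB u v : L (u - v) = L u - L v.
Proof. by have := LZ (-1) v; rewrite rmorphN1 !scaleN1r LD => ->. Qed.

Lemma real_linear_sum I (s : seq I) (P : pred I) (f : I -> E) :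
  L (\sum_(i <- s | P i) f i) = \sum_(i <- s | P i) L (f i).
Proof. exact: (big_morph L LD real_linear0). Qed.

Lemma continuous_real_linear (T : topologicalType) (f : T -> E) :
  continuous f -> continuous (fun x => L (f x)).
Proof.
move=> /continuous_rnormP cf; apply/continuous_rnormP => x e e0.
have K1 : 0 < `|K| + 1 by rewrite ltr_wpDl.
have e1 : 0 < e / (`|K| + 1) by rewrite divr_gt0.
apply: filterS (cf x _ e1) => y; rewrite -real_linearB ltr_pdivlMr// => h.
rewrite (le_lt_trans _ h)// (le_trans (LK _))// mulrC.
by rewrite ler_wpM2l ?rnorm_ge0// (le_trans (ler_norm _))// lerDl.
Qed.

(** The weights in a simple integral are real, so homogeneity is asked over [R] only; complex
    conjugation then qualifies as [L]. *)
Lemma haarI_real_linear (f : G -> E) : continuous f ->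
  haarI mu (fun x => L (f x)) = L (haarI mu f).
Proof.
move=> cf; apply/subr0_eq/rnorm_small_eq0 => e e0.
have K1 : 0 < `|K| + 1 by rewrite ltr_wpDl.
have e1 : 0 < e / 2 / (`|K| + 1) by rewrite !divr_gt0.
have LKe u : rnorm u <= e / 2 / (`|K| + 1) -> rnorm (L u) <= e / 2.
  rewrite ler_pdivlMr// => h.
  rewrite (le_trans _ h)// (le_trans (LK _))// mulrC.
  by rewrite ler_wpM2l ?rnorm_ge0// (le_trans (ler_norm _))// lerDl.
have [h sh fh] := cont_usimple cG cf e1.
rewrite (splitr e).
apply: (le_trans (rnorm_distD (L (simple_integral mu (h : borel G -> E))) _ _)).
apply: lerD; last first.
  rewrite -real_linearB LKe// rnorm_distC.
  by refine (haarI_approx cG mu cf sh _) => x; exact: ltW.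
have -> : L (simple_integral mu (h : borel G -> E)) =
    simple_integral mu ((L \o h) : borel G -> F).
  have hE : simple_integral mu (h : borel G -> E) =
    \sum_(v <- fset_set (range h)) (fine (mu (h @^-1` [set v])))%:C *: v.
    exact: (simple_integral_comp mu id sh).
  rewrite hE real_linear_sum simple_integral_comp//.
  by apply: eq_bigr => v _; rewrite LZ.
refine (haarI_approx cG mu (continuous_real_linear cf) _ _) => [|x].
  exact: fsimple_comp.
by rewrite /= -real_linearB; apply: LKe; exact: ltW (fh x).
Qed.

End RealLinearMap.

Lemma conj_real (R : realType) (r : R) : Num.conj (r%:C) = r%:C :> R[i].
Proof.
have /CrealP : (r%:C : R[i]) \is Num.real by apply/complex_realP; exists r.
by [].
Qed.

(* Scalar functions are kept in [R[i]]; the topology and the integral come from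
   the alias [cpx R]. *)
Record ccont (R : realType) (T : topologicalType) (f : T -> R[i]) : Prop :=
  Ccont { ccont_continuous : continuous (f : T -> cpx R) }.

HB.lock Definition sI (R : realType) (G : topGroupType)
    (mu : probability (borel G) R) (f : G -> R[i]) : R[i] :=
  haarI mu (f : G -> cpx R).

Section ScalarFunctions.
Context {R : realType} {T : topologicalType}.
Implicit Types (f g : T -> R[i]).

Lemma ccontP f : ccont f <-> (forall x (e : R), 0 < e ->
  \forall y \near x, cabs (f x - f y) < e).
Proof.
by split=> [[cf]|cf]; [|split]; apply/(@continuous_rnormP R (cpx R) T f).
Qed.

Lemma ccont_cst (a : R[i]) : ccont (fun _ : T => a).
Proof. by split; exact: (@continuous_cst R T (cpx R) a). Qed.

Lemma ccont_lin (a : R[i]) f g : ccont f -> ccont g ->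
  ccont (fun x => a * f x + g x).
Proof. by move=> [cf] [cg]; split; exact: (@continuous_lin R T (cpx R) a f g cf cg). Qed.

Lemma ccont_sub f g : ccont f -> ccont g -> ccont (fun x => f x - g x).
Proof. by move=> [cf] [cg]; split; exact: (@continuous_sub R T (cpx R) f g cf cg). Qed.

Lemma ccont_mul f g : ccont f -> ccont g -> ccont (fun x => f x * g x).
Proof.
move=> [cf] [cg]; split=> x.
exact: (@cvgZ R[i] (cpx R) _ _ _ f g (f x) (g x) (cf x) (cg x)).
Qed.

Lemma continuous_scalev (E : normedModType R[i]) f (g : T -> E) :
  ccont f -> continuous g -> continuous (fun x => f x *: g x).
Proof.
by move=> [cf] cg x; exact: (@cvgZ R[i] E _ _ _ f g (f x) (g x) (cf x) (cg x)).
Qed.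

Lemma ccont_sum I (s : seq I) (P : pred I) (F : I -> T -> R[i]) :
  (forall i, ccont (F i)) -> ccont (fun x => \sum_(i <- s | P i) F i x).
Proof.
move=> cF; split; apply: (@continuous_bigsum R T (cpx R) I s P F) => i.
by have [] := cF i.
Qed.

Lemma ccont_conj f : ccont f -> ccont (fun x => Num.conj (f x)).
Proof.
move=> cf; apply/ccontP => x e e0.
have /ccontP/(_ x e e0) := cf; apply: filterS => y.
by rewrite -rmorphB cabs_conj.
Qed.

Lemma ccont_realC (u : T -> R) : continuous u -> ccont (fun x => (u x)%:C).
Proof.
move=> cu; apply/ccontP => x e e0.
have /cvgrPdist_lt/(_ e e0) := cu x; apply: filterS => y.
by rewrite -raddfB cabsR.
Qed.

Lemma ccont_comp (S : topologicalType) (f : S -> R[i]) (g : T -> S) :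
  continuous g -> ccont f -> ccont (fun x => f (g x)).
Proof.
move=> cg [cf]; split=> x.
exact: (@continuous_comp T S (cpx R) g f x (cg x) (cf (g x))).
Qed.

End ScalarFunctions.

Section ScalarHaar.
Context {R : realType} {G : topGroupType}.
Hypothesis cG : compact [set: G].
Variable mu : probability (borel G) R.
Hypothesis mu_haar : haar_probability mu.
Implicit Types (f g : G -> R[i]).

Local Notation sI := (sI mu).

Lemma sI_cst (a : R[i]) : sI (fun=> a) = a.
Proof. by rewrite sI.unlock; exact: (@haarI_cst R G (cpx R) mu a). Qed.

Lemma sI_linear (a : R[i]) f g : ccont f -> ccont g ->
  sI (fun x => a * f x + g x) = a * sI f + sI g.
Proof. by rewrite sI.unlock => -[cf] [cg]; exact: (@haarI_linear R G (cpx R) cG mu a f g cf cg). Qed.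

Lemma sIB f g : ccont f -> ccont g -> sI (fun x => f x - g x) = sI f - sI g.
Proof. by rewrite sI.unlock => -[cf] [cg]; exact: (@haarIB R G (cpx R) cG mu f g cf cg). Qed.

Lemma sIZ (a : R[i]) f : ccont f -> sI (fun x => a * f x) = a * sI f.
Proof. by rewrite sI.unlock => -[cf]; exact: (@haarIZ R G (cpx R) cG mu a f cf). Qed.

Lemma sI_sum I (s : seq I) (P : pred I) (F : I -> G -> R[i]) :
  (forall i, ccont (F i)) ->
  sI (fun x => \sum_(i <- s | P i) F i x) = \sum_(i <- s | P i) sI (F i).
Proof.
move=> cF; rewrite sI.unlock; apply: (@haarI_bigsum R G (cpx R) cG mu I s P F) => i.
by have [] := cF i.
Qed.

Lemma sI_bound f (M : R) : ccont f -> (forall x, cabs (f x) <= M) ->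
  cabs (sI f) <= M.
Proof. by rewrite sI.unlock => -[cf]; exact: (@haarI_bound R G (cpx R) cG mu f M cf). Qed.

Lemma sI_left (a : G) f : ccont f -> sI (fun x => f (a * x)%g) = sI f.
Proof. by rewrite sI.unlock => -[cf]; exact: (@haarI_left R G (cpx R) cG mu mu_haar a f cf). Qed.

Lemma ccont_sI (k : G * G -> R[i]) : ccont k ->
  ccont (fun x => sI (fun y => k (x, y))).
Proof. by rewrite sI.unlock => -[ck]; split; exact: (@continuous_haarI R G (cpx R) cG mu k ck). Qed.

Lemma sI_Fubini (k : G * G -> R[i]) : ccont k ->
  sI (fun x => sI (fun y => k (x, y))) = sI (fun y => sI (fun x => k (x, y))).
Proof. by rewrite sI.unlock => -[ck]; exact: (@haarI_Fubini R G (cpx R) cG mu k ck). Qed.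

Lemma ccont_bounded f : ccont f -> exists2 M : R, 0 < M & forall x, cabs (f x) <= M.
Proof. by move=> [cf]; exact: (@cont_bounded R G (cpx R) cG f cf). Qed.

Lemma ccont_tube (T : topologicalType) (k : T * G -> R[i]) (t : T) (e : R) :
  ccont k -> 0 < e ->
  \forall t' \near t, forall y, cabs (k (t, y) - k (t', y)) < e.
Proof. by move=> [ck]; exact: (@tube G cG R (cpx R) T k t e ck). Qed.

Lemma ccont_left (a : G) f : ccont f -> ccont (fun x => f (a * x)%g).
Proof. by move=> [cf]; split; exact: (@continuous_left R G (cpx R) a f cf). Qed.

Lemma sI_conj f : ccont f -> sI (fun x => Num.conj (f x)) = Num.conj (sI f).
Proof.
rewrite sI.unlock => -[cf]; refine (@haarI_real_linear R G (cpx R) (cpx R) cG mu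
  (fun a => Num.conj (a : R[i]) : cpx R) 1 _ _ _ f cf).
- exact: rmorphD.
- by move=> r a; rewrite [LHS]rmorphM /= conj_real.
- by move=> a; rewrite mul1r !rnorm_cpx cabs_conj.
Qed.

Lemma haarI_scalev (E : completeNormedModType R[i]) f (v : E) : ccont f ->
  haarI mu (fun x => f x *: v) = sI f *: v.
Proof.
rewrite sI.unlock => -[cf]; refine (@haarI_real_linear R G (cpx R) E cG mu
  (fun a => (a : R[i]) *: v) (rnorm v) _ _ _ f cf).
- by move=> a b; rewrite -scalerDl.
- by move=> r a; rewrite scalerA.
- by move=> a; rewrite rnormZ mulrC rnorm_cpx.
Qed.

End ScalarHaar.

(** * Positivity of the Haar integral and the inner product of continuous functions *)

Section HaarPositivity.
Context {R : realType} {G : topGroupType}.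
Hypothesis cG : compact [set: G].
Variable mu : probability (borel G) R.
Hypothesis mu_haar : haar_probability mu.
Implicit Types (f g h : G -> R[i]).
Local Notation sI := (sI mu).

Lemma complex_conj_real (z : R[i]) : Num.conj z = z -> z = (complex.Re z)%:C.
Proof. by move=> /CrealP/complex_realP[r ->]. Qed.

(** If [f] is bounded by [M], then [M - f] lies between 0 and [M], so the norm bound puts [M - sI f]
    within [M] of 0. The integral being real, it cannot be negative. *)
Lemma sI_ge0 f : ccont f -> (forall x, 0 <= f x) -> 0 <= sI f.
Proof.
move=> cf f0.
have fE x : f x = (complex.Re (f x))%:C by exact: complexE_ge0.
have IE : sI f = (complex.Re (sI f))%:C.
  apply: complex_conj_real; rewrite -(sI_conj cG mu cf); congr sI.
  by apply/funext => x; rewrite fE conj_real.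
have [M M0 fM] := ccont_bounded cG cf.
have cM : ccont (fun x => M%:C - f x) by apply: ccont_sub => //; exact: ccont_cst.
have := sI_bound cG mu cM (M := M).
rewrite (sIB cG mu (ccont_cst _) cf) sI_cst IE -raddfB cabsR ler0c => /(_ _)/ler_normlW.
rewrite lerBlDr lerDl; apply=> x.
have r0 : 0 <= complex.Re (f x) by rewrite -ler0c -fE.
rewrite fE -raddfB cabsR ger0_norm; first by rewrite lerBlDr lerDl.
rewrite subr_ge0 (le_trans _ (fM x))// fE cabsR.
by rewrite ger0_norm.
Qed.

Lemma sI_le f g : ccont f -> ccont g -> (forall x, f x <= g x) -> sI f <= sI g.
Proof.
move=> cf cg fg; rewrite -subr_ge0 -(sIB cG mu cg cf); apply: sI_ge0.
  exact: ccont_sub.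
by move=> x; rewrite subr_ge0.
Qed.

(* If [f x0 > 0], finitely many left translates of [f] add up to a function
   bounded below by a positive constant, and all have the same integral. *)
Lemma sI_eq0 f : ccont f -> (forall x, 0 <= f x) -> sI f = 0 ->
  forall x, f x = 0.
Proof.
move=> cf f0 If0 x0; apply: contrapT => /eqP fx0.
have fE x : f x = (complex.Re (f x))%:C by exact: complexE_ge0.
pose c := complex.Re (f x0) / 2.
have c0 : 0 < c.
  rewrite divr_gt0// lt_neqAle -ler0c -fE f0 andbT.
  by apply: contra_neq fx0 => h; rewrite fE -h.
have c2 : complex.Re (f x0) = c + c by rewrite -splitr.
(* Left multiplication by [x0 * x^-1] carries [x] to [x0], so near [x] this translate of [f] stays
   above [c], which is half of [f x0]. *)
have [|s hs] := @finite_subcover G cG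
    (fun x => [set y | cabs (f x0 - f ((x0 * x^-1) * y)%g) < c]).
  move=> x.
  have /ccontP/(_ x c c0) := ccont_left (x0 * x^-1)%g cf.
  by apply: filterS => y; rewrite mulgVK.
have cs x : ccont (fun y => f ((x0 * x^-1) * y)%g) by exact: ccont_left.
have : c%:C <= sI (fun y => \sum_(x <- s) f ((x0 * x^-1) * y)%g).
  rewrite -[X in X <= _](sI_cst mu); apply: sI_le.
  - exact: ccont_cst.
  - exact: ccont_sum.
  move=> y; have /hasP[x xs /asboolP /= fxy] := hs y.
  apply: (@le_trans _ _ (f ((x0 * x^-1) * y)%g)).
    move: fxy; rewrite (fE x0) (fE (_ * y)%g) -raddfB cabsR lecR => /ltr_normlW.
    by rewrite c2 ltrBlDr => h; apply: ltW; move: h; rewrite ltrD2l.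
  rewrite (big_rem x)//= lerDl; apply: sumr_ge0 => z _; exact: f0.
rewrite (sI_sum cG mu _ _ cs) big1 => [|x _]; last by rewrite (sI_left cG mu_haar).
by rewrite lecE /= eqxx /= leNgt c0.
Qed.

Definition ip f g : R[i] := sI (fun x => f x * Num.conj (g x)).

Lemma ccont_ip f g : ccont f -> ccont g -> ccont (fun x => f x * Num.conj (g x)).
Proof. by move=> cf cg; apply: ccont_mul => //; exact: ccont_conj. Qed.

Lemma ip_linear (a : R[i]) f g h : ccont f -> ccont g -> ccont h ->
  ip (fun x => a * f x + g x) h = a * ip f h + ip g h.
Proof.
move=> cf cg ch; rewrite /ip -(sI_linear cG mu _ (ccont_ip cf ch) (ccont_ip cg ch)).
by congr sI; apply/funext => x; rewrite mulrDl mulrA.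
Qed.

Lemma ip_conj f g : ccont f -> ccont g -> ip g f = Num.conj (ip f g).
Proof.
move=> cf cg; rewrite /ip -(sI_conj cG mu (ccont_ip cf cg)).
by congr sI; apply/funext => x; rewrite rmorphM /= conjCK mulrC.
Qed.

Lemma ip_ge0 f : ccont f -> 0 <= ip f f.
Proof.
by move=> cf; apply: sI_ge0 => [|x]; [exact: ccont_ip|exact: mul_conjC_ge0].
Qed.

Lemma ip_eq0 f : ccont f -> ip f f = 0 -> f = fun=> 0.
Proof.
move=> cf ff0; apply/funext => x; apply/eqP.
have := sI_eq0 (ccont_ip cf cf) (fun x => mul_conjC_ge0 (f x)) ff0 x.
by move/eqP; rewrite mul_conjC_eq0.
Qed.

Lemma ip_left (a : G) f g : ccont f -> ccont g ->
  ip (fun x => f (a * x)%g) (fun x => g (a * x)%g) = ip f g.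
Proof. by move=> cf cg; exact: (sI_left cG mu_haar a (ccont_ip cf cg)). Qed.

End HaarPositivity.

(** * Inner products *)

(** A positive definite hermitian form on a subspace [S] of functions. The subspace is a predicate
    so that one development serves continuous functions, their subspaces [coefperp] and
    [eigenspace], and invariant subspaces of [n]-tuples. *)
Record prehilbert (R : realType) (X : Type) (S : (X -> R[i]) -> Prop)
    (b : (X -> R[i]) -> (X -> R[i]) -> R[i]) : Prop := Prehilbert {
  ph_zero : S (fun=> 0);
  ph_linS : forall (a : R[i]) f g, S f -> S g -> S (fun x => a * f x + g x);
  ph_lin : forall (a : R[i]) f g h, S f -> S g -> S h ->
    b (fun x => a * f x + g x) h = a * b f h + b g h;
  ph_conj : forall f g, S f -> S g -> b g f = Num.conj (b f g);
  ph_ge0 : forall f, S f -> 0 <= b f f;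
  ph_eq0 : forall f, S f -> b f f = 0 -> f = fun=> 0
}.

Section Prehilbert.
Context {R : realType} {X : Type}.
Local Notation V := (X -> R[i]).
Variables (S : V -> Prop) (b : V -> V -> R[i]).
Implicit Types (f g h : V) (a : R[i]).
Hypothesis PH : prehilbert S b.
Let S0 := ph_zero PH.
Let Slin := ph_linS PH.
Let b_lin := ph_lin PH.
Let b_conj := ph_conj PH.
Let b_ge0 := ph_ge0 PH.
Let b_eq0 := ph_eq0 PH.

(** The squared norm of [f]. *)
Definition n2 f : R := complex.Re (b f f).

Lemma n2E f : S f -> b f f = (n2 f)%:C.
Proof. by move=> Sf; rewrite -complexE_ge0// b_ge0. Qed.

Lemma n2_ge0 f : S f -> 0 <= n2 f.
Proof. by move=> Sf; rewrite -ler0c -n2E// b_ge0. Qed.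

Lemma n2_eq0 f : S f -> n2 f = 0 -> f = fun=> 0.
Proof. by move=> Sf f0; apply: b_eq0 => //; rewrite n2E// f0. Qed.

Lemma S_scale a f : S f -> S (fun x => a * f x).
Proof.
move=> Sf; rewrite (_ : (fun x => _) = (fun x => a * f x + 0)); first exact: Slin.
by apply/funext => x; rewrite addr0.
Qed.

Lemma S_sub f g : S f -> S g -> S (fun x => f x - g x).
Proof.
move=> Sf Sg; rewrite (_ : (fun x => _) = (fun x => -1 * g x + f x)); first exact: Slin.
by apply/funext => x; rewrite mulN1r addrC.
Qed.

Lemma b0l g : S g -> b (fun=> 0) g = 0.
Proof.
move=> Sg; have := b_lin (-1) S0 S0 Sg.
rewrite (_ : (fun x => _) = (fun=> 0)); last by apply/funext => x; rewrite mulr0 addr0.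
by rewrite mulN1r addNr.
Qed.

Lemma bZl a f g : S f -> S g -> b (fun x => a * f x) g = a * b f g.
Proof.
move=> Sf Sg; have := b_lin a Sf S0 Sg; rewrite b0l// addr0 => <-; congr b.
by apply/funext => x; rewrite addr0.
Qed.

Lemma b_linr a f g h : S f -> S g -> S h ->
  b h (fun x => a * f x + g x) = Num.conj a * b h f + b h g.
Proof.
move=> Sf Sg Sh; rewrite b_conj//; last exact: Slin.
by rewrite b_lin// rmorphD rmorphM /= -!b_conj.
Qed.

Lemma bZr a f g : S f -> S g -> b g (fun x => a * f x) = Num.conj a * b g f.
Proof.
move=> Sf Sg; rewrite b_conj//; last exact: S_scale.
by rewrite bZl// rmorphM/= -b_conj.
Qed.

Lemma b_subl f g h : S f -> S g -> S h ->
  b (fun x => f x - g x) h = b f h - b g h.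
Proof.
move=> Sf Sg Sh; have := b_lin (-1) Sg Sf Sh; rewrite mulN1r addrC => <-; congr b.
by apply/funext => x; rewrite mulN1r addrC.
Qed.

Lemma b_subr f g h : S f -> S g -> S h ->
  b h (fun x => f x - g x) = b h f - b h g.
Proof.
move=> Sf Sg Sh; rewrite b_conj//; last exact: S_sub.
by rewrite b_subl// rmorphB /= -!b_conj.
Qed.

Lemma n2_lin a f g : S f -> S g ->
  n2 (fun x => a * f x + g x) =
  cabs a ^+ 2 * n2 f + 2 * complex.Re (a * b f g) + n2 g.
Proof.
move=> Sf Sg; apply: complexI.
rewrite -n2E; last exact: Slin.
rewrite b_lin ?b_linr//; last exact: Slin.
rewrite !rmorphD /= [(_ * n2 f)%:C]rmorphM /= [(2 * _)%:C]rmorphM /= cabs2E -!n2E//.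
rewrite (b_conj Sf Sg).
have -> : (2%:R)%:C = 2%:R :> R[i] by rewrite rmorph_nat.
rewrite -addcJ -[_^*%C]/(Num.conj _) rmorphM/=.
by ring.
Qed.

Lemma n2_scale a f : S f -> n2 (fun x => a * f x) = cabs a ^+ 2 * n2 f.
Proof.
move=> Sf; apply: complexI; rewrite -n2E; last exact: S_scale.
rewrite bZl ?bZr//; last exact: S_scale.
by rewrite rmorphM/= cabs2E -n2E// mulrA.
Qed.

Lemma cauchy_schwarz f g : S f -> S g -> cabs (b f g) ^+ 2 <= n2 f * n2 g.
Proof.
move=> Sf Sg; have [g0|g0] := eqVneq (n2 g) 0.
  rewrite g0 mulr0 (n2_eq0 Sg g0) b_conj// b0l// rmorph0.
  by rewrite -(@rmorph0 _ _ (real_complex R)) cabsR normr0 expr0n.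
have gp : 0 < n2 g by rewrite lt_neqAle eq_sym g0 n2_ge0.
(* The coefficient is the one that makes the combination orthogonal to [g]. *)
have := n2_ge0 (Slin (- (b f g / (n2 g)%:C)) Sg Sf).
rewrite n2_lin// (_ : - _ * b g f = (- (cabs (b f g) ^+ 2 / n2 g))%:C); last first.
  rewrite (b_conj Sf Sg) rmorphN rmorphM fmorphV /= cabs2E mulNr.
  by rewrite mulrAC.
have -> : cabs (- (b f g / (n2 g)%:C)) = cabs (b f g) / n2 g.
  by rewrite /cabs normrN normf_div -!cabsE cabsR gtr0_norm// -fmorphV -rmorphM.
rewrite /= => h; rewrite -ler_pdivrMr//.
suff : cabs (b f g) ^+ 2 / n2 g = (cabs (b f g) / n2 g) ^+ 2 * n2 g by move: h => /=; lra.
by field.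
Qed.

Definition orthonormal_in n (e : 'I_n -> V) : Prop :=
  (forall i, S (e i)) /\ forall i j, b (e i) (e j) = (i == j)%:R.

Lemma S_sum I (s : seq I) (P : pred I) (c : I -> R[i]) (e : I -> V) :
  (forall i, S (e i)) -> S (fun x => \sum_(i <- s | P i) c i * e i x).
Proof.
move=> Se; elim: s => [|i s ih].
  by under eq_fun do rewrite big_nil.
by under eq_fun do rewrite big_cons; case: (P i) => //; exact: Slin.
Qed.

Lemma b_suml I (s : seq I) (P : pred I) (c : I -> R[i]) (e : I -> V) g :
  (forall i, S (e i)) -> S g ->
  b (fun x => \sum_(i <- s | P i) c i * e i x) g =
  \sum_(i <- s | P i) c i * b (e i) g.
Proof.
move=> Se Sg; elim: s => [|i s ih].
  by under eq_fun do rewrite big_nil; rewrite big_nil b0l.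
under eq_fun do rewrite big_cons; rewrite big_cons; case: (P i) => //.
by rewrite b_lin// ?ih//; exact: S_sum.
Qed.

Section Orthonormal.
Variables (n : nat) (e : 'I_n -> V).
Hypothesis eON : orthonormal_in e.

Lemma coord_sum (c : 'I_n -> R[i]) j :
  b (fun x => \sum_(i < n) c i * e i x) (e j) = c j.
Proof.
have [Se bee] := eON; rewrite b_suml// (bigD1 j)//= bee eqxx mulr1.
by rewrite big1 ?addr0// => i ij; rewrite bee (negbTE ij) mulr0.
Qed.

Lemma b_residual f j : S f ->
  b (fun x => f x - \sum_(i < n) b f (e i) * e i x) (e j) = 0.
Proof.
by move=> Sf; have [Se bee] := eON; rewrite b_subl ?coord_sum ?subrr//; exact: S_sum.
Qed.

Lemma n2_sum (c : 'I_n -> R[i]) :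
  n2 (fun x => \sum_(i < n) c i * e i x) = \sum_(i < n) cabs (c i) ^+ 2.
Proof.
have [Se bee] := eON; apply: complexI.
rewrite -n2E; last exact: S_sum.
rewrite rmorph_sum b_suml//; last exact: S_sum.
apply: eq_bigr => i _; rewrite b_conj ?coord_sum//; last exact: S_sum.
by rewrite /= cabs2E.
Qed.

Lemma bessel f : S f -> \sum_(i < n) cabs (b f (e i)) ^+ 2 <= n2 f.
Proof.
move=> Sf; have [Se bee] := eON.
pose p x := \sum_(i < n) b f (e i) * e i x.
have Sp : S p by exact: S_sum.
have Sr : S (fun x => f x - p x) by exact: S_sub.
rewrite [X in _ <= n2 X](_ : f = (fun x => 1 * (f x - p x) + p x)); last first.
  by apply/funext => x; rewrite mul1r subrK.
rewrite n2_lin// (_ : b _ p = 0); last first.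
  rewrite b_conj// b_suml// big1 ?rmorph0// => i _.
  by rewrite (b_conj Sr (Se i)) b_residual// rmorph0 mulr0.
rewrite mulr0 raddf0 mulr0 addr0 n2_sum lerDr mulr_ge0 ?sqr_ge0//.
exact: n2_ge0.
Qed.

End Orthonormal.

(** One Gram-Schmidt step: the residual of [f] is nonzero by assumption and gets normalized. *)
Lemma orthonormal_extend n (e : 'I_n -> V) f : orthonormal_in e -> S f ->
  f <> (fun x => \sum_(i < n) b f (e i) * e i x) ->
  exists e' : 'I_n.+1 -> V, orthonormal_in e'.
Proof.
move=> eON Sf fp; have [Se bee] := eON.
pose r x := f x - \sum_(i < n) b f (e i) * e i x.
have Sr : S r by apply: S_sub => //; exact: S_sum.
have r0 : 0 < n2 r.
  rewrite lt_neqAle n2_ge0// andbT; apply: contra_notN fp => /eqP/esym/(n2_eq0 Sr) re0.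
  by apply/funext => x; apply/eqP; rewrite -subr_eq0; apply/eqP; exact: (congr1 (@^~ x) re0).
pose c : R[i] := ((Num.sqrt (n2 r))^-1)%:C.
pose u x := c * r x.
have Su : S u by exact: S_scale.
have uu : b u u = 1.
  rewrite n2E// n2_scale// cabsR real_normK ?num_real// exprVn sqr_sqrtr ?ltW//.
  by rewrite mulVf ?gt_eqF.
have ue i : b u (e i) = 0 by rewrite bZl// b_residual// mulr0.
exists (fun i => if unlift ord_max i is Some j then e j else u); split.
  by move=> i; case: unliftP.
move=> i j; case: unliftP => [i' ->|->]; case: unliftP => [j' ->|->].
- by rewrite bee (inj_eq lift_inj).
- by rewrite b_conj// ue rmorph0 eq_sym (negbTE (neq_lift _ _)).
- by rewrite ue (negbTE (neq_lift _ _)).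
- by rewrite eqxx.
Qed.

(** A family of maximal size spans, as it could otherwise be extended. Finite dimension is expressed
    as a bound on the size of orthonormal families, the form in which Bessel's inequality delivers
    it. *)
Lemma orthonormal_basis_exists (N : nat) :
  (forall n (e : 'I_n -> V), orthonormal_in e -> (n <= N)%N) ->
  exists n (e : 'I_n -> V), orthonormal_in e /\
    forall f, S f -> f = (fun x => \sum_(i < n) b f (e i) * e i x).
Proof.
move=> eN; pose P n := `[<exists e : 'I_n -> V, orthonormal_in e>].
have P0 : P 0%N by apply/asboolP; exists (fun=> (fun=> 0)); split => -[].
have PN n : P n -> (n <= N)%N by move=> /asboolP[e /eN].
have [n /asboolP[e eON] nmax] := ex_maxnP (ex_intro _ 0%N P0) PN.
exists n, e; split=> // f Sf; apply: contrapT => fp.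
have [e' e'ON] := orthonormal_extend eON Sf fp.
suff /nmax : P n.+1 by rewrite ltnn.
by apply/asboolP; exists e'.
Qed.

End Prehilbert.

Definition dotI (R : realType) n (u v : 'I_n -> R[i]) : R[i] :=
  \sum_(i < n) u i * Num.conj (v i).

Lemma prehilbert_dotI (R : realType) n : prehilbert (fun=> True) (@dotI R n).
Proof.
split=> //.
- move=> a f g h _ _ _; rewrite /dotI mulr_sumr -big_split/=.
  by apply: eq_bigr => i _; rewrite mulrDl mulrA.
- move=> f g _ _; rewrite /dotI rmorph_sum; apply: eq_bigr => i _.
  by rewrite rmorphM /= conjCK mulrC.
- by move=> f _; apply: sumr_ge0 => i _; exact: mul_conjC_ge0.
- move=> f _ f0; apply/funext => i; apply/eqP; rewrite -mul_conjC_eq0; apply/eqP.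
  have /psumr_eq0P := f0; apply=> // j _; exact: mul_conjC_ge0.
Qed.

Lemma n2_dotI (R : realType) n (u : 'I_n -> R[i]) :
  n2 (@dotI R n) u = \sum_(i < n) cabs (u i) ^+ 2.
Proof.
apply: complexI; rewrite -(n2E (prehilbert_dotI R n))// rmorph_sum.
by apply: eq_bigr => i _; rewrite /= cabs2E.
Qed.

(** Bessel's inequality is summed over the [n] standard basis vectors: the left sides add up to [m],
    and each right side is 1. *)
Lemma ortho_l2_le (R : realType) n m (w : 'I_m -> 'I_n -> R[i]) :
  orthonormal_in (fun=> True) (@dotI R n) w -> (m <= n)%N.
Proof.
move=> wON; have [_ ww] := wON.
rewrite -(ler_nat R) -[n]card_ord -sumr_const.
have -> : m%:R = \sum_(i < n) \sum_(k < m) cabs (w k i) ^+ 2 :> R.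
  rewrite exchange_big /=; under eq_bigr => k _.
    rewrite -n2_dotI /n2 ww eqxx /=. over.
  by rewrite sumr_const card_ord.
apply: ler_sum => i _.
have := bessel (prehilbert_dotI R n) wON (f := fun j => (j == i)%:R) I.
have -> : n2 (@dotI R n) (fun j => (j == i)%:R) = 1.
  rewrite n2_dotI (bigD1 i)//= eqxx /(cabs 1) normr1 expr1n big1 ?addr0// => j.
  by move=> /negbTE ->; rewrite /cabs normr0 expr0n.
apply: le_trans; apply: ler_sum => k _.
rewrite /dotI (bigD1 i)//= eqxx mul1r big1 ?addr0 ?cabs_conj// => j /negbTE ->.
by rewrite mul0r.
Qed.

(** * The Hilbert space of [n]-tuples *)

Section L2norm.
Context {R : realType} {n : nat}.
Let PH := prehilbert_dotI R n.

(** A type of its own, so that its norm is the Euclidean one: [hilbertSpace] requires the norm to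
    come from the inner product. *)
Definition l2 : Type := 'I_n -> R[i]^o.
HB.instance Definition _ := GRing.Lmodule.copy l2 ('I_n -> R[i]^o).

Definition l2_norm (u : l2) : R[i] := (Num.sqrt (n2 (@dotI R n) u))%:C.

Lemma l2_normD (u v : l2) : l2_norm (u + v) <= l2_norm u + l2_norm v.
Proof.
rewrite /l2_norm -rmorphD lecR; set nu := n2 _ u; set nv := n2 _ v.
have nu0 : 0 <= nu by exact: (n2_ge0 PH).
have nv0 : 0 <= nv by exact: (n2_ge0 PH).
rewrite -(ler_pXn2r (_ : 0 < 2)%N)// ?nnegrE ?sqrtr_ge0 ?addr_ge0 ?sqrtr_ge0//.
rewrite sqr_sqrtr; last exact: (n2_ge0 PH).
have -> : n2 (@dotI R n) (u + v) = n2 (@dotI R n) (fun i => 1 * u i + v i).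
  by congr n2; apply/funext => i; rewrite mul1r.
rewrite (n2_lin PH)// -/nu -/nv mul1r /cabs normr1 expr1n mul1r.
rewrite sqrrD !sqr_sqrtr// lerD2r lerD2l -[leRHS]mulr_natl ler_pM2l//.
rewrite (le_trans (ler_norm _))// (le_trans (ler_Re_cabs _))//.
rewrite -(ler_pXn2r (_ : 0 < 2)%N)// ?nnegrE ?cabs_ge0 ?mulr_ge0 ?sqrtr_ge0//.
by rewrite exprMn !sqr_sqrtr//; exact: (cauchy_schwarz PH).
Qed.

Lemma l2_normZ (a : R[i]) (u : l2) : l2_norm (a *: u) = `|a| * l2_norm u.
Proof.
rewrite /l2_norm -cabsE -rmorphM /=; congr (_%:C).
have -> : n2 (@dotI R n) (a *: u) = n2 (@dotI R n) (fun i => a * u i) by [].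
by rewrite (n2_scale PH)// sqrtrM ?sqr_ge0// sqrtr_sqr ger0_norm// cabs_ge0.
Qed.

Lemma l2_norm_eq0 (u : l2) : l2_norm u = 0 -> u = 0.
Proof.
move=> /complexI/eqP; rewrite sqrtr_eq0 => u0.
apply: (n2_eq0 PH (f := u)) => //; apply/eqP; rewrite eq_le u0 (n2_ge0 PH)//.
Qed.

HB.instance Definition _ :=
  Lmodule_isNormed.Build R[i] l2 l2_normD l2_normZ l2_norm_eq0.

Lemma l2_rnorm (u : l2) : rnorm u = Num.sqrt (n2 (@dotI R n) u).
Proof. by []. Qed.

Lemma l2_coord_le (u : l2) i : cabs (u i) <= rnorm u.
Proof.
rewrite l2_rnorm n2_dotI -(ler_pXn2r (_ : 0 < 2)%N)// ?nnegrE ?cabs_ge0 ?sqrtr_ge0//.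
rewrite sqr_sqrtr; last by apply: sumr_ge0 => j _; exact: sqr_ge0.
by rewrite (bigD1 i)//= lerDl sumr_ge0// => j _; exact: sqr_ge0.
Qed.

Lemma l2_rnorm_le (u : l2) : rnorm u <= \sum_(i < n) cabs (u i).
Proof.
rewrite l2_rnorm n2_dotI -(ler_pXn2r (_ : 0 < 2)%N)// ?nnegrE ?sqrtr_ge0 ?sumr_ge0//; last first.
  by move=> i _; exact: cabs_ge0.
rewrite sqr_sqrtr; last by apply: sumr_ge0 => j _; exact: sqr_ge0.
rewrite expr2 mulr_suml; apply: ler_sum => i _.
rewrite expr2 ler_wpM2l ?cabs_ge0// (bigD1 i)//= lerDl sumr_ge0// => j _.
exact: cabs_ge0.
Qed.

Lemma cvg_l2 (F : set_system l2) (FF : Filter F) (c : l2) :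
  (forall i (e : R), 0 < e -> \forall v \near F, cabs (c i - v i) < e) -> F --> c.
Proof.
move=> Fc; apply/(@cvg_rnormP R l2 _ F _ id) => e e0.
have en0 : 0 < e / n.+1%:R by rewrite divr_gt0.
have : \forall v \near F, forall i, cabs (c i - v i) < e / n.+1%:R.
  by apply: filter_forall => i; exact: Fc.
apply: filterS => v cv; rewrite (le_lt_trans (l2_rnorm_le _))//.
rewrite (@le_lt_trans _ _ (\sum_(i < n) e / n.+1%:R))//.
  by apply: ler_sum => i _; apply: ltW; exact: cv.
rewrite sumr_const card_ord -[X in X < _]mulr_natr -mulrA gtr_pMr//.
by rewrite mulrC ltr_pdivrMr// mul1r ltr_nat.
Qed.

Lemma l2_complete (F : set_system l2) : ProperFilter F -> cauchy F -> cvg F.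
Proof.
move=> FF /cauchyP Fc.
have cvgi i : cvg ((fun v : l2 => v i : cpx R) @ F).
  apply/cauchy_cvgP/cauchy_exP => e e0.
  have [a Fa] : exists a, F (ball a e) by exact: Fc.
  exists (a i); apply: (@filterS _ F _ _ _ _ Fa) => v.
  rewrite -!ball_normE /= -!rnormE => av.
  apply: le_lt_trans av; rewrite lecR; exact: (l2_coord_le (a - v) i).
apply/cvg_ex; exists ((fun i => lim ((fun v : l2 => v i : cpx R) @ F)) : l2).
apply: cvg_l2 => i e e0.
have /(@cvg_rnormP R (cpx R) _ F _ (fun v => v i))/(_ e e0) := cvgi i.
exact.
Qed.

HB.instance Definition _ := Uniform_isComplete.Build l2 l2_complete.

Definition l2_dot (u v : l2) : R[i] := dotI u v.

Lemma l2_dot_bilinear : bilinear_for *%R (Num.conj \; *%R) l2_dot.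
Proof.
split=> [v|u] a x y; first exact: (ph_lin PH a (f := x) (g := y) (h := v)).
exact: (b_linr PH a (f := x) (g := y) (h := u)).
Qed.

HB.instance Definition _ :=
  bilinear_isBilinear.Build R[i] l2 l2 R[i] *%R (Num.conj \; *%R) l2_dot
    l2_dot_bilinear.

Lemma l2_dot_hermitian (u v : l2) :
  l2_dot u v = (-1) ^+ false * Num.conj (l2_dot v u).
Proof. by rewrite expr0 mul1r; exact: (ph_conj PH). Qed.

HB.instance Definition _ := isHermitianSesquilinear.Build R[i] l2 false
  Num.conj l2_dot l2_dot_hermitian.

Lemma l2_dot_gt0 (u : l2) : u != 0 -> 0 < l2_dot u u.
Proof.
move=> u0; rewrite lt_neqAle (ph_ge0 PH)// andbT eq_sym.
by apply: contra_neq u0; exact: (ph_eq0 PH).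
Qed.

HB.instance Definition _ := isDotProduct.Build R[i] l2 l2_dot l2_dot_gt0.

Lemma l2_inner_norm (u : l2) : l2_dot u u = `|u| ^+ 2.
Proof.
rewrite -[ `|u| ]/(l2_norm u) /l2_norm -rmorphXn /= sqr_sqrtr ?(n2_ge0 PH)//.
exact: (n2E PH).
Qed.

Definition l2_hilbert : hilbertSpace R := HilbertSpace l2_inner_norm.

End L2norm.
Arguments l2 : clear implicits.
Arguments l2_hilbert : clear implicits.

(** * Unitary representations given by continuous unitary matrices *)

Section MatrixRep.
Context {R : realType} {G : topGroupType} {n : nat}.
Variable U : G -> 'I_n -> 'I_n -> R[i].
Hypothesis U_mul : forall x y i j,
  U (x * y)%g i j = \sum_(k < n) U x i k * U y k j.
Hypothesis U_one : forall i j, U 1%g i j = (i == j)%:R.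
Hypothesis U_unitary : forall x j k,
  \sum_(i < n) U x i j * Num.conj (U x i k) = (j == k)%:R.
Hypothesis U_cont : forall i j, ccont (fun x => U x i j).

Definition mx_op (x : G) (v : l2_hilbert R n) : l2_hilbert R n :=
  fun i => \sum_(j < n) U x i j * v j.

Lemma mx_op_mul x y v : mx_op (x * y)%g v = mx_op x (mx_op y v).
Proof.
apply/funext => i; rewrite /mx_op.
under eq_bigr do rewrite U_mul mulr_suml.
rewrite exchange_big/=; apply: eq_bigr => k _.
by rewrite mulr_sumr; apply: eq_bigr => j _; rewrite mulrA.
Qed.

Lemma mx_op_one v : mx_op 1%g v = v.
Proof.
apply/funext => i; rewrite /mx_op (bigD1 i)//= U_one eqxx mul1r big1 ?addr0// => j ji.
by rewrite U_one eq_sym (negbTE ji) mul0r.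
Qed.

Lemma mx_op_unitary x : unitary_map (mx_op x).
Proof.
split=> [a u v|u v|w]; last first.
- by exists (mx_op x^-1%g w); rewrite -mx_op_mul mulgV mx_op_one.
- rewrite /inner/= /l2_dot /dotI /mx_op.
  under eq_bigr => i _.
    rewrite rmorph_sum mulr_suml.
    under eq_bigr => j _ do rewrite mulr_sumr.
    over.
  rewrite exchange_big/=; apply: eq_bigr => j _.
  rewrite exchange_big/= (bigD1 j)//= [X in _ + X]big1 ?addr0 => [|k kj].
    under eq_bigr do rewrite rmorphM mulrACA.
    by rewrite -mulr_suml U_unitary eqxx mul1r.
  under eq_bigr do rewrite rmorphM mulrACA.
  by rewrite -mulr_suml U_unitary eq_sym (negbTE kj) mul0r.
- apply/funext => i; rewrite /mx_op.
  rewrite -[RHS]/(a * (\sum_(j < n) U x i j * u j) + \sum_(j < n) U x i j * v j).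
  rewrite mulr_sumr -big_split/=.
  by apply: eq_bigr => j _; rewrite -[(a *: u + v) j]/(a * u j + v j) mulrDr mulrCA.
Qed.

Lemma mx_op_continuous v : continuous (fun x => mx_op x v).
Proof.
move=> x; apply: cvg_l2 => i e e0.
have /ccontP : ccont (fun x => \sum_(j < n) U x i j * v j).
  by apply: ccont_sum => j; apply: ccont_mul => //; exact: ccont_cst.
exact.
Qed.

Definition mx_rep : unitaryRep R G :=
  UnitaryRep mx_op_unitary mx_op_mul mx_op_continuous.

End MatrixRep.

(** * Matrix coefficients *)

Section OrthonormalBasis.
Context {R : realType} {H : hilbertSpace R} {n : nat}.
Variable xi : 'I_n -> H.
Hypothesis xiP : orthonormal_basis xi.
Implicit Types (u v : H).

Lemma basis_expand u : u = \sum_(i < n) inner H u (xi i) *: xi i.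
Proof.
have [xiON /(_ u)[c {1 2}->]] := xiP.
apply: eq_bigr => i _; congr (_ *: _).
rewrite linear_sumlz (bigD1 i)//= linearZl_LR /= xiON eqxx mulr1 big1 ?addr0// => j ji.
by rewrite linearZl_LR /= xiON (negbTE ji) mulr0.
Qed.

Lemma inner_conj u v : inner H u v = Num.conj (inner H v u).
Proof. by rewrite hermC expr0 mul1r. Qed.

Lemma inner_coord u v :
  inner H u v = \sum_(i < n) inner H u (xi i) * Num.conj (inner H v (xi i)).
Proof.
rewrite {1}(basis_expand u) linear_sumlz; apply: eq_bigr => i _.
by rewrite linearZl_LR /= -inner_conj.
Qed.

Lemma inner_coord_le u i : cabs (inner H u (xi i)) <= rnorm u.
Proof.
rewrite -(ler_pXn2r (_ : 0 < 2)%N)// ?nnegrE ?cabs_ge0 ?rnorm_ge0// -lecR.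
rewrite [leRHS]rmorphXn /= rnormE -inner_norm [leRHS]inner_coord [leRHS](bigD1 i)//=.
by rewrite cabs2E lerDl sumr_ge0// => j _; exact: mul_conjC_ge0.
Qed.

End OrthonormalBasis.

Section RepMatrix.
Context {R : realType} {G : topGroupType}.
Variables (pi : unitaryRep R G) (n : nat) (xi : 'I_n -> rep_space pi).
Hypothesis xiP : orthonormal_basis xi.
Local Notation H := (rep_space pi).

Definition rep_mx (x : G) (i j : 'I_n) : R[i] := inner H (pi x (xi j)) (xi i).

Lemma rep_sum x I (s : seq I) (c : I -> R[i]) (u : I -> H) :
  pi x (\sum_(i <- s) c i *: u i) = \sum_(i <- s) c i *: pi x (u i).
Proof.
have [lin _ _] := rep_unitary pi x.
have lin0 : pi x 0 = 0.
  by have := lin (-1) 0 0; rewrite scaler0 add0r scaleN1r addNr.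
elim: s => [|i s ih]; first by rewrite !big_nil.
by rewrite !big_cons lin ih.
Qed.

Lemma rep_basis x j : pi x (xi j) = \sum_(i < n) rep_mx x i j *: xi i.
Proof. exact: basis_expand. Qed.

Lemma rep_mx_mul x y i j :
  rep_mx (x * y)%g i j = \sum_(k < n) rep_mx x i k * rep_mx y k j.
Proof.
rewrite {1}/rep_mx rep_mul rep_basis rep_sum linear_sumlz; apply: eq_bigr => k _.
by rewrite linearZl_LR /= mulrC.
Qed.

Lemma rep_mx_unitary x j k :
  \sum_(i < n) rep_mx x i j * Num.conj (rep_mx x i k) = (j == k)%:R.
Proof.
have [_ iso _] := rep_unitary pi x; have [ON _] := xiP.
by rewrite -ON -iso [RHS](inner_coord xiP).
Qed.

Lemma rep_one u : pi 1%g u = u.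
Proof.
have [_ _ /(_ u)[v <-]] := rep_unitary pi 1%g.
by rewrite -rep_mul mulg1.
Qed.

Lemma rep_mx_inv x i j : rep_mx x^-1%g i j = Num.conj (rep_mx x j i).
Proof.
have [_ iso _] := rep_unitary pi x.
by rewrite /rep_mx -iso -rep_mul mulgV rep_one inner_conj.
Qed.

Lemma rep_mx_one i j : rep_mx 1%g i j = (i == j)%:R.
Proof. by have [ON _] := xiP; rewrite /rep_mx rep_one ON eq_sym. Qed.

Lemma rep_mx_unitaryr x i k :
  \sum_(j < n) rep_mx x i j * Num.conj (rep_mx x k j) = (i == k)%:R.
Proof.
rewrite -rep_mx_one -(mulgV x) rep_mx_mul.
by apply: eq_bigr => j _; rewrite rep_mx_inv.
Qed.

Lemma rep_mx_cont i j : ccont (fun x => rep_mx x i j).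
Proof.
apply/ccontP => x e e0.
have /continuous_rnormP/(_ x e e0) := @rep_continuous R G pi (xi j).
apply: filterS => y; apply: le_lt_trans.
by rewrite /rep_mx -linearBl; exact: inner_coord_le.
Qed.

Lemma adjoint_basis x i j :
  inner H (adjoint (pi x) (xi j)) (xi i) = Num.conj (rep_mx x j i).
Proof.
rewrite /adjoint; case: xgetP => [w -> /= ->|].
  by rewrite inner_conj.
(* The operator of [x^-1] is an adjoint, so the default value of [xget] does not occur. *)
move=> /(_ (pi x^-1%g (xi j)))[] v /=.
have [_ iso _] := rep_unitary pi x.
by rewrite -iso -rep_mul mulgV rep_one.
Qed.

Lemma rep_mx_row_le x i : \sum_(j < n) cabs (rep_mx x i j) ^+ 2 = 1.
Proof.
apply: complexI; rewrite rmorph_sum rmorph1 /=.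
under eq_bigr do rewrite /= cabs2E.
by rewrite rep_mx_unitaryr eqxx.
Qed.

End RepMatrix.

(** * The span of the conjugated matrix coefficients *)

Section CoefSpan.
Context {R : realType} {G : topGroupType}.
Variable Gh : unitaryDual R G.
Implicit Types (f g : G -> R[i]).

Definition dual_mx (sigma : Gh) (x : G) (i j : 'I_(dual_dim sigma)) : R[i] :=
  rep_mx (dual_basis sigma) x i j.

(** The linear span as a smallest predicate, so that membership is itself an induction principle.
    The conjugates are the scalar weights that occur in [fourier]. *)
Definition coefspan f : Prop := forall S : (G -> R[i]) -> Prop,
  S (fun=> 0) -> (forall a f g, S f -> S g -> S (fun x => a * f x + g x)) ->
  (forall sigma i j, S (fun x => Num.conj (dual_mx (sigma := sigma) x i j))) -> S f.

Lemma coefspan0 : coefspan (fun=> 0).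
Proof. by move=> S S0. Qed.

Lemma coefspan_lin a f g : coefspan f -> coefspan g ->
  coefspan (fun x => a * f x + g x).
Proof.
by move=> cf cg S S0 Sl Sc; apply: (Sl a f g); [exact: cf|exact: cg].
Qed.

Lemma coefspan_coef sigma i j :
  coefspan (fun x => Num.conj (dual_mx (sigma := sigma) x i j)).
Proof. by move=> S S0 Sl Sc; exact: Sc. Qed.

Lemma coefspan_cont f : coefspan f -> ccont f.
Proof.
apply; first exact: ccont_cst; first exact: ccont_lin.
by move=> sigma i j; apply: ccont_conj; apply: rep_mx_cont; exact: dual_basisP.
Qed.

Lemma coefspan_sum I (s : seq I) (c : I -> R[i]) (F : I -> G -> R[i]) :
  (forall i, coefspan (F i)) -> coefspan (fun x => \sum_(i <- s) c i * F i x).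
Proof.
move=> cF; elim: s => [|i s ih].
  by under eq_fun do rewrite big_nil; exact: coefspan0.
by under eq_fun do rewrite big_cons; exact: coefspan_lin.
Qed.

(* Every irreducible representation is equivalent to some [sigma] in [Gh], so
   its conjugated matrix coefficients are combinations of those of [sigma]. *)
Lemma coefspan_irreducible (pi : unitaryRep R G) (u v : rep_space pi) :
  irreducible_rep pi ->
  coefspan (fun x => Num.conj (inner (rep_space pi) (pi x u) v)).
Proof.
move=> /(dual_surj Gh)[sigma [F [[_ Fiso Fsurj] FE]]].
have [u' <-] := Fsurj u; have [v' <-] := Fsurj v.
have xiP := @dual_basisP _ _ Gh sigma.
pose H := rep_space (dual_rep sigma).
pose xi := dual_basis sigma.
rewrite (_ : (fun x => _) = fun x => \sum_(i < dual_dim sigma)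
    inner H v' (xi i) * (\sum_(j < dual_dim sigma)
    Num.conj (inner H u' (xi j)) * Num.conj (dual_mx x i j))); last first.
  apply/funext => x; rewrite -FE Fiso (inner_coord xiP) rmorph_sum.
  apply: eq_bigr => i _; rewrite rmorphM /= conjCK mulrC; congr (_ * _).
  rewrite (basis_expand xiP u') rep_sum linear_sumlz rmorph_sum.
  apply: eq_bigr => j _; rewrite linearZl_LR /= rmorphM /=; congr (Num.conj _ * _).
  by rewrite -(basis_expand xiP u').
by apply: coefspan_sum => i; apply: coefspan_sum => j; exact: coefspan_coef.
Qed.

End CoefSpan.

(** * Density of the matrix coefficients *)

Lemma ultra_bounded_cvg (R : realType) (U : set_system nat) (r : nat -> R) (B : R) :
  UltraFilter U -> (forall n, `|r n| <= B) -> exists p : R, r @ U --> p.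
Proof.
move=> UU rB; have := @segment_compact R (- B) B.
move=> /(_ (r @ U) _)[|p [_ clp]].
  by apply: nearW => n; rewrite /= in_itv/= -ler_norml.
exists p => A nA; have [//|UnA] := in_ultra_setVsetC (r @^-1` A) UU.
have [y [/= nAy Ay]] := clp (~` A) A UnA nA.
by [].
Qed.

Section Ascoli.
Context {R : realType} {G : topGroupType}.
Hypothesis cG : compact [set: G].

(** Arzela-Ascoli for a sequence on a compact group that may have no convergent subsequence: the
    pointwise limit is taken along an ultrafilter finer than [\oo]. Equicontinuity passes to the
    limit, and a finite cover makes the approximation uniform for arbitrarily large [n]. *)
Lemma equicontinuous_cluster (u : nat -> G -> R[i]) (B : R) :
  (forall n x, cabs (u n x) <= B) ->
  (forall x (e : R), 0 < e ->
    \forall x' \near x, forall n, cabs (u n x - u n x') <= e) ->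
  exists2 g : G -> R[i], ccont g & forall (e : R) N, 0 < e ->
    exists2 n, (N <= n)%N & forall x, cabs (u n x - g x) <= e.
Proof.
move=> uB ueq.
have [U [UU Uoo]] := ultraFilterLemma (eventually_filter).
have cvgRe x : exists p : R, complex.Re (u n x) @[n --> U] --> p.
  apply: (ultra_bounded_cvg (B := B)) => n.
  exact: le_trans (ler_Re_cabs _) (uB _ _).
have cvgIm x : exists p : R, complex.Im (u n x) @[n --> U] --> p.
  apply: (ultra_bounded_cvg (B := B)) => n.
  exact: le_trans (ler_Im_cabs _) (uB _ _).
have [p up] := choice cvgRe; have [q uq] := choice cvgIm.
pose g x : R[i] := p x +i* q x.
have ug x (e : R) : 0 < e -> \forall n \near U, cabs (u n x - g x) < e.
  move=> e0; have e2 : 0 < e / 2 by rewrite divr_gt0.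
  have /cvgrPdist_lt/(_ _ e2) upx := up x.
  have /cvgrPdist_lt/(_ _ e2) uqx := uq x.
  near=> n; rewrite (le_lt_trans (cabs_le_ReIm _))// (splitr e) ltrD//.
    rewrite raddfB /= distrC; near: n; exact: upx.
  rewrite raddfB /= distrC; near: n; exact: uqx.
have gxx x x' (e : R) : (forall n, cabs (u n x - u n x') <= e) ->
    cabs (g x - g x') <= e.
  move=> ue; apply/ler_addgt0Pr => d d0; have d2 : 0 < d / 2 by rewrite divr_gt0.
  near U => n.
  have -> : g x - g x' = (u n x - u n x') + ((u n x' - g x') - (u n x - g x)) by ring.
  rewrite (le_trans (cabsD _ _))// lerD// (splitr d) (le_trans (cabsD _ _))//.
  rewrite lerD//; last rewrite cabsN.
    by apply: ltW; near: n; exact: ug.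
  by apply: ltW; near: n; exact: ug.
have cg : ccont g.
  apply/ccontP => x e e0; have e2 : 0 < e / 2 by rewrite divr_gt0.
  apply: filterS (ueq x _ e2) => x' /gxx gx; apply: (le_lt_trans gx).
  by rewrite ltr_pdivrMr// ltr_pMr// ltr1n.
exists g => // e N e0; have e3 : 0 < e / 3 by rewrite divr_gt0.
have [s sP] := finite_subcover cG (fun x => ueq x _ e3).
have : \forall n \near U, forall x, x \in s -> cabs (u n x - g x) < e / 3.
  elim: (s) => [|x t ih]; first exact: nearW.
  near=> n => y; rewrite inE => /predU1P[->|yt].
    by near: n; exact: ug.
  by move: y yt; near: n; exact: ih.
move=> us; have Uge : U [set n | (N <= n)%N] by apply: Uoo; exact: nbhs_infty_ge.
have [n [un /= Nn]] := filter_ex (filterI us Uge).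
exists n => // x; have /hasP[y ys /asboolP ux] := sP x.
have -> : u n x - g x = (u n y - g y) + ((g y - g x) - (u n y - u n x)) by ring.
rewrite (_ : e = e / 3 + (e / 3 + e / 3)); last by field.
rewrite (le_trans (cabsD _ _))// lerD//; first by apply: ltW; exact: un.
rewrite (le_trans (cabsD _ _))// lerD//; first exact: gxx.
by rewrite cabsN.
Unshelve. all: by end_near. Qed.

End Ascoli.

Lemma sub_prehilbert (R : realType) (X : Type) (S S' : (X -> R[i]) -> Prop) b :
  prehilbert S b -> (forall f, S' f -> S f) -> S' (fun=> 0) ->
  (forall (a : R[i]) f g, S' f -> S' g -> S' (fun x => a * f x + g x)) ->
  prehilbert S' b.
Proof.
move=> [z ls l c p d] SS z' ls'; split => //.
- by move=> a f g h Sf Sg Sh; apply: l; exact: SS.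
- by move=> f g Sf Sg; apply: c; exact: SS.
- by move=> f Sf; apply: p; exact: SS.
- by move=> f Sf; apply: d; exact: SS.
Qed.

Lemma cabs_small_eq0 (R : realType) (C : R) (z : R[i]) :
  (forall e : R, 0 < e -> cabs z <= C * e) -> z = 0.
Proof.
move=> zC; have C1 : 0 < `|C| + 1 by rewrite ltr_wpDl.
apply/eqP; rewrite -normr_eq0 -cabsE; apply/eqP; congr (_%:C).
apply/eqP; rewrite eq_le cabs_ge0 andbT; apply/ler_addgt0Pl => e e0; rewrite addr0.
have e1 : 0 < e / (`|C| + 1) by rewrite divr_gt0.
rewrite (le_trans (zC _ e1))// mulrCA ler_piMr ?(ltW e0)//.
by rewrite ler_pdivrMr// mul1r (le_trans (ler_norm _))// lerDl.
Qed.

(** * Convolution operators on continuous functions *)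

Section ConvolutionOperator.
Context {R : realType} {G : topGroupType}.
Hypothesis cG : compact [set: G].
Variable mu : probability (borel G) R.
Hypothesis mu_haar : haar_probability mu.
Implicit Types (f g h : G -> R[i]).
Local Notation sI := (sI mu).
Local Notation ip := (ip mu).
Local Notation nn := (n2 ip).

Lemma prehilbert_ip : prehilbert (@ccont R G) ip.
Proof.
split.
- exact: ccont_cst.
- exact: ccont_lin.
- exact: ip_linear.
- exact: ip_conj.
- exact: ip_ge0.
- exact: ip_eq0.
Qed.

Lemma nn_le_sup f (M : R) : ccont f -> (forall x, cabs (f x) <= M) -> nn f <= M ^+ 2.
Proof.
move=> cf fM; rewrite -lecR -(n2E prehilbert_ip cf) -(sI_cst mu (M ^+ 2)%:C).
apply: (sI_le cG); first exact: ccont_ip.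
  exact: ccont_cst.
move=> x; rewrite -cabs2E lecR ler_pXn2r// ?nnegrE ?cabs_ge0//.
by rewrite (le_trans _ (fM x))// cabs_ge0.
Qed.

Variable kap : G -> R[i].
Hypothesis kap_cont : ccont kap.
Hypothesis kap_real : forall x, Num.conj (kap x) = kap x.
Hypothesis kap_sym : forall x, kap x^-1%g = kap x.

(** The kernel depends on [x^-1 * y] only, so that [Top] commutes with left translations; [kap_real]
    and [kap_sym] make it selfadjoint. *)
Definition Top f x : R[i] := sI (fun y => kap (x^-1 * y)%g * f y).

Lemma continuous_invmul :
  continuous (fun p : G * G => (p.1^-1 * p.2)%g).
Proof.
move=> p; apply: (@continuous_comp _ _ _ (fun p : G * G => (p.1^-1, p.2)%g)
  (fun p => (p.1 * p.2)%g)).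
  apply: cvg_pair => /=; last exact: cvg_snd.
  apply: (@continuous_comp _ _ _ fst (fun x : G => x^-1%g)); first exact: cvg_fst.
  exact: invg_continuous.
exact: mulg_continuous.
Qed.

Lemma ccont_kap : ccont (fun p : G * G => kap (p.1^-1 * p.2)%g).
Proof. by apply: ccont_comp; first exact: continuous_invmul. Qed.

Lemma ccont_Tint x f : ccont f -> ccont (fun y => kap (x^-1 * y)%g * f y).
Proof. by move=> cf; apply: ccont_mul => //; exact: ccont_left. Qed.

Lemma Top_cont f : ccont f -> ccont (Top f).
Proof.
move=> cf; apply: (ccont_sI cG mu (k := fun p => kap (p.1^-1 * p.2)%g * f p.2)).
apply: ccont_mul; first exact: ccont_kap.
by apply: ccont_comp cf => p; exact: cvg_snd.
Qed.

Lemma Top_lin a f g : ccont f -> ccont g ->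
  Top (fun x => a * f x + g x) = fun x => a * Top f x + Top g x.
Proof.
move=> cf cg; apply/funext => x; rewrite /Top.
rewrite -(sI_linear cG mu a (ccont_Tint x cf) (ccont_Tint x cg)); congr sI.
by apply/funext => y; rewrite mulrDr mulrCA.
Qed.

Lemma Top0 : Top (fun=> 0) = fun=> 0.
Proof.
apply/funext => x; rewrite /Top -[RHS](sI_cst mu 0); congr sI.
by apply/funext => y; rewrite mulr0.
Qed.

Lemma Top_scale a f : ccont f -> Top (fun x => a * f x) = fun x => a * Top f x.
Proof.
move=> cf; have := Top_lin a cf (@ccont_cst R G 0); rewrite Top0.
under eq_fun do rewrite addr0; move=> ->.
by apply/funext => x; rewrite addr0.
Qed.

Lemma Top_sub f g : ccont f -> ccont g ->
  Top (fun x => f x - g x) = fun x => Top f x - Top g x.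
Proof.
move=> cf cg; have := Top_lin (-1) cg cf.
under eq_fun do rewrite mulN1r addrC; move=> ->.
by apply/funext => x; rewrite mulN1r addrC.
Qed.

Lemma Top_ip f x : ccont f -> Top f x = ip f (fun y => kap (x^-1 * y)%g).
Proof. by move=> cf; congr sI; apply/funext => y; rewrite kap_real mulrC. Qed.

Lemma Top_sa f g : ccont f -> ccont g -> ip (Top f) g = ip f (Top g).
Proof.
move=> cf cg.
pose k (p : G * G) := kap (p.1^-1 * p.2)%g * f p.2 * Num.conj (g p.1).
have ck : ccont k.
  apply: ccont_mul; last by apply: ccont_conj; apply: ccont_comp cg => p; exact: cvg_fst.
  apply: ccont_mul; first exact: ccont_kap.
  by apply: ccont_comp cf => p; exact: cvg_snd.
transitivity (sI (fun x => sI (fun y => k (x, y)))).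
  congr sI; apply/funext => x.
  rewrite mulrC -(sIZ cG mu _ (ccont_Tint x cf)); congr sI.
  by apply/funext => y; rewrite mulrC.
rewrite (sI_Fubini cG mu ck); congr sI; apply/funext => y.
rewrite /Top -(sI_conj cG mu (ccont_Tint y cg)).
rewrite -(sIZ cG mu); last by apply: ccont_conj; exact: ccont_Tint.
congr sI; apply/funext => x; rewrite rmorphM /= kap_real -[kap (y^-1 * x)%g]kap_sym.
by rewrite invgM invgK /k /=; ring.
Qed.

Lemma Top_left a f : ccont f ->
  Top (fun x => f (a * x)%g) = fun x => Top f (a * x)%g.
Proof.
move=> cf; apply/funext => x; rewrite /Top.
rewrite -(sI_left cG mu_haar a (ccont_Tint (a * x)%g cf)); congr sI.
by apply/funext => y; rewrite invgM mulgA mulgVK.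
Qed.

(** Cauchy-Schwarz, all translates of [kap] having the norm of [kap]. A bound in the norm of [ip]
    becomes a uniform one, so that images under [Top] have continuous uniform cluster points. *)
Lemma Top_bound f x : ccont f -> cabs (Top f x) ^+ 2 <= nn kap * nn f.
Proof.
move=> cf; rewrite Top_ip// mulrC.
have ckx : ccont (fun y => kap (x^-1 * y)%g) by exact: ccont_left.
rewrite (le_trans (cauchy_schwarz prehilbert_ip cf ckx))//.
by rewrite /n2 (ip_left cG mu_haar).
Qed.

Lemma Top_equicontinuous x (e : R) : 0 < e -> \forall x' \near x,
  forall f, ccont f -> cabs (Top f x - Top f x') ^+ 2 <= e ^+ 2 * nn f.
Proof.
move=> e0; have := ccont_tube cG x ccont_kap e0; apply: filterS => x' /= kx f cf.
have ck z : ccont (fun y => kap (z^-1 * y)%g) by exact: ccont_left.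
rewrite !Top_ip// -(b_subr prehilbert_ip)// mulrC.
have ckk : ccont (fun y => kap (x^-1 * y)%g - kap (x'^-1 * y)%g) by exact: ccont_sub.
rewrite (le_trans (cauchy_schwarz prehilbert_ip cf ckk))// ler_wpM2l//.
  exact: (n2_ge0 prehilbert_ip).
by apply: nn_le_sup => // y; exact: ltW.
Qed.

Lemma Top_nn_le f : ccont f -> nn (Top f) <= nn kap * nn f.
Proof.
move=> cf; rewrite -[leRHS]sqr_sqrtr; last first.
  by rewrite mulr_ge0// (n2_ge0 prehilbert_ip).
apply: nn_le_sup; first exact: Top_cont.
move=> x; rewrite -(ler_pXn2r (_ : 0 < 2)%N)// ?nnegrE ?cabs_ge0 ?sqrtr_ge0//.
by rewrite sqr_sqrtr ?Top_bound// mulr_ge0// (n2_ge0 prehilbert_ip).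
Qed.

Variable Gh : unitaryDual R G.
Local Notation coefspan := (coefspan Gh).

Lemma coefspan_Top f : coefspan f -> coefspan (Top f).
Proof.
move=> cf; suff [] : ccont f /\ coefspan (Top f) by [].
apply: (cf (fun f => ccont f /\ coefspan (Top f))) => [|a f1 g [cf1 Tf] [cg Tg]|sigma i j].
- split; first exact: ccont_cst.
  by rewrite Top0; exact: coefspan0.
- split; first exact: ccont_lin.
  by rewrite Top_lin//; exact: coefspan_lin.
pose D (x : G) (i j : 'I_(dual_dim sigma)) := dual_mx x i j.
have cD k l : ccont (fun x => Num.conj (D x k l)).
  by apply: coefspan_cont; exact: coefspan_coef.
split; first exact: cD.
(* Substituting [x * y] for [y] frees the kernel of [x], and the coefficient at [x * y] splits by
   multiplicativity of the representation. *)
rewrite (_ : Top _ = fun x => \sum_(k < dual_dim sigma)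
    sI (fun y => kap y * Num.conj (D y k j)) * Num.conj (D x i k)).
  by apply: coefspan_sum => k; exact: coefspan_coef.
apply/funext => x; rewrite /Top -(sI_left cG mu_haar x (ccont_Tint x (cD i j))).
under eq_bigr do rewrite mulrC -(sIZ cG mu _ (ccont_mul kap_cont (cD _ _))).
rewrite -(sI_sum cG mu _ predT); last first.
  by move=> k; apply: ccont_mul; [exact: ccont_cst|exact: ccont_mul].
congr sI; apply/funext => y; rewrite mulKg /D /dual_mx.
rewrite (rep_mx_mul (@dual_basisP _ _ Gh sigma)) rmorph_sum mulr_sumr.
by apply: eq_bigr => k _; rewrite rmorphM /= mulrCA.
Qed.

Definition coefperp f : Prop := ccont f /\ forall m, coefspan m -> ip f m = 0.

Lemma coefperp_cont f : coefperp f -> ccont f. Proof. by case. Qed.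

Lemma coefperp_lin a f g : coefperp f -> coefperp g ->
  coefperp (fun x => a * f x + g x).
Proof.
move=> [cf pf] [cg pg]; split=> [|m cm]; first exact: ccont_lin.
by rewrite (ph_lin prehilbert_ip)// ?pf ?pg// ?mulr0 ?addr0//; exact: coefspan_cont cm.
Qed.

Lemma prehilbert_coefperp : prehilbert coefperp ip.
Proof.
apply: (sub_prehilbert prehilbert_ip) => [f []//||]; last exact: coefperp_lin.
split=> [|m cm]; first exact: ccont_cst.
by rewrite (b0l prehilbert_ip)//; exact: coefspan_cont cm.
Qed.

Lemma coefperp_Top f : coefperp f -> coefperp (Top f).
Proof.
move=> [cf pf]; split=> [|m cm]; first exact: Top_cont.
rewrite Top_sa//; last exact: coefspan_cont cm.
by apply: pf; exact: coefspan_Top.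
Qed.

Lemma coefspan_left a f : coefspan f -> coefspan (fun x => f (a * x)%g).
Proof.
move=> cf; apply: (cf (fun f => coefspan (fun x => f (a * x)%g))).
- exact: coefspan0.
- by move=> c g h; exact: coefspan_lin.
move=> sigma i j.
rewrite (_ : (fun x => _) = fun x => \sum_(k < dual_dim sigma)
    Num.conj (dual_mx a i k) * Num.conj (dual_mx x k j)).
  by apply: coefspan_sum => k; exact: coefspan_coef.
apply/funext => x; rewrite /dual_mx (rep_mx_mul (@dual_basisP _ _ Gh sigma)).
by rewrite rmorph_sum; apply: eq_bigr => k _; rewrite rmorphM.
Qed.

Lemma coefperp_left a f : coefperp f -> coefperp (fun x => f (a * x)%g).
Proof.
move=> [cf pf]; split=> [|m cm]; first exact: ccont_left.
rewrite -(pf _ (coefspan_left a^-1%g cm)).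
rewrite -[RHS](ip_left cG mu_haar a)//; last first.
  by apply: ccont_left; exact: coefspan_cont cm.
by congr ip; apply/funext => x; rewrite mulKg.
Qed.

Lemma coefperp_closed g : ccont g ->
  (forall e : R, 0 < e -> exists2 f, coefperp f & forall x, cabs (g x - f x) <= e) ->
  coefperp g.
Proof.
move=> cg gf; split=> // m cm; have ccm := coefspan_cont cm.
have m0 := n2_ge0 prehilbert_ip ccm.
apply: (cabs_small_eq0 (C := nn m + 1)).
move=> e e0; have [f [cf pf] gfe] := gf e e0.
have -> : ip g m = ip (fun x => g x - f x) m.
  by rewrite (b_subl prehilbert_ip)// pf// subr0.
have cgf : ccont (fun x => g x - f x) by exact: ccont_sub.
rewrite cabs_le_sqr; last by rewrite mulr_ge0 ?addr_ge0// ltW.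
rewrite (le_trans (cauchy_schwarz prehilbert_ip cgf ccm))// mulrC exprMn.
rewrite mulrC [leRHS]mulrC; apply: ler_pM => //; first exact: (n2_ge0 prehilbert_ip).
  exact: nn_le_sup.
by rewrite expr2; nra.
Qed.

Lemma Top_sup f (e : R) x : ccont f -> (forall x, cabs (f x) <= e) ->
  cabs (Top f x) <= Num.sqrt (nn kap) * e.
Proof.
move=> cf fe; have e0 : 0 <= e by rewrite (le_trans _ (fe x))// cabs_ge0.
rewrite cabs_le_sqr; last by rewrite mulr_ge0 ?sqrtr_ge0.
rewrite (le_trans (Top_bound x cf))// exprMn sqr_sqrtr; last first.
  exact: (n2_ge0 prehilbert_ip).
by rewrite ler_wpM2l ?nn_le_sup//; exact: (n2_ge0 prehilbert_ip).
Qed.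

Lemma Top_cluster (f : nat -> G -> R[i]) (B : R) :
  (forall n, ccont (f n)) -> (forall n, nn (f n) <= B) ->
  exists2 g, ccont g & forall (e : R) N, 0 < e ->
    exists2 n, (N <= n)%N & forall x, cabs (Top (f n) x - g x) <= e.
Proof.
move=> cf fB; have B0 : 0 <= B.
  by rewrite (le_trans _ (fB 0%N))// (n2_ge0 prehilbert_ip).
have k0 := n2_ge0 prehilbert_ip kap_cont.
apply: (equicontinuous_cluster cG (B := Num.sqrt (nn kap * B))) => [n x|x e e0].
  rewrite cabs_le_sqr ?sqrtr_ge0// sqr_sqrtr ?mulr_ge0//.
  by rewrite (le_trans (Top_bound x (cf n)))// ler_wpM2l.
have B1 : 0 < B + 1 by rewrite ltr_wpDl.
have e1 : 0 < e / (B + 1) by rewrite divr_gt0.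
apply: filterS (Top_equicontinuous x e1) => x' h n.
rewrite cabs_le_sqr; last exact: ltW.
rewrite (le_trans (h _ (cf n)))// exprMn -mulrA ler_piMr ?sqr_ge0//.
rewrite (@le_trans _ _ ((B + 1)^-1 ^+ 2 * (B + 1)))//.
  by rewrite ler_wpM2l ?sqr_ge0// (le_trans (fB n))// lerDl.
rewrite expr2 mulfVK ?gt_eqF// invf_le1//; lra.
Qed.

Lemma nn_scale_unit f : ccont f -> nn f != 0 ->
  exists2 c : R, 0 < c & nn (fun x => c%:C * f x) = 1 /\ c ^+ 2 = (nn f)^-1.
Proof.
move=> cf f0; have fp : 0 < nn f.
  by rewrite lt_neqAle eq_sym f0 (n2_ge0 prehilbert_ip).
exists (Num.sqrt (nn f))^-1; first by rewrite invr_gt0 sqrtr_gt0.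
have cE : (Num.sqrt (nn f))^-1 ^+ 2 = (nn f)^-1 by rewrite exprVn sqr_sqrtr// ltW.
split=> //; rewrite (n2_scale prehilbert_ip)// cabsR real_normK ?num_real// cE.
by rewrite mulVf.
Qed.

(* [g] is a uniform cluster point of [Top f_n], where the [f_n] are unit
   vectors along which the norm of [Top f_n] tends to its supremum. *)
Lemma Top_eigenvector f0 : coefperp f0 -> Top f0 <> (fun=> 0) ->
  exists2 lam : R, 0 < lam & exists2 g, coefperp g /\ g <> (fun=> 0) &
    Top (Top g) = fun x => lam%:C * g x.
Proof.
move=> pf0 Tf0.
pose A : set R := [set nn (Top f) | f in [set f | coefperp f /\ nn f <= 1]].
have k0 := n2_ge0 prehilbert_ip kap_cont.
have Aub : has_ubound A.
  exists (nn kap) => _ [f [[cf _] f1] <-].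
  by rewrite (le_trans (Top_nn_le cf))// ler_piMr.
pose M := sup A.
have Mhom f : coefperp f -> nn (Top f) <= M * nn f.
  move=> pf; have cf := coefperp_cont pf.
  have [fz|fnz] := eqVneq (nn f) 0.
    rewrite fz mulr0 (le_trans (Top_nn_le cf))// fz mulr0//.
  have [c c0 [cn cE]] := nn_scale_unit cf fnz.
  have fp : 0 < nn f by rewrite lt_neqAle eq_sym fnz (n2_ge0 prehilbert_ip).
  rewrite -ler_pdivrMr// mulrC -cE.
  apply: (ub_le_sup Aub); exists (fun x => c%:C * f x).
    split; last by rewrite cn.
    exact: (S_scale prehilbert_coefperp).
  rewrite Top_scale//.
  rewrite (n2_scale prehilbert_ip)//; last exact: Top_cont.
  by rewrite cabsR real_normK// num_real.
have M0 : 0 < M.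
  have cf := coefperp_cont pf0.
  have T0 : 0 < nn (Top f0).
    rewrite lt_neqAle (n2_ge0 prehilbert_ip) ?andbT; last exact: Top_cont.
    apply: contra_notN Tf0 => /eqP/esym; apply: (n2_eq0 prehilbert_ip).
    exact: Top_cont.
  have := lt_le_trans T0 (Mhom f0 pf0).
  by rewrite pmulr_lgt0// lt_neqAle (n2_ge0 prehilbert_ip)// andbT; apply/negP => /eqP f00;
    move: (Mhom _ pf0); rewrite -f00 mulr0 leNgt T0.
have A0 : A !=set0.
  exists (nn (Top (fun=> 0))), (fun=> 0) => //; split.
    exact: (ph_zero prehilbert_coefperp).
  by rewrite /n2 (b0l prehilbert_ip)//; exact: ccont_cst.
have /choice[f fP] (n : nat) : exists f, [/\ coefperp f, nn f <= 1 &
    M - n.+1%:R^-1 < nn (Top f)].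
  have [|_ [f [pf f1] <-] Mf] := @sup_adherent R A n.+1%:R^-1 _ (conj A0 Aub).
    by rewrite invr_gt0.
  by exists f.
have pf n : coefperp (f n) by have [] := fP n.
have cf n : ccont (f n) by exact: coefperp_cont.
have [g cg gcl] := Top_cluster cf (B := 1) (fun n => let: And3 _ h _ := fP n in h).
have pg : coefperp g.
  apply: coefperp_closed => // e e0; have [n _ fg] := gcl e 0%N e0.
  by exists (Top (f n)); [exact: coefperp_Top|move=> x; rewrite -cabsN opprB].
have TTf n : coefperp (Top (Top (f n))) by do 2!apply: coefperp_Top.
exists M => //; exists g.
  (* If [g] were 0, some [Top (f n)] would have squared norm at most [M / 4] and yet above
     [M / 2]. *)
  split=> // g0; have e0 : 0 < Num.sqrt M / 2 by rewrite divr_gt0 ?sqrtr_gt0.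
  have M2 : 0 < M / 2 by rewrite divr_gt0.
  near \oo => N.
  have [n Nn fg] := gcl (Num.sqrt M / 2) N e0.
  have : nn (Top (f n)) <= (Num.sqrt M / 2) ^+ 2.
    apply: nn_le_sup; first exact: Top_cont.
    by move=> x; move: (fg x); rewrite g0 subr0.
  have [_ _] := fP n.
  have : n.+1%:R^-1 < M / 2.
    have : N.+1%:R^-1 < M / 2 by near: N; exact: near_infty_natSinv_lt (PosNum M2).
    by apply: le_lt_trans; rewrite lef_pV2 ?posrE ?ler_nat.
  have -> : (Num.sqrt M / 2) ^+ 2 = M / 4.
    by rewrite exprMn sqr_sqrtr ?ltW//; field.
  move: M0 => {Tf0 g0}; move: (nn (Top (f n))) (n.+1%:R^-1 : R) (M) => t q m *; lra.
pose K := Num.sqrt (nn kap).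
have K0 : 0 <= K by exact: sqrtr_ge0.
apply/funext => x; apply/eqP; rewrite -subr_eq0; apply/eqP.
apply: (cabs_small_eq0 (C := K + K * K + M)) => e e0.
have eM : 0 < e ^+ 2 / M by rewrite divr_gt0 ?exprn_gt0.
near \oo => N; have [n Nn fg] := gcl e N e0.
pose h x := Top (f n) x - g x.
have ch : ccont h by apply: ccont_sub => //; exact: Top_cont.
pose w x := (- M%:C) * f n x + Top (Top (f n)) x.
have cw : ccont w by apply: ccont_lin => //; exact: coefperp_cont.
(* With [t = nn (Top (f n))], selfadjointness makes the cross term [- 2 * M * t], and the two
   squares are at most [M * t] and [M ^+ 2]. The total is at most [M * (M - t)], hence at most
   [M / n.+1%:R]. *)
have we : nn w <= e ^+ 2.
  rewrite (n2_lin prehilbert_ip)//; last exact: coefperp_cont.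
  rewrite -Top_sa//; last by apply: Top_cont.
  rewrite (n2E prehilbert_ip); last exact: Top_cont.
  rewrite -rmorphN -rmorphM /= cabsR normrN gtr0_norm//.
  have := Mhom _ (coefperp_Top (pf n)).
  have [_ f1 ft] := fP n.
  have nN : n.+1%:R^-1 <= e ^+ 2 / M.
    have : N.+1%:R^-1 < e ^+ 2 / M by near: N; exact: near_infty_natSinv_lt (PosNum eM).
    move/ltW; apply: le_trans; by rewrite lef_pV2 ?posrE ?ler_nat.
  have {}nN : M * n.+1%:R^-1 <= e ^+ 2 by rewrite mulrC -ler_pdivlMr.
  move: ft nN f1; set t := nn (Top (f n)); set q := n.+1%:R^-1 => ft nN f1.
  have : M ^+ 2 * nn (f n) <= M ^+ 2 by rewrite ler_piMr// sqr_ge0.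
  have : M * (M - t) <= M * q by rewrite ler_wpM2l ?ltW//; lra.
  by rewrite expr2; lra.
(* [w] is small only in the norm of [ip]; one more [Top] makes it uniformly small, and [h] is
   uniformly small already. *)
have -> : Top (Top g) x - M%:C * g x =
    Top w x - (Top (Top h) x - M%:C * h x).
  rewrite /w Top_lin//; last exact: coefperp_cont.
  rewrite /h Top_sub//; last exact: Top_cont.
  rewrite Top_sub; [by ring|do 2!apply: Top_cont|apply: Top_cont] => //.
have he y : cabs (h y) <= e by exact: fg.
rewrite (_ : (K + K * K + M) * e = K * e + (K * (K * e) + M * e)); last by ring.
rewrite (le_trans (cabsD _ _))// cabsN lerD//.
  rewrite cabs_le_sqr ?mulr_ge0 ?(ltW e0)// (le_trans (Top_bound x cw))// exprMn.
  by rewrite sqr_sqrtr// ler_wpM2l.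
rewrite (le_trans (cabsD _ _))// lerD//.
  apply: Top_sup; first exact: Top_cont.
  by move=> y; apply: Top_sup.
by rewrite cabsN cabsM cabsR gtr0_norm// ler_wpM2l// ltW.
Unshelve. all: by end_near. Qed.

Section Eigenspace.
Variable lam : R.
Hypothesis lam_gt0 : 0 < lam.

(** Eigenvectors of the square of [Top]: maximizing the norm determines the square of an eigenvalue
    of [Top], not its sign. *)
Definition eigenspace f : Prop :=
  coefperp f /\ Top (Top f) = fun x => lam%:C * f x.

Lemma prehilbert_eigenspace : prehilbert eigenspace ip.
Proof.
apply: (sub_prehilbert prehilbert_coefperp) => [f []//||a f g [pf Tf] [pg Tg]].
- split; first exact: (ph_zero prehilbert_coefperp).
  by rewrite !Top0; apply/funext => x; rewrite mulr0.
have cf := coefperp_cont pf; have cg := coefperp_cont pg.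
split; first exact: coefperp_lin.
rewrite Top_lin// Top_lin; [|exact: Top_cont|exact: Top_cont].
by rewrite Tf Tg; apply/funext => x; rewrite mulrDr mulrCA.
Qed.

Lemma eigenspace_left a f : eigenspace f -> eigenspace (fun x => f (a * x)%g).
Proof.
move=> [pf Tf]; have cf := coefperp_cont pf; split; first exact: coefperp_left.
by rewrite !Top_left// ?Tf//; exact: Top_cont.
Qed.

(* Bessel's inequality for the translates of the kernel. *)
Lemma eigenspace_dim n (e : 'I_n -> G -> R[i]) : orthonormal_in eigenspace ip e ->
  n%:R <= (nn kap / lam) ^+ 2.
Proof.
move=> [Ve ee]; have ce i : ccont (e i) by have [/coefperp_cont] := Ve i.
have eON : orthonormal_in (@ccont R G) ip e by split.
have k0 := n2_ge0 prehilbert_ip kap_cont.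
have pw x : \sum_(i < n) cabs (e i x) ^+ 2 <= (nn kap / lam) ^+ 2.
  have ck : ccont (fun y => kap (x^-1 * y)%g) by exact: ccont_left.
  rewrite exprMn exprVn ler_pdivlMr ?exprn_gt0// mulr_suml.
  (* [lam * e i x] is [Top (Top (e i)) x], the inner product of [Top (e i)] with a translated
     kernel; selfadjointness moves the remaining [Top] onto the kernel. *)
  have -> : \sum_(i < n) cabs (e i x) ^+ 2 * lam ^+ 2 =
      \sum_(i < n) cabs (ip (Top (fun y => kap (x^-1 * y)%g)) (e i)) ^+ 2.
    apply: eq_bigr => i _; have [_ Te] := Ve i.
    rewrite Top_sa// (ph_conj prehilbert_ip) ?cabs_conj//; last exact: Top_cont.
    rewrite -Top_ip ?Te; last exact: Top_cont.
    by rewrite cabsM cabsR gtr0_norm// exprMn mulrC.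
  rewrite (le_trans (bessel prehilbert_ip eON (Top_cont ck)))//.
  rewrite (le_trans (Top_nn_le ck))// expr2 ler_wpM2l//.
  by rewrite /n2 (ip_left cG mu_haar).
(* Integrated over [G], the sum of squared moduli gives [n], while the constant bound is unchanged
   since [mu] has mass 1. *)
have cs : ccont (fun x => \sum_(i < n) e i x * Num.conj (e i x)).
  by apply: ccont_sum => i; exact: ccont_ip.
rewrite -lecR -(sI_cst mu ((nn kap / lam) ^+ 2)%:C).
have -> : (n%:R)%:C = sI (fun x => \sum_(i < n) e i x * Num.conj (e i x)).
  rewrite (sI_sum cG mu _ predT) => [|i]; last exact: ccont_ip.
  transitivity (\sum_(i < n) ip (e i) (e i)) => //.
  under eq_bigr do rewrite ee eqxx.
  by rewrite sumr_const card_ord rmorph_nat.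
apply: (sI_le cG) => //; first exact: ccont_cst.
move=> x; under eq_bigr do rewrite -cabs2E.
by rewrite -rmorph_sum lecR.
Qed.

End Eigenspace.

Definition translation_stable n (e : 'I_n -> G -> R[i]) : Prop :=
  forall a j, exists c : 'I_n -> R[i],
    (fun x => e j (a * x)%g) = fun x => \sum_(i < n) c i * e i x.

Lemma translation_stable_exists f0 : coefperp f0 -> Top f0 <> (fun=> 0) ->
  exists n, (0 < n)%N /\ exists e : 'I_n -> G -> R[i],
    orthonormal_in coefperp ip e /\ translation_stable e.
Proof.
move=> pf0 Tf0; have [lam lam0 [g [pg g0] Tg]] := Top_eigenvector pf0 Tf0.
have [|n [e [[Ve ee] Vexp]]] := @orthonormal_basis_exists _ _ _ _
    (prehilbert_eigenspace lam) (Num.bound ((nn kap / lam) ^+ 2)).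
  move=> m e /(eigenspace_dim lam0) mle; apply: ltnW.
  rewrite -(ltr_nat R) (le_lt_trans mle)// archi_boundP//.
  exact: sqr_ge0.
exists n; split.
  rewrite lt0n; apply: contra_notN g0 => /eqP n0.
  by rewrite (Vexp g)//; apply/funext => x; rewrite big1// => -[i i0]; exfalso;
    rewrite n0 in i0.
exists e; split; first by split => // i; have [] := Ve i.
move=> a j; exists (fun i => ip (fun x => e j (a * x)%g) (e i)).
by rewrite -Vexp//; exact: eigenspace_left.
Qed.

(** * The representation on a translation-stable subspace of minimal dimension *)

Section MinimalStable.
Variables (n : nat) (e : 'I_n -> G -> R[i]).
Hypothesis n_gt0 : (0 < n)%N.
Hypothesis eON : orthonormal_in coefperp ip e.
Hypothesis eTS : translation_stable e.
Hypothesis n_min : forall m (e' : 'I_m -> G -> R[i]), (0 < m)%N ->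
  orthonormal_in coefperp ip e' -> translation_stable e' -> (n <= m)%N.

Let Se i : coefperp (e i). Proof. by have [] := eON. Qed.
Let ce i : ccont (e i). Proof. exact: coefperp_cont. Qed.
Let eONc : orthonormal_in (@ccont R G) ip e. Proof. by have [_ ee] := eON. Qed.

(** The matrix of left translation on the span of [e]; the inverse makes it a homomorphism instead
    of an antihomomorphism. *)
Definition trans_mx (g : G) (i j : 'I_n) : R[i] :=
  ip (fun x => e j (g^-1 * x)%g) (e i).

Let cel i (g : G) : ccont (fun x => e i (g * x)%g). Proof. exact: ccont_left. Qed.

Lemma trans_mxE (g : G) j :
  (fun x => e j (g^-1 * x)%g) = fun x => \sum_(i < n) trans_mx g i j * e i x.
Proof.
have [c cE] := eTS g^-1%g j.
rewrite [LHS]cE; apply/funext => x; apply: eq_bigr => i _; congr (_ * _).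
by rewrite /trans_mx cE (coord_sum prehilbert_ip eONc).
Qed.

Lemma trans_mx_mul (g h : G) i j :
  trans_mx (g * h)%g i j = \sum_(k < n) trans_mx g i k * trans_mx h k j.
Proof.
rewrite {1}/trans_mx (_ : (fun x => _) =
    fun x => \sum_(k < n) trans_mx h k j * e k (g^-1 * x)%g).
  rewrite (b_suml prehilbert_ip _ _ _ (fun k => cel k _) (ce i)).
  by apply: eq_bigr => k _; rewrite mulrC.
apply/funext => x; rewrite invgM -mulgA.
exact: (congr1 (@^~ (g^-1 * x)%g) (trans_mxE h j)).
Qed.

Lemma trans_mx_one i j : trans_mx 1%g i j = (i == j)%:R.
Proof.
have [_ ee] := eON; rewrite eq_sym -ee /trans_mx; congr ip.
by apply/funext => x; rewrite invg1 mul1g.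
Qed.

Lemma trans_mx_unitary x j k :
  \sum_(i < n) trans_mx x i j * Num.conj (trans_mx x i k) = (j == k)%:R.
Proof.
have [_ <-] := eON; rewrite -(ip_left cG mu_haar x^-1%g)//.
rewrite {1}trans_mxE (b_suml prehilbert_ip _ _ _ ce (cel k _)).
by apply: eq_bigr => i _; rewrite -(ph_conj prehilbert_ip).
Qed.

Lemma trans_mx_inv x i j : trans_mx x^-1%g i j = Num.conj (trans_mx x j i).
Proof.
rewrite /trans_mx -(ph_conj prehilbert_ip)// invgK -[RHS](ip_left cG mu_haar x)//.
by congr ip; apply/funext => y; rewrite mulKg.
Qed.

Lemma trans_mx_cont i j : ccont (fun x => trans_mx x i j).
Proof.
apply: (ccont_sI cG mu (k := fun p => e j (p.1^-1 * p.2)%g * Num.conj (e i p.2))).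
apply: ccont_mul; first by apply: ccont_comp; first exact: continuous_invmul.
by apply: ccont_conj; apply: ccont_comp (ce i) => p; exact: cvg_snd.
Qed.

Definition trans_rep : unitaryRep R G :=
  mx_rep trans_mx_mul trans_mx_one trans_mx_unitary trans_mx_cont.

(** The vectors of an orthonormal basis of an invariant [W], read as coordinates along [e], give a
    translation-stable orthonormal family [e'] of the same size [m]. If [m] is positive, minimality
    gives [n <= m], so the basis of [W] cannot be extended and [W] is the whole space. *)
Lemma trans_rep_irreducible : irreducible_rep trans_rep.
Proof.
split.
  exists ((fun=> 1) : l2_hilbert R n) => /(congr1 (@^~ (Ordinal n_gt0))) /eqP.
  by rewrite oner_eq0.
move=> W _ W0 Wlin Winv.
have PHW : prehilbert W (@dotI R n).
  by apply: (sub_prehilbert (prehilbert_dotI R n)).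
have [|m [w [wON Wexp]]] := @orthonormal_basis_exists _ _ _ _ PHW n.
  move=> m w [_ ww]; by apply: (@ortho_l2_le _ _ _ w); split.
have [Ww ww] := wON.
have [m0|m_gt0] := posnP m.
  left; apply/seteqP; split => [v Wv|_ ->//].
  rewrite /= (Wexp v Wv); apply/funext => i.
  by rewrite big1// => -[k k0]; exfalso; rewrite m0 in k0.
right; pose e' k x := \sum_(i < n) w k i * e i x.
have ce' k : ccont (e' k) by exact: (S_sum prehilbert_ip).
have e'ON : orthonormal_in coefperp ip e'.
  split=> [k|k l]; first exact: (S_sum prehilbert_coefperp).
  rewrite /e' (b_suml prehilbert_ip _ _ _ ce (ce' l)) -ww; apply: eq_bigr => i _.
  by rewrite (ph_conj prehilbert_ip)// (coord_sum prehilbert_ip eONc).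
have e'TS : translation_stable e'.
  move=> a k; have Wv := Winv a^-1%g _ (Ww k).
  exists (fun l => dotI (trans_rep a^-1%g (w k)) (w l)); apply/funext => x.
  transitivity (\sum_(i < n) (trans_rep a^-1%g (w k)) i * e i x).
    rewrite /e'; under eq_bigr => j _.
      have -> : e j (a * x)%g = \sum_(i < n) trans_mx a^-1%g i j * e i x.
        by have := congr1 (@^~ x) (trans_mxE a^-1%g j); rewrite /= invgK.
      rewrite mulr_sumr. over.
    rewrite exchange_big; apply: eq_bigr => i _ /=.
    by rewrite mulr_suml; apply: eq_bigr => j _; rewrite mulrCA mulrA.
  rewrite {1}(Wexp _ Wv); under eq_bigr do rewrite mulr_suml.
  rewrite exchange_big; apply: eq_bigr => l _ /=.
  by rewrite mulr_sumr; apply: eq_bigr => i _; rewrite mulrA.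
have nm := n_min m_gt0 e'ON e'TS.
apply/seteqP; split=> [//|v _].
have wONT : orthonormal_in (fun=> True) (@dotI R n) w by split.
have -> : v = (fun x => \sum_(k < m) dotI v (w k) * w k x) :> ('I_n -> R[i]).
  apply: contrapT => vw.
  have [w' /ortho_l2_le] := orthonormal_extend (prehilbert_dotI R n) wONT I vw.
  by rewrite ltnNge nm.
exact: (S_sum PHW).
Qed.

(** A translate of [e j] evaluated at the identity is a value of [e j]: this writes [e j] as a
    combination of conjugated coefficients of [trans_rep]. Being also orthogonal to them, it would
    have norm 0 and not 1. *)
Lemma minimal_stable_absurd : False.
Proof.
have coef j i : coefspan (fun x => Num.conj (trans_mx x j i)).
  have := @coefspan_irreducible _ _ Gh trans_rep
    (fun k => (k == i)%:R) (fun k => (k == j)%:R) trans_rep_irreducible.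
  congr coefspan; apply/funext => x; congr (Num.conj _).
  rewrite /inner /= /l2_dot /dotI (bigD1 j)//= eqxx rmorph1 mulr1 big1 ?addr0.
    rewrite /mx_op (bigD1 i)//= eqxx mulr1 big1 ?addr0// => k /negbTE ->.
    by rewrite mulr0.
  by move=> k /negbTE ->; rewrite rmorph0 mulr0.
pose j := Ordinal n_gt0; have [_ ee] := eON.
have [_ /(_ (e j))] := Se j; rewrite ee eqxx => h.
suff : (1 : R[i]) = 0 by move/eqP; rewrite oner_eq0.
apply: h; rewrite (_ : e j = fun x => \sum_(i < n) e i 1%g * Num.conj (trans_mx x j i)).
  exact: coefspan_sum.
apply/funext => x.
have := congr1 (@^~ 1%g) (trans_mxE x^-1%g j); rewrite /= invgK mulg1 => ->.
by apply: eq_bigr => i _; rewrite trans_mx_inv mulrC.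
Qed.

End MinimalStable.

Lemma coefperp_Top_eq0 f : coefperp f -> Top f = fun=> 0.
Proof.
move=> pf; apply: contrapT => Tf.
pose P n := (0 < n)%N && `[<exists e : 'I_n -> G -> R[i],
    orthonormal_in coefperp ip e /\ translation_stable e>].
have exP : exists n, P n.
  have [n [n0 he]] := translation_stable_exists pf Tf.
  by exists n; rewrite /P n0; apply/asboolP.
have [n /andP[n0 /asboolP[e [eON eTS]]] nmin] := ex_minnP exP.
apply: (minimal_stable_absurd n0 eON eTS) => m e' m0 e'ON e'TS.
by apply: nmin; rewrite /P m0; apply/asboolP; exists e'.
Qed.

(* The residuals of a minimizing sequence of the distance from [f] to
   [coefspan] are asymptotically orthogonal to [coefspan]; a cluster point of
   their images under [Top] is orthogonal to it, hence killed by [Top], and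
   lies in the closure of the range of [Top], hence vanishes. *)
Lemma Top_approx f (e : R) : ccont f -> 0 < e ->
  exists2 m, coefspan m & forall x, cabs (Top f x - m x) <= e.
Proof.
move=> cf e0.
pose A : set R := [set nn (fun x => f x - m x) | m in coefspan].
have cfm m : coefspan m -> ccont (fun x => f x - m x).
  by move=> cm; apply: ccont_sub => //; exact: coefspan_cont cm.
have A0 : A !=set0 by exists (nn (fun x => f x - 0)), (fun=> 0); [exact: coefspan0|].
have Alb : has_lbound A.
  by exists 0 => _ [m cm <-]; apply: (n2_ge0 prehilbert_ip); exact: cfm.
pose del := inf A.
have /choice[m mP] (n : nat) : exists m, coefspan m /\
    nn (fun x => f x - m x) < del + n.+1%:R^-1.
  have [|_ [m cm <-] h] := @inf_adherent R A n.+1%:R^-1 _ (conj A0 Alb).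
    by rewrite invr_gt0.
  by exists m.
pose psi n x := f x - m n x.
have cm n : coefspan (m n) by have [] := mP n.
have cpsi n : ccont (psi n) by exact: cfm.
have psi_orth n c : coefspan c -> cabs (ip (psi n) c) ^+ 2 <= nn c * n.+1%:R^-1.
  move=> cc; have ccc := coefspan_cont cc; have [c0|cn0] := eqVneq (nn c) 0.
    rewrite (le_trans (cauchy_schwarz prehilbert_ip (cpsi n) ccc))//.
    by rewrite c0 mulr0 mul0r.
  have cp : 0 < nn c by rewrite lt_neqAle eq_sym cn0 (n2_ge0 prehilbert_ip).
  pose w := ip (psi n) c.
  (* Moving by this optimal multiple of [c] lowers the squared distance by [cabs w ^+ 2 / nn c],
     which cannot exceed the gap [n.+1%:R^-1] to the infimum. *)
  pose t : R[i] := - (w / (nn c)%:C).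
  have : del <= nn (fun x => t * c x + psi n x).
    apply: (ge_inf Alb); exists (fun x => - t * c x + m n x).
      exact: coefspan_lin.
    by congr (n2 ip); apply/funext => x; rewrite /psi; ring.
  rewrite (n2_lin prehilbert_ip)//.
  rewrite (ph_conj prehilbert_ip (cpsi n) ccc) -/w.
  have -> : t * Num.conj w = (- (cabs w ^+ 2 / nn c))%:C.
    by rewrite rmorphN rmorphM fmorphV /= cabs2E mulNr mulrAC.
  have -> : cabs t = cabs w / nn c.
    by rewrite /cabs normrN normf_div -!cabsE cabsR gtr0_norm// -fmorphV -rmorphM.
  have [_ /=] := mP n; rewrite -/(psi n) -ler_pdivrMl// [(nn c)^-1 * _]mulrC.
  have -> : (cabs w / nn c) ^+ 2 * nn c = cabs w ^+ 2 / nn c by field.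
  by move: (cabs w ^+ 2 / nn c) (nn (psi n)) (n.+1%:R^-1 : R) (del) => *; lra.
have psiB n : nn (psi n) <= del + 1.
  have [_ /ltW h] := mP n; rewrite (le_trans h)// lerD2l invf_le1//.
  by rewrite ler1n.
have [g cg gcl] := Top_cluster cpsi psiB.
(* A passage to the limit applied twice: to [c] in the span, and then to [c = g], for which [Top c]
   is 0. *)
have small (c : G -> R[i]) : ccont c -> (forall n, cabs (ip (Top (psi n)) c) ^+ 2
    <= nn (Top c) * n.+1%:R^-1) -> ip g c = 0.
  move=> cc hc.
  apply: (cabs_small_eq0 (C := Num.sqrt (nn c) + Num.sqrt (nn (Top c)))) => d d0.
  have d2 : 0 < d ^+ 2 by rewrite exprn_gt0.
  near \oo => N; have [n Nn gn] := gcl d N d0.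
  have cT : ccont (Top (psi n)) by exact: Top_cont.
  have cgT : ccont (fun x => g x - Top (psi n) x) by exact: ccont_sub.
  have -> : ip g c = ip (fun x => g x - Top (psi n) x) c + ip (Top (psi n)) c.
    by rewrite (b_subl prehilbert_ip)// subrK.
  rewrite (le_trans (cabsD _ _))// mulrDl lerD//.
    rewrite cabs_le_sqr; last by rewrite mulr_ge0 ?sqrtr_ge0 ?(ltW d0).
    rewrite (le_trans (cauchy_schwarz prehilbert_ip cgT cc))// exprMn mulrC.
    rewrite sqr_sqrtr; last exact: (n2_ge0 prehilbert_ip).
    rewrite ler_wpM2l ?(n2_ge0 prehilbert_ip)// nn_le_sup// => x.
    by rewrite -cabsN opprB.
  rewrite cabs_le_sqr; last by rewrite mulr_ge0 ?sqrtr_ge0 ?(ltW d0).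
  have cTc := Top_cont cc.
  rewrite (le_trans (hc n))// exprMn sqr_sqrtr; last exact: (n2_ge0 prehilbert_ip).
  rewrite ler_wpM2l ?(n2_ge0 prehilbert_ip)//.
  have : N.+1%:R^-1 < d ^+ 2 by near: N; exact: near_infty_natSinv_lt (PosNum d2).
  by move/ltW; apply: le_trans; rewrite lef_pV2 ?posrE ?ler_nat.
have pg : coefperp g.
  split=> // c cc; apply: small; first exact: coefspan_cont cc.
  move=> n; rewrite Top_sa//; last exact: coefspan_cont cc.
  by apply: psi_orth; exact: coefspan_Top.
have g0 : g = fun=> 0.
  apply: (ph_eq0 prehilbert_ip cg); apply: small => // n.
  rewrite Top_sa// coefperp_Top_eq0// (ph_conj prehilbert_ip (@ccont_cst R G 0) (cpsi n)).
  rewrite (b0l prehilbert_ip)// rmorph0 /cabs normr0 expr0n /=.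
  by rewrite mulr_ge0// (n2_ge0 prehilbert_ip)//; exact: ccont_cst.
have [n _ gn] := gcl e 0%N e0.
exists (Top (m n)); first exact: coefspan_Top.
move=> x; have := gn x; rewrite g0 subr0 /psi Top_sub//.
exact: coefspan_cont (cm n).
Unshelve. all: by end_near. Qed.

End ConvolutionOperator.

(** * Approximate identities and uniform density *)

Section Density.
Context {R : realType} {G : topGroupType}.
Hypothesis cG : compact [set: G].
Hypothesis hG : hausdorff_space G.
Variable mu : probability (borel G) R.
Hypothesis mu_haar : haar_probability mu.
Variable Gh : unitaryDual R G.

Lemma urysohn (K U : set G) : closed K -> open U -> K `<=` U ->
  exists u : G -> R, [/\ continuous u, forall x, 0 <= u x <= 1,
    forall x, K x -> u x = 1 & forall x, ~ U x -> u x = 0].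
Proof.
move=> clK oU KU.
have nG : normal_space G by exact: compact_normal.
have m : uniform_separator (~` U) K.
  apply: ((@normal_separatorP R G).1 nG) => //; first exact: open_closedC.
  by apply/seteqP; split => x // [Ux /KU].
exists (@Urysohn G R (~` U) K); split.
- exact: Urysohn_continuous.
- move=> x; have : range (@Urysohn G R (~` U) K) (@Urysohn G R (~` U) K x) by exists x.
  by move=> /Urysohn_range; rewrite /= in_itv.
- by move=> x Kx; apply: (Urysohn_sub1 m); exists x.
- by move=> x Ux; apply: (Urysohn_sub0 m); exists x.
Qed.

(** The unit scalar [w] rotates the integral onto the positive axis, and averaging [w * f] with its
    conjugate leaves a real integrand below the modulus of [f]. A bound by the supremum would be too
    weak for kernels concentrated near the identity. *)
Lemma sI_norm_le (f g : G -> R[i]) : ccont f -> ccont g ->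
  (forall x, `|f x| <= g x) -> `|sI mu f| <= sI mu g.
Proof.
move=> cf cg fg; have [->|f0] := eqVneq (sI mu f) 0.
  rewrite normr0; apply: (sI_ge0 cG) => // x.
  exact: le_trans (normr_ge0 _) (fg x).
pose w := Num.conj (sI mu f) / `|sI mu f|.
have w1 : `|w| = 1 by rewrite normf_div norm_conjC normr_id divff// normr_eq0.
have wf : w * sI mu f = `|sI mu f|.
  rewrite /w mulrAC [_ * sI mu f]mulrC -normCK expr2 mulfK// normr_eq0//.
have cwf : ccont (fun x => w * f x) by apply: ccont_mul => //; exact: ccont_cst.
have -> : `|sI mu f| = sI mu (fun x => 2^-1 * (w * f x) + 2^-1 * Num.conj (w * f x)).
  rewrite (sI_linear cG)//; last first.
    by apply: ccont_mul; [exact: ccont_cst|exact: ccont_conj].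
  rewrite !(sIZ cG) ?(sI_conj cG) ?(sIZ cG)//; last exact: ccont_conj.
  rewrite wf.
  have /CrealP -> : `|sI mu f| \is Num.real by exact: normr_real.
  by field.
apply: (sI_le cG) => //.
  apply: ccont_lin => //; apply: ccont_mul; [exact: ccont_cst|exact: ccont_conj].
move=> x; apply: le_trans (fg x).
have -> : `|f x| = `|w * f x| by rewrite normrM w1 mul1r.
rewrite -mulrDr mulrC ler_pdivrMr// -[_ + _]/(_ + (w * f x)^*%C) addcJ mulrC.
by rewrite ler_pM2r// (le_trans _ (normc_ge_Re _))// lecR ler_norm.
Qed.

Theorem coefspan_dense (f : G -> R[i]) (e : R) : ccont f -> 0 < e ->
  exists2 m, coefspan Gh m & forall x, cabs (f x - m x) <= e.
Proof.
move=> cf e0; have e2 : 0 < e / 2 by rewrite divr_gt0.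
have cfm : ccont (fun p : G * G => f (p.2 * p.1)%g).
  apply: ccont_comp cf => p.
  apply: (@continuous_comp _ _ _ (fun p : G * G => (p.2, p.1)) (fun p => (p.1 * p.2)%g)).
    by apply: cvg_pair => /=; [exact: cvg_snd|exact: cvg_fst].
  exact: mulg_continuous.
pose U := [set z : G | forall y, cabs (f (y * 1)%g - f (y * z)%g) < e / 2].
have nU : nbhs (1%g : G) U := ccont_tube cG (1%g : G) cfm e2.
have [u [cu u01 u1 u0]] : exists u : G -> R, [/\ continuous u,
    forall x, 0 <= u x <= 1, forall x, [set 1%g] x -> u x = 1 &
    forall x, ~ (U°) x -> u x = 0].
  apply: urysohn.
  - exact: (accessible_closed_set1 (hausdorff_accessible hG)).
  - exact: open_interior.
  - by move=> _ ->.
(* The product with the inverse makes the kernel symmetric. It is 1 at the identity, so its integral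
   is positive, and it vanishes outside of [U]. *)
pose kap0 (z : G) : R[i] := (u z * u z^-1%g)%:C.
have ck0 : ccont kap0.
  apply: ccont_realC => x; apply: cvgM; first exact: cu.
  apply: (@continuous_comp _ _ _ (fun x : G => x^-1%g) u); last exact: cu.
  exact: invg_continuous.
have u_ge0 x : 0 <= u x by have /andP[] := u01 x.
have k0_ge0 z : 0 <= kap0 z by rewrite ler0c mulr_ge0.
have c_ge0 : 0 <= sI mu kap0 by exact: (sI_ge0 cG).
have c_neq0 : sI mu kap0 != 0.
  apply/negP => /eqP /(sI_eq0 cG mu_haar ck0 k0_ge0)/(_ 1%g)/complexI/eqP.
  by rewrite invg1 u1// mulr1 oner_eq0.
set c := sI mu kap0 in c_ge0 c_neq0.
pose kap z := c^-1 * kap0 z.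
have ck : ccont kap by apply: ccont_mul => //; exact: ccont_cst.
have k_ge0 z : 0 <= kap z by rewrite mulr_ge0// invr_ge0.
have k_real z : Num.conj (kap z) = kap z.
  by apply/CrealP; exact: ger0_real.
have k_sym z : kap z^-1%g = kap z.
  by rewrite /kap /kap0 invgK [u z^-1%g * _]mulrC.
have k_one : sI mu kap = 1 by rewrite (sIZ cG)// mulVf.
have kU z : ~ U z -> kap z = 0.
  move=> Uz; rewrite /kap /kap0 u0 ?mul0r ?mulr0//.
  by move=> /interior_subset.
have [m cm mf] := Top_approx cG mu_haar ck k_real k_sym Gh cf e2.
exists m => // x; rewrite (splitr e).
have -> : f x - m x = (f x - Top mu kap f x) + (Top mu kap f x - m x).
  by rewrite addrA subrK.
rewrite (le_trans (cabsD _ _))// lerD//.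
have cfx : ccont (fun z => f (x * z)%g) by exact: ccont_left.
have -> : f x = sI mu (fun z => f x * kap z) by rewrite (sIZ cG)// k_one mulr1.
have ckfx : ccont (fun z => kap z * f (x * z)%g) by exact: ccont_mul.
(* [Top f x] is the average of [f (x * z)] against a weight of mass 1 that vanishes for [z] outside
   of [U], where [U] works for all [x] at once. *)
have -> : Top mu kap f x = sI mu (fun z => kap z * f (x * z)%g).
  rewrite /Top -[LHS](sI_left cG mu_haar x).
    by congr sI; apply/funext => z; rewrite mulKg.
  by apply: ccont_mul => //; exact: ccont_left.
have cfk : ccont (fun z => f x * kap z) by apply: ccont_mul => //; exact: ccont_cst.
rewrite -(sIB cG)//.
rewrite -lecR cabsE.
apply: (le_trans (sI_norm_le (g := fun z => (e / 2)%:C * kap z) _ _ _)).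
- exact: ccont_sub.
- by apply: ccont_mul => //; exact: ccont_cst.
- move=> z; rewrite [f x * _]mulrC -mulrBr normrM ger0_norm// mulrC.
  have [Uz|/kU ->] := pselect (U z); last by rewrite !mulr0.
  rewrite ler_wpM2r// -cabsE lecR; apply: ltW.
  by have := Uz x; rewrite mulg1.
by rewrite (sIZ cG)// k_one mulr1.
Qed.

End Density.

(** * Schur orthogonality *)

Section Schur.
Context {R : realType} {G : topGroupType}.
Variable Gh : unitaryDual R G.
Local Notation d := (@dual_dim R G Gh).
Local Notation xiP sigma := (@dual_basisP R G Gh sigma).

Definition dualM (sigma : Gh) (x : G) : 'M[R[i]]_(d sigma) :=
  \matrix_(i, j) dual_mx x i j.

Definition adjm m n (A : 'M[R[i]]_(m, n)) : 'M[R[i]]_(n, m) := map_mx Num.conj A^T.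

Lemma adjmM m n p (A : 'M[R[i]]_(m, n)) (B : 'M[R[i]]_(n, p)) :
  adjm (A *m B) = adjm B *m adjm A.
Proof. by rewrite /adjm trmx_mul map_mxM. Qed.

Lemma dualM_inv sigma x : dualM sigma x^-1%g = adjm (dualM sigma x).
Proof. by apply/matrixP => i j; rewrite !mxE /dual_mx rep_mx_inv. Qed.

Lemma dual_dim_gt0 sigma : (0 < d sigma)%N.
Proof.
have [[v v0] _] := dual_irreducible sigma.
rewrite lt0n; apply: contra_notN v0 => /eqP d0.
by rewrite (basis_expand (xiP sigma) v) big1// => -[k k0]; exfalso; rewrite d0 in k0.
Qed.

Definition coordv sigma (u : rep_space (dual_rep sigma)) : 'cV[R[i]]_(d sigma) :=
  \col_i inner _ u (dual_basis sigma i).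

Lemma coordv_lin sigma (a : R[i]) (u v : rep_space (dual_rep sigma)) :
  coordv (a *: u + v) = a *: coordv u + coordv v.
Proof. by apply/colP => i; rewrite !mxE linearDl linearZl_LR. Qed.

Lemma coordv_rep sigma x (u : rep_space (dual_rep sigma)) :
  coordv (dual_rep sigma x u) = dualM sigma x *m coordv u.
Proof.
apply/colP => i; rewrite !mxE {1}(basis_expand (xiP sigma) u) rep_sum linear_sumlz.
by apply: eq_bigr => j _; rewrite linearZl_LR !mxE mulrC.
Qed.

Definition vecof sigma (v : 'cV[R[i]]_(d sigma)) : rep_space (dual_rep sigma) :=
  \sum_i v i 0 *: dual_basis sigma i.

Lemma vecofK sigma : cancel (@vecof sigma) (@coordv sigma).
Proof.
have [xiON _] := xiP sigma.
move=> v; apply/colP => i; rewrite mxE /vecof linear_sumlz (bigD1 i)//=.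
rewrite linearZl_LR /= xiON eqxx mulr1 big1 ?addr0// => j /negbTE ji.
by rewrite linearZl_LR /= xiON ji mulr0.
Qed.

Lemma coordvK sigma : cancel (@coordv sigma) (@vecof sigma).
Proof.
move=> u; rewrite [RHS](basis_expand (xiP sigma)); apply: eq_bigr => i _.
by rewrite mxE.
Qed.

Lemma inner_coordv sigma (u v : rep_space (dual_rep sigma)) :
  inner _ u v = (adjm (coordv v) *m coordv u) 0 0.
Proof.
rewrite (inner_coord (xiP sigma)) mxE; apply: eq_bigr => i _.
by rewrite !mxE mulrC.
Qed.

(** The intertwining hypothesis makes the kernel of [A] invariant. Coordinates are bounded by the
    norm, so it is also closed, as [irreducible_rep] requires. *)
Lemma irreducible_kernel sigma m (A : 'M[R[i]]_(m, d sigma)) :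
  (forall x, exists M, A *m dualM sigma x = M *m A) ->
  A = 0 \/ forall v : 'cV_(d sigma), A *m v = 0 -> v = 0.
Proof.
move=> AM; have [_ irr] := dual_irreducible sigma.
pose W : set (rep_space (dual_rep sigma)) := [set u | A *m coordv u = 0].
have [||||W0|WT] := irr W.
- apply/closure_id; apply/seteqP; split; first exact: subset_closure.
  move=> u clu; apply/colP => r; rewrite [RHS]mxE.
  apply: (cabs_small_eq0 (C := \sum_i cabs (A r i))) => e e0.
  have eC0 : 0 < e%:C :> R[i] by rewrite ltcR.
  have [v [Wv]] := clu _ (nbhsx_ballx u _ eC0).
  rewrite -ball_normE /= -rnormE ltcR => uv.
  have -> : (A *m coordv u) r 0 = (A *m coordv (u - v)) r 0.
    rewrite (_ : u - v = (-1) *: v + u); last by rewrite scaleN1r addrC.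
    by rewrite coordv_lin mulmxDr -scalemxAr Wv scaler0 add0r.
  rewrite mxE mulr_suml.
  elim/big_ind2 : _ => [|z s z' s' zs zs'|i _]; first by rewrite /cabs normr0.
    by rewrite (le_trans (cabsD _ _))// lerD.
  rewrite cabsM ler_wpM2l ?cabs_ge0// mxE.
  by rewrite (le_trans (inner_coord_le (xiP sigma) _ _))// ltW.
- rewrite /W /= (_ : coordv 0 = 0) ?mulmx0//.
  by apply/colP => i; rewrite !mxE linear0l.
- move=> a u v Wu Wv; rewrite /W /= coordv_lin mulmxDr -scalemxAr Wu Wv.
  by rewrite scaler0 addr0.
- move=> x u Wu; have [M AMx] := AM x.
  by rewrite /W /= coordv_rep mulmxA AMx -mulmxA Wu mulmx0.
- right=> v Av; rewrite -(vecofK v).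
  have : W (vecof v) by rewrite /W /= vecofK.
  rewrite W0 /= => ->; apply/colP => i; rewrite !mxE linear0l//.
left; apply/matrixP => i j; rewrite mxE.
have : W (vecof (delta_mx j 0)) by rewrite WT.
rewrite /W /= vecofK => /matrixP/(_ i 0); rewrite mxE [RHS]mxE => <-.
rewrite (bigD1 j)//= mxE !eqxx mulr1 big1 ?addr0// => k /negbTE kj.
by rewrite mxE kj mulr0.
Qed.

Lemma commutant_scalar sigma (A : 'M[R[i]]_(d sigma)) :
  (forall x, A *m dualM sigma x = dualM sigma x *m A) -> exists a, A = a%:M.
Proof.
move=> AD.
(* Eigenvectors are row vectors, so the transpose is used to obtain a column vector in the kernel of
   [A - a%:M]. *)
have [a ra] : exists a, root (char_poly A^T) a.
  by apply/closed_rootP; rewrite size_char_poly eqSS -lt0n dual_dim_gt0.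
rewrite -eigenvalue_root_char in ra; have /eigenvalueP[v va v0] := ra.
exists a; apply/eqP; rewrite -subr_eq0; apply/eqP.
have [|//|inj] := @irreducible_kernel sigma _ (A - a%:M).
  move=> x; exists (dualM sigma x).
  by rewrite mulmxBl mulmxBr AD mul_scalar_mx mul_mx_scalar.
exfalso; move/eqP: v0; apply.
rewrite -[v]trmxK; rewrite (inj v^T) ?trmx0//.
by rewrite mulmxBl -[A]trmxK -trmx_mul va linearZ /= mul_scalar_mx subrr.
Qed.

Lemma adjm_mul_eq0 m n (B : 'M[R[i]]_(m, n)) (a : R[i]) :
  adjm B *m B = a%:M -> B != 0 -> 0 < a.
Proof.
move=> Ba B0.
have col_ge0 j : 0 <= \sum_i B i j * Num.conj (B i j).
  by apply: sumr_ge0 => i _; exact: mul_conjC_ge0.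
have col j : \sum_i B i j * Num.conj (B i j) = a.
  have /matrixP/(_ j j) := Ba; rewrite !mxE eqxx mulr1n => <-.
  by apply: eq_bigr => i _; rewrite !mxE mulrC.
have /existsP[i /existsP[j Bij]] : [exists i, exists j, B i j != 0].
  apply: contraNT B0 => /existsPn h; apply/eqP/matrixP => i j; rewrite mxE.
  by have /existsPn/(_ j) := h i; rewrite negbK => /eqP.
rewrite -(col j) (bigD1 i)//= ltr_wpDr//; last by rewrite mul_conjC_gt0.
by apply: sumr_ge0 => k _; exact: mul_conjC_ge0.
Qed.

Lemma scale3K n (w : 'cV[R[i]]_n) (c e a : R[i]) : e * c * a = 1 ->
  c *: (e *: (a *: w)) = w.
Proof. by move=> H; rewrite 2!scalerA [c * e]mulrC H scale1r. Qed.

(** Both products of [B] and its adjoint commute with the representations, so they are scalars;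
    these are equal and positive since [B] is nonzero. Dividing [B] by the square root of the scalar
    gives a unitary equivalence, and distinct elements of [Gh] are inequivalent. *)
Lemma intertwiner_eq sigma tau (B : 'M[R[i]]_(d sigma, d tau)) :
  (forall x, B *m dualM tau x = dualM sigma x *m B) -> B != 0 -> tau = sigma.
Proof.
move=> BD B0.
have BD' x : dualM tau x *m adjm B = adjm B *m dualM sigma x.
  have E rho : dualM rho x = adjm (dualM rho x^-1%g) by rewrite -dualM_inv invgK.
  by rewrite !E -!adjmM BD.
have [a Ba] : exists a, adjm B *m B = a%:M.
  by apply: commutant_scalar => x; rewrite -mulmxA BD !mulmxA -BD'.
have [b Bb] : exists b, B *m adjm B = b%:M.
  by apply: commutant_scalar => x; rewrite -mulmxA -BD' !mulmxA BD.
have a0 : 0 < a by exact: adjm_mul_eq0 Ba B0.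
have ab : b = a.
  apply/eqP; rewrite -subr_eq0; apply: contraNT B0 => ab0.
  have : (b - a) *: B = 0.
    by rewrite scalerBl -[b *: B]mul_scalar_mx -[a *: B]mul_mx_scalar -Bb -Ba mulmxA subrr.
  by move/eqP; rewrite scaler_eq0 (negbTE ab0).
have [ar aE] := gt0_complexR a0.
pose c : R[i] := ((Num.sqrt (complex.Re a))^-1)%:C.
have cc : Num.conj c * c * a = 1.
  rewrite [X in _ * X = _]aE /c conj_real -!rmorphM /= -expr2 exprVn sqr_sqrtr ?ltW//.
  by rewrite mulVf ?gt_eqF.
pose F (u : rep_space (dual_rep tau)) := vecof (c *: (B *m coordv u)).
have coordF u : coordv (F u) = c *: (B *m coordv u) by rewrite vecofK.
apply: dual_inj; exists F; split; last first.
  move=> x v; apply: (can_inj (@coordvK sigma)).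
  by rewrite coordF !coordv_rep coordF -scalemxAr !mulmxA BD.
split=> [r u v|u v|w].
- apply: (can_inj (@coordvK sigma)); rewrite coordF !coordv_lin !coordF.
  by rewrite mulmxDr scalerDr -scalemxAr !scalerA mulrC.
- rewrite !inner_coordv !coordF.
  have -> : adjm (c *: (B *m coordv v)) = Num.conj c *: (adjm (coordv v) *m adjm B).
    by rewrite -adjmM; apply/matrixP => i j; rewrite !mxE rmorphM.
  rewrite -scalemxAl -scalemxAr scalerA mulmxA -(mulmxA _ _ B) Ba.
  by rewrite mul_mx_scalar -scalemxAl scalerA cc scale1r.
exists (vecof (Num.conj c *: (adjm B *m coordv w))).
apply: (can_inj (@coordvK sigma)); rewrite coordF vecofK -scalemxAr mulmxA Bb ab.
by rewrite mul_scalar_mx; clearbody c; exact: (scale3K (coordv w) cc).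
Qed.

Hypothesis cG : compact [set: G].
Variable mu : probability (borel G) R.
Hypothesis mu_haar : haar_probability mu.

Lemma dual_mx_cont (sigma : Gh) i j : ccont (fun x => dual_mx (sigma := sigma) x i j).
Proof. exact: (rep_mx_cont (xiP sigma)). Qed.

(** The average over [x] of [dualM sigma x *m delta_mx j l *m adjm (dualM tau x)], the usual way to
    produce an intertwiner. *)
Definition mean_mx sigma tau (j : 'I_(d sigma)) (l : 'I_(d tau)) :
    'M[R[i]]_(d sigma, d tau) :=
  \matrix_(i, k) ip mu (fun x => dual_mx x i j) (fun x => dual_mx x k l).

Lemma mean_mx_intertwines sigma tau j l x :
  @mean_mx sigma tau j l *m dualM tau x = dualM sigma x *m mean_mx j l.
Proof.
apply/matrixP => i k; rewrite !mxE.
have cs (rho : Gh) a b : ccont (fun y => dual_mx (sigma := rho) y a b).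
  exact: dual_mx_cont.
have PH := prehilbert_ip cG mu_haar.
transitivity (ip mu (fun y => dual_mx y i j)
    (fun y => dual_mx (sigma := tau) (x^-1 * y)%g k l)).
  have -> : (fun y => dual_mx (sigma := tau) (x^-1 * y)%g k l) = fun y =>
      \sum_b Num.conj (dual_mx x b k) * dual_mx y b l.
    apply/funext => y; rewrite /dual_mx (rep_mx_mul (xiP tau)).
    by apply: eq_bigr => b _; rewrite rep_mx_inv.
  rewrite (ph_conj PH _ (cs _ _ _)); last first.
    by apply: ccont_sum => b; apply: ccont_mul => //; exact: ccont_cst.
  rewrite (b_suml PH)// rmorph_sum; apply: eq_bigr => b _.
  by rewrite !mxE rmorphM /= conjCK mulrC -(ph_conj PH).
have cx : ccont (fun y => dual_mx (sigma := tau) (x^-1 * y)%g k l).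
  exact: (ccont_left x^-1%g (cs tau k l)).
rewrite -[LHS](ip_left cG mu_haar x)//.
have -> : (fun y => dual_mx (sigma := tau) (x^-1 * (x * y))%g k l) =
    fun y => dual_mx y k l by apply/funext => y; rewrite mulKg.
have -> : (fun y => dual_mx (sigma := sigma) (x * y)%g i j) = fun y =>
    \sum_a dual_mx x i a * dual_mx y a j.
  by apply/funext => y; rewrite /dual_mx (rep_mx_mul (xiP sigma)).
by rewrite (b_suml PH)//; apply: eq_bigr => a _; rewrite !mxE.
Qed.

Lemma schur_neq (sigma tau : Gh) i j k l : sigma <> tau ->
  ip mu (fun x => dual_mx (sigma := sigma) x i j)
        (fun x => dual_mx (sigma := tau) x k l) = 0.
Proof.
move=> st; have [B0|B0] := eqVneq (@mean_mx sigma tau j l) 0.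
  by have /matrixP/(_ i k) := B0; rewrite !mxE.
by case: st; apply/esym; apply: intertwiner_eq B0; exact: mean_mx_intertwines.
Qed.

(** The mean matrix is a scalar [b]; its trace is [b] times the dimension, and equals [(j == l)%:R]
    by unitarity. *)
Lemma schur_eq (sigma : Gh) i j k l :
  ip mu (fun x => dual_mx (sigma := sigma) x i j)
        (fun x => dual_mx (sigma := sigma) x k l) =
  ((i == k) && (j == l))%:R / (d sigma)%:R.
Proof.
have [|b bE] := @commutant_scalar sigma (@mean_mx sigma sigma j l).
  exact: mean_mx_intertwines.
have d0 : (d sigma)%:R != 0 :> R[i] by rewrite pnatr_eq0 -lt0n dual_dim_gt0.
have := congr1 mxtrace bE; rewrite mxtrace_scalar /mxtrace.
under eq_bigr do rewrite mxE.
rewrite /ip -(sI_sum cG mu _ predT) => [|a]; last first.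
  by apply: ccont_ip; exact: dual_mx_cont.
under eq_fun do rewrite (rep_mx_unitary (xiP sigma)).
rewrite sI_cst => jl.
have /matrixP/(_ i k) := bE; rewrite !mxE /ip => ->.
have -> : b = (j == l)%:R / (d sigma)%:R by rewrite jl -[b *+ _]mulr_natr mulfK.
by case: (i == k) => /=; rewrite ?mulr1n ?mulr0n ?mul0r.
Qed.

End Schur.

(** * Uniqueness of Fourier coefficients *)

Section VanishingIntegrals.
Context {R : realType} {d : measure_display} {T : measurableType d}.
Variable mu : probability T R.
Context {E : completeNormedModType R[i]}.
Implicit Types (f g : T -> E) (A : set T).

Definition restr A f : T -> E := fun x => if `[<A x>] then f x else 0.

Lemma limsimple_restr A f : measurable A -> limsimple f -> limsimple (restr A f).
Proof.
move=> mA [h [sh hf]]; exists (fun n => restr A (h n)); split=> [n|x].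
  exact: fsimple_restrict.
by rewrite /restr; case: asboolP => // _; exact: cvg_cst.
Qed.

Lemma limsimple_L1 f : limsimple f -> (inorm mu f < +oo)%E -> L1_fun mu f.
Proof. by move=> lf If; split => //; apply/strongly_measurableP; exists f => //; exact: aeW. Qed.

Lemma L1_restr A f : measurable A -> limsimple f -> (inorm mu f < +oo)%E ->
  L1_fun mu (restr A f).
Proof.
move=> mA lf If; apply: limsimple_L1; first exact: limsimple_restr.
apply: le_lt_trans If; apply: le_inorm => // [|x]; first exact: limsimple_restr.
by rewrite /restr; case: asboolP => // _; rewrite rnorm0 rnorm_ge0.
Qed.

(* If [f] integrates to [0] on every set then, for a simple [h],
   [sum_v m(h = v) |v| = sum_v |int_(h = v) (h - f)| <= int |h - f|]. *)
Lemma inorm_simple_le f (h : T -> E) : limsimple f -> (inorm mu f < +oo)%E ->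
  (forall A, measurable A -> bochner_integral mu (restr A f) = 0) ->
  fsimple h -> (inorm mu h <= inorm mu (fun x => (f x - h x)%R))%E.
Proof.
move=> lf If f0 sh; have [fh mh] := sh.
rewrite /inorm (integral_fsimple mu (g := fun v => rnorm v) sh) => [|v]; last exact: rnorm_ge0.
have lfh : limsimple (fun x => f x - h x).
  by apply: limsimpleB => //; exact: fsimple_limsimple.
have -> : (\int[mu]_x (rnorm (f x - h x)%R)%:E = \int[mu]_x
    \sum_(v <- fset_set (range h))
      (rnorm (restr (h @^-1` [set v]) (fun x => (f x - h x)%R) x))%:E)%E.
  apply: eq_integral => x _; rewrite sumEFin; congr EFin.
  rewrite (bigD1_seq (h x) _ (fset_uniq _))//=; last first.
    by rewrite in_fset_set// mem_set//; exists x.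
  rewrite {1}/restr asboolT//= big1 ?addr0// => v /eqP vx.
  by rewrite /restr asboolF ?rnorm0// => /esym.
rewrite ge0_integral_sum//; last 2 first.
- by move=> v; apply: measurable_ernorm; exact: limsimple_restr.
- by move=> v x _; rewrite lee_fin rnorm_ge0.
rewrite -sumEFin; apply: lee_sum => v _.
have mhv := mh v.
have bf : is_bochner_integral mu (restr (h @^-1` [set v]) f) 0.
  by rewrite -(f0 _ mhv); apply: L1_is_bochner_integral; exact: L1_restr.
have srh : fsimple (restr (h @^-1` [set v]) h) by exact: fsimple_restrict.
have bh := is_bochner_integral_simple mu srh.
have := is_bochner_integral_bound (is_bochner_integral_linear (-1) bh bf).
have -> : simple_integral mu (restr (h @^-1` [set v]) h) =
    (fine (mu (h @^-1` [set v])))%:C *: v.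
  have -> : restr (h @^-1` [set v]) h =
      (fun b : bool => if b then v else 0) \o (fun x => `[<(h @^-1` [set v]) x>]).
    by apply/funext => x; rewrite /restr /=; case: asboolP.
  have sb := fsimple_bool mhv.
  rewrite simple_integral_comp//.
  have hb b : [set x | `[<h x = v>] == b] = (fun x => `[<h x = v>]) @^-1` [set b].
    by apply/seteqP; split => x /= /eqP.
  transitivity (\sum_(b <- fset_set (range (fun x => `[<(h @^-1` [set v]) x>])) | b)
      (fine (mu ((fun x => `[<(h @^-1` [set v]) x>]) @^-1` [set b])))%:C *: v).
    rewrite [RHS]big_mkcond; apply: eq_bigr => -[] _ //.
    by rewrite scaler0.
  rewrite -scaler_suml -rmorph_sum -(fine_muD_sum mu id sb)/=.
  congr ((fine (mu _))%:C *: _); apply/seteqP; split => x /= => [/asboolP//|hx].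
  exact/asboolP.
rewrite addr0 scaleN1r rnormN rnormZ cabsR ger0_norm ?fine_ge0// => /le_trans; apply.
rewrite /inorm le_eqVlt; apply/orP; left; apply/eqP; apply: eq_integral => x _.
rewrite /restr; case: asboolP => _; last by rewrite scaler0 addr0.
by rewrite scaleN1r addrC.
Qed.

(** The norm of [f] is at most that of [h n] plus that of [f - h n], and the former is bounded by
    the latter; so it is at most twice a quantity that tends to 0. *)
Lemma inorm_eq0_of_restr f : limsimple f -> (inorm mu f < +oo)%E ->
  (forall A, measurable A -> bochner_integral mu (restr A f) = 0) ->
  {ae mu, forall x, f x = 0}.
Proof.
move=> lf If f0.
have /is_bochner_integralP := L1_is_bochner_integral (limsimple_L1 lf If).
case=> f' [h [ff' [sh hf /ge0_cvge0P ih _]]].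
have if0 : inorm mu f = 0%E.
  apply/eqP; rewrite eq_le inorm_ge0 andbT; apply/lee_addgt0Pr => e e0; rewrite add0e.
  have e2 : 0 < e / 2 by rewrite divr_gt0.
  near \oo => n.
  have lfh : limsimple (fun x => f x - h n x).
    by apply: limsimpleB => //; exact: fsimple_limsimple.
  have fhE : inorm mu (fun x => f x - h n x) = inorm mu (fun x => f' x - h n x).
    by apply: ae_eq_inorm; apply: filterS ff' => x ->.
  apply: (le_trans (@le_inormD _ _ _ mu _ f (h n) (fun x => f x - h n x) _ _ _)) => //.
  - exact: fsimple_limsimple.
  - by move=> x; rewrite -{1}(subrK (h n x) (f x)) addrC (le_trans (rnormD _ _)).
  have := inorm_simple_le lf If f0 (sh n); rewrite fhE => hle.
  have hn : (inorm mu (fun x => (f' x - h n x)%R) <= (e / 2)%:E)%E.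
    by near: n; apply: ih => // n; exact: inorm_ge0.
  by rewrite (splitr e) EFinD leeD// (le_trans hle).
have : (\int[mu]_x `|(rnorm (f x))%:E| = 0)%E.
  by rewrite -[RHS]if0; apply: eq_integral => x _; rewrite gee0_abs// lee_fin rnorm_ge0.
move/(ae_eq_integral_abs mu measurableT (measurable_ernorm lf)).
by apply: filterS => x /(_ Logic.I) /= [] /rnorm_eq0.
Unshelve. all: by end_near. Qed.

End VanishingIntegrals.

Section SimpleApproximation.
Context {R : realType} {d : measure_display} {T : measurableType d}.
Variable mu : probability T R.
Context {E : completeNormedModType R[i]}.
Implicit Types (f g : T -> E) (A : set T).

Lemma L1_simple_approx f (e : R) : L1_fun mu f -> 0 < e ->
  exists2 h, fsimple h & (inorm mu (fun x => (f x - h x)%R) <= e%:E)%E.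
Proof.
move=> /L1_is_bochner_integral/is_bochner_integralP[f' [h [ff' [sh hf ih _]]]] e0.
have [N _ /(_ N (leqnn _)) hN] : \forall n \near \oo,
    (inorm mu (fun x => (f' x - h n x)%R) <= e%:E)%E.
  by move/ge0_cvge0P: ih; apply => // n; exact: inorm_ge0.
exists (h N); first exact: sh.
apply: le_trans hN; rewrite le_eqVlt; apply/orP; left; apply/eqP.
by apply: ae_eq_inorm; apply: filterS ff' => x ->.
Qed.

Lemma inorm_restr_le A f (M : R) : measurable A -> (forall x, rnorm (f x) <= M) ->
  (inorm mu (restr A f) <= M%:E * mu A)%E.
Proof.
move=> mA fM; have M0 : 0 <= M by rewrite (le_trans _ (fM point))// rnorm_ge0.
rewrite -integral_cst// integral_mkcond; apply: ae_le_lower_integral => [x|x|].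
- by rewrite lee_fin rnorm_ge0.
- by rewrite patchE; case: ifPn => // _; rewrite lee_fin.
- apply: aeW => x; rewrite patchE /restr; case: asboolP => Ax.
    by rewrite mem_set// lee_fin.
  by rewrite memNset// rnorm0.
Qed.

Lemma limsimple_scale (p : T -> R[i]) f : limsimple (p : T -> cpx R) ->
  limsimple f -> limsimple (fun x => p x *: f x).
Proof.
move=> [h [sh hp]] [k [sk kf]]; exists (fun n x => (h n x : R[i]) *: k n x).
split=> [n|x].
  exact: (fsimple_comp (fun q : cpx R * E => (q.1 : R[i]) *: q.2)
    (fsimple_pair (sh n) (sk n))).
exact: (@cvgZ R[i] E _ _ _ (fun n => h n x : R[i]) (fun n => k n x) (p x) (f x)
  (hp x) (kf x)).
Qed.

End SimpleApproximation.

Section FourierUniqueness.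
Context {R : realType} {G : topGroupType} {E : completeNormedModType R[i]}.
Hypothesis cG : compact [set: G].
Hypothesis hG : hausdorff_space G.
Variable mu : probability (borel G) R.
Hypothesis mu_haar : haar_probability mu.
Variable Gh : unitaryDual R G.
Implicit Types (p q : G -> R[i]) (f : borel G -> E).

Definition pairing p f : E := bochner_integral mu (fun x : borel G => p x *: f x).

Lemma L1_scale p f : ccont p -> L1_fun mu f -> L1_fun mu (fun x : borel G => p x *: f x).
Proof.
move=> cp [/strongly_measurableP[f' lf' ff'] If].
have lp : limsimple (p : borel G -> cpx R).
  by apply: (@cont_limsimple R G (cpx R)) => //; exact: ccont_continuous cp.
have pff' : {ae mu, forall x : borel G, p x *: f x = p x *: f' x}.
  by apply: filterS ff' => x ->.
have lpf := limsimple_scale lp lf'.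
split; first by apply/strongly_measurableP; exists (fun x => p x *: f' x).
rewrite (ae_eq_inorm pff').
have [M M0 pM] := ccont_bounded cG cp.
apply: (@le_lt_trans _ _ (M%:E * inorm mu f' + 0%:E * inorm mu f')%E).
  apply: le_inorm_lin => //; first exact: ltW.
  by move=> x; rewrite rnormZ mul0r addr0 ler_wpM2r// rnorm_ge0.
rewrite mul0e adde0 lte_mul_pinfty//; first by rewrite lee_fin ltW.
by rewrite -(ae_eq_inorm ff').
Qed.

Lemma is_pairing p f : ccont p -> L1_fun mu f ->
  is_bochner_integral mu (fun x : borel G => p x *: f x) (pairing p f).
Proof. by move=> cp /(L1_scale cp)/L1_is_bochner_integral. Qed.

Lemma pairing_linear a p q f : ccont p -> ccont q -> L1_fun mu f ->
  pairing (fun x => a * p x + q x) f = a *: pairing p f + pairing q f.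
Proof.
move=> cp cq If; apply: bochner_integralE.
have := is_bochner_integral_linear a (is_pairing cp If) (is_pairing cq If).
congr (is_bochner_integral _ _ _); apply/funext => x.
by rewrite scalerDl scalerA.
Qed.

Lemma pairing_bound p f (M : R) : ccont p -> L1_fun mu f ->
  (forall x, cabs (p x) <= M) -> rnorm (pairing p f) <= M * fine (inorm mu f).
Proof.
move=> cp If pM.
have M0 : 0 <= M by rewrite (le_trans _ (pM point))// cabs_ge0.
have [/strongly_measurableP[f' lf' ff'] If'] := If.
have fin : inorm mu f \is a fin_num by rewrite ge0_fin_numE// inorm_ge0.
rewrite -lee_fin (le_trans (is_bochner_integral_bound (is_pairing cp If)))//.
rewrite EFinM fineK// (ae_eq_inorm ff').
rewrite -[leRHS]adde0 -(mul0e (inorm mu f')).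
have -> : inorm mu (fun x : borel G => p x *: f x) = inorm mu (fun x : borel G => p x *: f' x).
  by apply: ae_eq_inorm; apply: filterS ff' => x ->.
apply: le_inorm_lin => // x.
by rewrite rnormZ mul0r addr0 ler_wpM2r// rnorm_ge0.
Qed.

Lemma pairing_eq0_of_coef f : L1_fun mu f ->
  (forall (sigma : Gh) i j, pairing (fun x => Num.conj (dual_mx (sigma := sigma) x i j)) f = 0) ->
  forall p, ccont p -> pairing p f = 0.
Proof.
move=> If f0.
have span0 m : coefspan Gh m -> ccont m /\ pairing m f = 0.
  move/(_ (fun m => ccont m /\ pairing m f = 0)); apply.
  - split; first exact: ccont_cst.
    apply: rnorm_eq0; apply/eqP; rewrite eq_le rnorm_ge0 andbT.
    rewrite -[leRHS](mul0r (fine (inorm mu f))) pairing_bound//; first exact: ccont_cst.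
    by move=> x; rewrite /cabs normr0.
  - move=> a p q [cp p0] [cq q0]; split; first exact: ccont_lin.
    by rewrite pairing_linear// p0 q0 scaler0 addr0.
  - by move=> sigma i j; split=> //; apply: ccont_conj; exact: dual_mx_cont.
move=> p cp; apply: rnorm_small_eq0 => e e0.
have I0 : 0 < fine (inorm mu f) + 1 by rewrite ltr_wpDl// fine_ge0// inorm_ge0.
have [m /span0[cm m0] pm] := coefspan_dense cG hG mu_haar Gh cp (divr_gt0 e0 I0).
have -> : pairing p f = pairing (fun x => (-1) * m x + p x) f.
  by rewrite pairing_linear// m0 scaler0 add0r.
rewrite (le_trans (pairing_bound _ If (M := e / (fine (inorm mu f) + 1)) _))//.
- exact: ccont_lin.
- by move=> x; rewrite mulN1r addrC.
- by rewrite mulrAC ler_pdivrMr// ler_pM2l// lerDl.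
Qed.

(* By regularity and Urysohn's lemma there is a continuous [u] that agrees with
   the indicator of [A] outside of a set of small measure. *)
Lemma haar_urysohn (A : set (borel G)) (e : R) : measurable A -> 0 < e ->
  exists (u : G -> R) (Z : set (borel G)), [/\ continuous u,
    forall x, 0 <= u x <= 1, measurable Z, (mu Z <= e%:E)%E &
    forall x, ~ Z x -> u x = (`[<A x>])%:R].
Proof.
move=> mA e0; have e2 : 0 < e / 2 by rewrite divr_gt0.
have [_ outer inner_] := mu_haar.
have muf (B : set (borel G)) : measurable B -> mu B \is a fin_num.
  by move=> mB; exact: fin_num_measure.
have mG (U : set G) : open U -> measurable (U : set (borel G)).
  by exact: open_borel.
have [_ [U [oU AU] <-] UA] : exists2 x, [set mu U | U in [set U : set G | open U /\ A `<=` U]] x & (x < mu A + (e / 2)%:E)%E.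
  by rewrite (outer A mA); apply: lb_ereal_inf_adherent => //; rewrite -(outer A mA) muf.
have mU := mG _ oU.
have [_ [K [cK KU] <-] UK] : exists2 x, [set mu K | K in [set K : set G | compact K /\ K `<=` U]] x & (mu U - (e / 2)%:E < x)%E.
  by rewrite (inner_ U oU); apply: ub_ereal_sup_adherent => //; rewrite -(inner_ U oU) muf.
have clK : closed K by exact: compact_closed.
have mK : measurable (K : set (borel G)).
  by rewrite -[X in measurable X](setCK K); apply: measurableC; apply: mG; exact: closed_openC.
have [u [cu u01 uK uU]] := @urysohn R G cG hG K U clK oU KU.
(* Inner regularity is given on open sets, so [K] is chosen inside [U] and may fail to lie in [A];
   [Z] collects both gaps, of measure at most [e / 2] each. *)
exists u, ((U `\` K) `|` (U `\` A)); split => //.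
- by apply: measurableU; exact: measurableD.
- have D (B : set (borel G)) : measurable B -> B `<=` U ->
      (mu U <= mu B + (e / 2)%:E)%E -> (mu (U `\` B) <= (e / 2)%:E)%E.
    move=> mB BU UB; rewrite measureD//; last by rewrite ltey_eq muf.
    by rewrite (setIidr BU) leeBlDl// muf.
  rewrite (le_trans (measureU2 _ _ _))//; try exact: measurableD.
  rewrite (splitr e) EFinD leeD//; apply: D => //; last exact: ltW.
  by move: UK; rewrite lteBlDr// => /ltW.
- move=> x Zx; case: asboolP => Ax.
    rewrite uK//; apply: contrapT => Kx; apply: Zx; left; split => //; exact: AU.
  by rewrite uU// => Ux; apply: Zx; right.
Qed.

(** Since [u] times [f] integrates to 0, the integral over [A] is that of [f] times the difference
    of the indicator and [u], which lives on [Z]. There [f] is split into [f - h], small in norm,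
    and a simple [h] bounded by [M]; the measure of [Z] is chosen after [M]. *)
Lemma restr_integral_eq0 f : limsimple f -> (inorm mu f < +oo)%E ->
  (forall p, ccont p -> pairing p f = 0) ->
  forall A, measurable A -> bochner_integral mu (restr A f) = 0.
Proof.
move=> lf Inf f0 A mA; apply: rnorm_small_eq0 => e e0.
have e2 : 0 < e / 2 by rewrite divr_gt0.
have If := limsimple_L1 lf Inf.
have [h sh fh] := L1_simple_approx If e2.
have [M M0 hM] := fsimple_bounded sh.
have [u [Z [cu u01 mZ Ze uZ]]] := haar_urysohn mA (divr_gt0 e2 M0).
have cuC : ccont (fun x => (u x)%:C) by exact: ccont_realC.
have IA : is_bochner_integral mu (restr A f) (bochner_integral mu (restr A f)).
  by apply: L1_is_bochner_integral; exact: L1_restr.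
have := is_bochner_integral_bound
  (is_bochner_integral_linear (-1) (is_pairing cuC If) IA).
rewrite f0// scaler0 add0r -lee_fin => /le_trans; apply.
have lfh : limsimple (fun x => f x - h x).
  by apply: limsimpleB => //; exact: fsimple_limsimple.
apply: (le_trans (@le_inormD _ _ _ mu _ _ (fun x => f x - h x) (restr Z h) lfh _ _)).
- by apply: limsimple_restr => //; exact: fsimple_limsimple.
- move=> x; have [Zx|Zx] := pselect (Z x); last first.
    have -> : -1 *: ((u x)%:C *: f x) + restr A f x = 0.
      rewrite uZ// /restr; case: asboolP => _; first by rewrite scale1r scaleN1r addNr.
      by rewrite scale0r scaler0 addr0.
    by rewrite rnorm0 addr_ge0// rnorm_ge0.
  have -> : restr Z h x = h x by rewrite /restr asboolT.
  apply: (@le_trans _ _ (rnorm (f x))); last first.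
    by rewrite -{1}(subrK (h x) (f x)) rnormD.
  have -> : -1 *: ((u x)%:C *: f x) + restr A f x =
      ((`[<A x>])%:R - u x)%:C *: f x.
    rewrite /restr raddfB scalerBl scaleN1r addrC; congr (_ - _).
    by case: asboolP => _; rewrite ?scale1r ?scale0r.
  rewrite rnormZ cabsR ler_piMl ?rnorm_ge0//.
  have /andP[u0 u1] := u01 x.
  by rewrite ler_norml; case: asboolP => _ /=; apply/andP; split; lra.
rewrite (splitr e) EFinD leeD//.
rewrite (le_trans (inorm_restr_le mu mZ hM))//.
apply: (le_trans (lee_wpmul2l _ Ze)); first by rewrite lee_fin ltW.
by rewrite -EFinM lee_fin mulrC divfK// gt_eqF.
Qed.

Lemma fourier_uniqueness f : L1_fun mu f ->
  (forall (sigma : Gh) i j, pairing (fun x => Num.conj (dual_mx (sigma := sigma) x i j)) f = 0) ->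
  {ae mu, forall x, f x = 0}.
Proof.
move=> If f0; have p0 := pairing_eq0_of_coef If f0.
have [/strongly_measurableP[f' lf' ff'] Inf] := If.
have Inf' : (inorm mu f' < +oo)%E by rewrite -(ae_eq_inorm ff').
have : {ae mu, forall x, f' x = 0}.
  apply: (inorm_eq0_of_restr lf' Inf'); apply: restr_integral_eq0 => // p cp.
  apply: bochner_integralE; rewrite -(p0 p cp).
  apply: is_bochner_integral_ae (is_pairing cp If).
  by apply: filterS ff' => x ->.
by apply: filterS2 ff' => x -> ->.
Qed.

End FourierUniqueness.

(** * Absolutely convergent Fourier series *)

Section SummableFamilies.
Context {R : realType} {I : choiceType}.
Implicit Types (X Y Z : {fset I}) (e : I -> R).
Local Open Scope fset_scope.

Lemma sum_fset_sub (V : zmodType) (F : I -> V) X Z : X `<=` Z ->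
  (\sum_(i <- Z) F i = \sum_(i <- X) F i + \sum_(i <- Z | i \notin X) F i)%R.
Proof.
move=> /fsubsetP XZ; rewrite (bigID (mem X))/=; congr (_ + _)%R.
rewrite -big_filter; apply: perm_big; apply: uniq_perm => [||i].
- by rewrite filter_uniq// fset_uniq.
- exact: fset_uniq.
- by rewrite mem_filter; apply: andb_idr; exact: XZ.
Qed.

Lemma sum_fset_le_esum e X : (forall i, 0 <= e i) ->
  ((\sum_(i <- X) e i)%:E <= \esum_(i in [set: I]) (e i)%:E)%E.
Proof.
move=> e0; apply: esum_ge; exists [set` X]%classic; first by split.
by rewrite fsbig_finite// set_fsetK -sumEFin.
Qed.

Lemma summable_tail e (eps : R) : (forall i, 0 <= e i) ->
  (\esum_(i in [set: I]) (e i)%:E < +oo)%E -> 0 < eps ->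
  exists X, forall Z, X `<=` Z -> \sum_(i <- Z | i \notin X) e i <= eps.
Proof.
move=> e0 se eps0.
have fin : (\esum_(i in [set: I]) (e i)%:E)%E \is a fin_num.
  by rewrite ge0_fin_numE// esum_ge0// => i _; rewrite lee_fin.
have [_ [A [fA _] <-]] := ub_ereal_sup_adherent eps0 fin.
rewrite fsbig_finite// sumEFin => Ae; exists (fset_set A) => Z AZ.
have := sum_fset_le_esum Z e0; rewrite (sum_fset_sub _ AZ) => Ze.
have := lt_le_trans Ae (lexx _); rewrite lteBlDr ?fin// => {}Ae.
have := le_lt_trans Ze Ae.
by rewrite -EFinD lte_fin ltrD2l => /ltW.
Qed.

Context {T : topologicalType} {E : completeNormedModType R[i]}.

(** The Weierstrass test over an unordered index type, by finite sets whose tails are at most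
    [n.+1%:R^-1]. The freedom of [X] in the conclusion serves to force a prescribed index into a
    partial sum. *)
Lemma normal_convergence e (F : I -> T -> E) :
  (forall i, 0 <= e i) -> (\esum_(i in [set: I]) (e i)%:E < +oo)%E ->
  (forall i, continuous (F i)) -> (forall i x, rnorm (F i x) <= e i) ->
  exists2 g : T -> E, continuous g & forall X (eps : R), 0 < eps ->
    exists2 Y, X `<=` Y & forall x, rnorm (g x - \sum_(i <- Y) F i x) <= eps.
Proof.
move=> e0 se cF Fe.
have /choice[X XP] (n : nat) : exists X, forall Z, X `<=` Z ->
    \sum_(i <- Z | i \notin X) e i <= n.+1%:R^-1.
  by apply: summable_tail => //; rewrite invr_gt0.
pose u n x := (\sum_(i <- X n) F i x)%R.
have uZ n Z x : X n `<=` Z -> rnorm (\sum_(i <- Z) F i x - u n x)%R <= n.+1%:R^-1.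
  move=> XZ; rewrite (sum_fset_sub (fun i => F i x) XZ) addrAC subrr add0r.
  by rewrite (le_trans (rnorm_sum _ _ _))// (le_trans _ (XP n Z XZ))// ler_sum.
have uu n m x : rnorm (u n x - u m x) <= (n.+1%:R^-1 + m.+1%:R^-1)%R.
  rewrite (le_trans (rnorm_distD (\sum_(i <- X n `|` X m) F i x)%R _ _))// lerD//.
    by rewrite rnorm_distC uZ// fsubsetUl.
  by rewrite uZ// fsubsetUr.
have cvgu x : cvg (u n x @[n --> \oo]).
  apply/cauchy_cvgP/cauchy_exP => d /gt0_complexR[d0 ->].
  have d2 : 0 < complex.Re d / 2 by rewrite divr_gt0.
  near \oo => N; exists (u N x).
  have : \forall n \near \oo, ball (u N x) (complex.Re d)%:C (u n x); last by [].
  near=> n; rewrite -ball_normE/= -rnormE ltcR.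
  rewrite (le_lt_trans (uu _ _ _))// [ltRHS](splitr) ltrD//.
    by near: N; exact: near_infty_natSinv_lt (PosNum d2).
  by near: n; exact: near_infty_natSinv_lt (PosNum d2).
have gu n x : rnorm (limn (fun n => u n x) - u n x) <= n.+1%:R^-1.
  apply/ler_addgt0Pr => d d0; have d2 : 0 < d / 2 by rewrite divr_gt0.
  near \oo => m.
  rewrite (le_trans (rnorm_distD (u m x) _ _))// [leRHS]addrC.
  have um : rnorm (limn (fun n => u n x) - u m x) < d / 2.
    by near: m; have /cvg_rnormP := cvgu x; exact.
  have m2 : m.+1%:R^-1 < d / 2.
    by near: m; exact: near_infty_natSinv_lt (PosNum d2).
  rewrite (le_trans (lerD (ltW um) (uu m n x)))// addrA lerD2r.
  by rewrite [leRHS](splitr d) lerD2l ltW.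
exists (fun x => limn (fun n => u n x)).
  apply/continuous_rnormP => x d d0; have d3 : 0 < d / 3 by rewrite divr_gt0.
  near \oo => n.
  have n3 : n.+1%:R^-1 < d / 3.
    by near: n; exact: near_infty_natSinv_lt (PosNum d3).
  have /continuous_rnormP/(_ x _ d3) : continuous (u n) by exact: continuous_bigsum.
  apply: filterS => y uxy.
  rewrite (le_lt_trans (rnorm_distD (u n x) _ _))//.
  have := rnorm_distD (u n y) (u n x) (limn (fun n => u n y)).
  have := gu n x; have := gu n y; rewrite [rnorm (limn _ - u n y)]rnorm_distC.
  by move: n3; move: n.+1%:R^-1 => r; lra.
move=> Y eps eps0; have eps2 : 0 < eps / 2 by rewrite divr_gt0.
near \oo => n; exists (X n `|` Y); first by rewrite fsubsetUr.
move=> x; rewrite (le_trans (rnorm_distD (u n x) _ _))//.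
have n2 : n.+1%:R^-1 < eps / 2.
  by near: n; exact: near_infty_natSinv_lt (PosNum eps2).
rewrite [leRHS](splitr eps) lerD//; first by rewrite (le_trans (gu n x))// ltW.
by rewrite rnorm_distC (le_trans (uZ _ _ _ _)) ?fsubsetUl// ltW.
Unshelve. all: by end_near. Qed.

End SummableFamilies.

(** Cauchy-Schwarz recovered from its weighted arithmetic-geometric forms, which can be summed
    termwise before [t] is chosen. For [A > 0], the value [t = r / A] gives [r ^+ 2 <= A * B]. *)
Lemma ler_sqrtM_AMGM (R : realType) (A B r : R) : 0 <= A -> 0 <= B -> 0 <= r ->
  (forall t, 0 < t -> r <= 2^-1 * (t * A + B / t)) -> r <= Num.sqrt A * Num.sqrt B.
Proof.
move=> A0 B0; rewrite le_eqVlt => /predU1P[<-|r0] h.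
  by rewrite mulr_ge0// sqrtr_ge0.
have [A1|A1] := eqVneq A 0.
  (* With [A = 0] this [t] yields [r <= r * B / (2 * (B + 1))], which is impossible for [r > 0]. *)
  have := h ((B + 1) / r) _; rewrite A1 mulr0 add0r invf_div divr_gt0// ?ltr_wpDl//.
  move/(_ isT); rewrite ler_pdivlMl// mulrA ler_pdivlMr ?ltr_wpDl//.
  by nra.
have {}A1 : 0 < A by rewrite lt_neqAle eq_sym A1.
rewrite -sqrtrM// -(ler_pXn2r (_ : 0 < 2)%N)// ?nnegrE ?sqrtr_ge0 ?(ltW r0)//.
rewrite sqr_sqrtr ?mulr_ge0//.
have := h (r / A) (divr_gt0 r0 A1); rewrite divfK ?gt_eqF// invf_div.
rewrite ler_pdivlMl// mulrA -lerBlDl mulr2n mulrDl mul1r addrK ler_pdivlMr//.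
by rewrite expr2 [A * B]mulrC.
Qed.

Section L1Lemmas.
Context {R : realType} {d : measure_display} {T : measurableType d}.
Variable mu : probability T R.
Context {E : completeNormedModType R[i]}.
Implicit Types (f g : T -> E).

Lemma L1_lin (a : R[i]) f g : L1_fun mu f -> L1_fun mu g ->
  L1_fun mu (fun x => a *: f x + g x).
Proof.
move=> [/strongly_measurableP[f' lf ff'] If] [/strongly_measurableP[g' lg gg'] Ig].
have lfg := limsimple_linear a lf lg.
have fg' : {ae mu, forall x, a *: f x + g x = a *: f' x + g' x}.
  by apply: filterS2 ff' gg' => x -> ->.
split; first by apply/strongly_measurableP; exists (fun x => a *: f' x + g' x).
rewrite (ae_eq_inorm fg').
apply: (@le_lt_trans _ _ ((cabs a)%:E * inorm mu f' + 1%:E * inorm mu g')%E).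
  apply: le_inorm_lin => //; first exact: cabs_ge0.
  by move=> x; rewrite (le_trans (rnormD _ _))// rnormZ mul1r.
rewrite mul1e lte_add_pinfty//; last by rewrite -(ae_eq_inorm gg').
by rewrite lte_mul_pinfty// ?lee_fin ?cabs_ge0// -(ae_eq_inorm ff').
Qed.

Lemma L2_L1 f : L2_fun mu f -> L1_fun mu f.
Proof.
move=> [sf If]; split => //.
have /strongly_measurableP[f' lf ff'] := sf.
rewrite (ae_eq_inorm ff').
have If' : (\int[mu]_x (rnorm (f' x) ^+ 2)%:E < +oo)%E.
  apply: le_lt_trans If; apply: ae_le_lower_integral => [x|x|].
  - by rewrite lee_fin sqr_ge0.
  - by rewrite lee_fin sqr_ge0.
  - by apply: filterS ff' => x ->.
apply: (@le_lt_trans _ _ (\int[mu]_x ((rnorm (f' x) ^+ 2)%:E + cst 1 x))%E).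
  apply: ae_le_lower_integral => [x|x|].
  - by rewrite lee_fin rnorm_ge0.
  - by rewrite adde_ge0// lee_fin sqr_ge0.
  - apply: aeW => x; rewrite -EFinD lee_fin.
    have := rnorm_ge0 (f' x); have := sqr_ge0 (rnorm (f' x) - 1).
    by rewrite sqrrB1; move: (rnorm (f' x)) => r; nra.
rewrite ge0_integralD//; last first.
- apply/measurable_EFinP; apply: measurable_funX; exact: measurable_rnorm.
- by move=> x _; rewrite lee_fin sqr_ge0.
rewrite lte_add_pinfty// integral_cst//= mul1e.
by rewrite (le_lt_trans (probability_le1 mu _))// ltry.
Qed.

End L1Lemmas.

(** * The Fourier series and its uniform bound *)

Section FourierSeries.
Context {R : realType} {G : topGroupType} {E : completeNormedModType R[i]}.
Hypothesis cG : compact [set: G].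
Hypothesis hG : hausdorff_space G.
Variable mu : probability (borel G) R.
Hypothesis mu_haar : haar_probability mu.
Variable Gh : unitaryDual R G.
Local Notation d := (@dual_dim R G Gh).

Lemma fourier_basis (f : G -> E) (sigma : Gh) i j :
  fourier mu f (dual_basis sigma j) (dual_basis sigma i) =
  pairing mu (fun x => Num.conj (dual_mx x j i)) f.
Proof.
congr bochner_integral; apply/funext => x.
by rewrite adjoint_basis.
Qed.

Lemma sI_ae_eq0 (f : G -> R[i]) : {ae mu, forall x : borel G, f x = 0} -> sI mu f = 0.
Proof.
move=> f0; rewrite sI.unlock; pose F : borel G -> cpx R := f.
suff : is_bochner_integral mu F (0 : cpx R) by exact: bochner_integralE.
have := haarI_is cG mu (@continuous_cst R G (cpx R) 0).
rewrite haarI0; apply: is_bochner_integral_ae.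
by apply: filterS f0 => y fy; exact: esym.
Qed.

(** The integral of the norm of the difference is 0, and the Haar integral is faithful on continuous
    functions. It transfers the bound from the sum of the Fourier series to any continuous
    representative. *)
Lemma continuous_ae_eq (g h : G -> E) : continuous g -> continuous h ->
  {ae mu, forall x : borel G, g x = h x} -> g = h.
Proof.
move=> cg ch gh; apply/funext => x; apply/eqP; rewrite -subr_eq0; apply/eqP.
have cgh : continuous (fun x => g x - h x) by exact: continuous_sub.
have cN : ccont (fun x => (rnorm (g x - h x))%:C).
  apply: ccont_realC => y; apply/cvgrPdist_lt => e e0.
  have /continuous_rnormP/(_ y e e0) := cgh; apply: filterS => z.
  exact/le_lt_trans/rnorm_distB.
apply: rnorm_eq0; apply: (@complexI R); rewrite rmorph0.
apply: (sI_eq0 cG mu_haar cN) => [y|]; first by rewrite lecR rnorm_ge0.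
apply: sI_ae_eq0.
by apply: filterS gh => y ->; rewrite subrr rnorm0.
Qed.

Implicit Types (c : forall sigma : Gh, 'I_(d sigma) -> 'I_(d sigma) -> E).

(** A term of the Fourier inversion formula: [d sigma] times the trace of the coefficient matrix
    multiplied by [dualM sigma x]. *)
Definition series_term c (sigma : Gh) (x : G) : E :=
  (d sigma)%:R *: \sum_i \sum_j dual_mx x j i *: c sigma i j.

Lemma series_term_cont c sigma : continuous (series_term c sigma).
Proof.
apply: continuous_scale; apply: continuous_bigsum => i.
apply: continuous_bigsum => j.
by apply: continuous_scalev; [exact: dual_mx_cont|exact: continuous_cst].
Qed.

Lemma pairing_series_term c sigma tau k l :
  pairing mu (fun x => Num.conj (dual_mx x l k)) (series_term c sigma) =
  if sigma == tau then c tau k l else 0.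
Proof.
have cs (rho : Gh) a b : ccont (fun y => dual_mx (sigma := rho) y a b).
  exact: dual_mx_cont.
pose D i j x := dual_mx (sigma := sigma) x j i * Num.conj (dual_mx (sigma := tau) x l k).
have cD i j : ccont (D i j) by exact: ccont_ip.
have -> : pairing mu (fun x => Num.conj (dual_mx x l k)) (series_term c sigma) =
    haarI mu (fun x => \sum_i \sum_j ((d sigma)%:R * D i j x) *: c sigma i j).
  congr bochner_integral; apply/funext => x; rewrite scalerA scaler_sumr.
  apply: eq_bigr => i _; rewrite scaler_sumr; apply: eq_bigr => j _.
  by rewrite scalerA /D; congr (_ *: _); ring.
have cdD i j : ccont (fun x => (d sigma)%:R * D i j x).
  by apply: ccont_mul => //; exact: ccont_cst.
have cdDc i j : continuous (fun x => ((d sigma)%:R * D i j x) *: c sigma i j).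
  by apply: continuous_scalev => //; exact: continuous_cst.
rewrite haarI_bigsum// => [|i]; last exact: continuous_bigsum.
under eq_bigr => i _.
  rewrite haarI_bigsum//.
  under eq_bigr do rewrite haarI_scalev// (sIZ cG)//.
  over.
have [st|st] := eqVneq sigma tau; last first.
  rewrite big1// => i _; rewrite big1// => j _.
  have -> : sI mu (D i j) = 0 by apply: (schur_neq cG mu_haar); exact/eqP.
  by rewrite mulr0 scale0r.
case: tau / st k l @D cD cdD cdDc => k l D cD cdD cdDc.
have d0 : (d sigma)%:R != 0 :> R[i] by rewrite pnatr_eq0 -lt0n dual_dim_gt0.
have E' i j : (d sigma)%:R * sI mu (D i j) = ((j == l) && (i == k))%:R :> R[i].
  have -> : sI mu (D i j) = ((j == l) && (i == k))%:R / (d sigma)%:R.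
    exact: (schur_eq cG mu_haar).
  by rewrite mulrC divfK.
under eq_bigr do under eq_bigr do rewrite E'.
rewrite (bigD1 k)//= [X in _ + X]big1 ?addr0 => [|i /negbTE ik]; last first.
  by rewrite big1// => j _; rewrite ik andbF scale0r.
rewrite (bigD1 l)//= !eqxx scale1r big1 ?addr0// => j /negbTE jl.
by rewrite jl scale0r.
Qed.

(** The arithmetic-geometric inequality with weight [q = t / w] is applied to every entry; by
    unitarity the squared moduli of the entries of [dualM sigma x] add up to [d sigma]. *)
Lemma rnorm_series_term c sigma x (w t : R) : 0 < w -> 0 < t ->
  rnorm (series_term c sigma x) <= 2^-1 * (t * ((d sigma)%:R ^+ 3 / w) +
    ((d sigma)%:R * w * \sum_i \sum_j rnorm (c sigma i j) ^+ 2) / t).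
Proof.
move=> w0 t0; rewrite rnormZ.
set D : R := (d sigma)%:R.
have D1 : 1 <= D by rewrite ler1n dual_dim_gt0.
have D0 : 0 <= D by exact: le_trans D1.
have -> : cabs (d sigma)%:R = D.
  by rewrite (_ : (d sigma)%:R = D%:C) ?cabsR ?ger0_norm// rmorph_nat.
pose q := t / w; have q0 : 0 < q by rewrite divr_gt0.
have amgm (m r : R) : m * r <= 2^-1 * (q * m ^+ 2 + r ^+ 2 / q).
  rewrite ler_pdivlMl// -(ler_pM2r q0) [leRHS]mulrDl divfK ?gt_eqF//.
  have := sqr_ge0 (q * m - r); rewrite -subr_ge0.
  by congr (0 <= _); ring.
apply: (@le_trans _ _ (D * \sum_i \sum_j (2^-1 * (q * cabs (dual_mx x j i) ^+ 2 +
    rnorm (c sigma i j) ^+ 2 / q)))).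
  rewrite ler_wpM2l// (le_trans (rnorm_sum _ _ _))//; apply: ler_sum => i _.
  rewrite (le_trans (rnorm_sum _ _ _))//; apply: ler_sum => j _.
  by rewrite rnormZ.
have -> : \sum_i \sum_j (2^-1 * (q * cabs (dual_mx (sigma := sigma) x j i) ^+ 2 +
    rnorm (c sigma i j) ^+ 2 / q)) =
    2^-1 * (q * D + (\sum_i \sum_j rnorm (c sigma i j) ^+ 2) / q).
  under eq_bigr do rewrite -mulr_sumr big_split/= -mulr_sumr -mulr_suml.
  rewrite -mulr_sumr big_split/= -mulr_sumr -mulr_suml exchange_big/=.
  congr (_ * (_ * _ + _)).
  under eq_bigr do rewrite (rep_mx_row_le (@dual_basisP _ _ Gh sigma)).
  by rewrite sumr_const card_ord.
rewrite mulrCA ler_wpM2l// mulrDr lerD//.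
  (* The factor [D] of the term and the sum [D] of the squared entries make a square, raised to the
     cube by [1 <= D]. *)
  have -> : D * (q * D) = t * (D ^+ 2 / w) by rewrite /q; ring.
  rewrite ler_wpM2l ?(ltW t0)// ler_wpM2r ?invr_ge0 ?(ltW w0)//.
  by rewrite exprS ler_peMl// sqr_ge0.
rewrite /q invf_div; rewrite le_eqVlt; apply/orP; left; apply/eqP.
by ring.
Qed.

Lemma fourier_series (w : Gh -> R) (f : G -> E) :
  (forall sigma, 0 < w sigma) ->
  (\esum_(sigma in [set: Gh]) ((d sigma)%:R ^+ 3 / w sigma)%:E < +oo)%E ->
  L1_fun mu (f : borel G -> E) ->
  let b sigma := (d sigma)%:R * w sigma * \sum_i \sum_j
    rnorm (fourier mu f (dual_basis sigma j) (dual_basis sigma i)) ^+ 2 in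
  (\esum_(sigma in [set: Gh]) (b sigma)%:E < +oo)%E ->
  exists g : G -> E, [/\ continuous g, {ae mu, forall x : borel G, f x = g x} &
    forall x, rnorm (g x) <=
      Num.sqrt (fine (\esum_(sigma in [set: Gh]) ((d sigma)%:R ^+ 3 / w sigma)%:E)%E) *
      Num.sqrt (fine (\esum_(sigma in [set: Gh]) (b sigma)%:E)%E)].
Proof.
move=> w0 sa If b sb.
set a := fun sigma => (d sigma)%:R ^+ 3 / w sigma.
pose c (sigma : Gh) i j := fourier mu f (dual_basis sigma j) (dual_basis sigma i).
have a0 sigma : 0 <= a sigma by rewrite divr_ge0 ?exprn_ge0// ltW.
have b0 sigma : 0 <= b sigma.
  rewrite mulr_ge0 ?mulr_ge0 ?(ltW (w0 _))// sumr_ge0// => i _.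
  by rewrite sumr_ge0// => j _; rewrite sqr_ge0.
have termle t sigma x : 0 < t ->
    rnorm (series_term c sigma x) <= 2^-1 * (t * a sigma + b sigma / t).
  by move=> t0; exact: rnorm_series_term.
(* The majorant for uniform convergence: the termwise bound at [t = 1]. *)
pose e sigma := 2^-1 * (a sigma + b sigma).
have e0 sigma : 0 <= e sigma by rewrite mulr_ge0 ?addr_ge0.
have se : (\esum_(sigma in [set: Gh]) (e sigma)%:E < +oo)%E.
  apply: (@le_lt_trans _ _ (\esum_(sigma in [set: Gh]) ((a sigma)%:E + (b sigma)%:E))%E).
    apply: le_esum => sigma _; rewrite -EFinD lee_fin /e.
    by have := a0 sigma; have := b0 sigma; move: (a sigma) (b sigma) => x y; lra.
  by rewrite esumD ?lte_add_pinfty// => sigma _; rewrite lee_fin.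
have ce x sigma : rnorm (series_term c sigma x) <= e sigma.
  by have := termle 1 sigma x ltr01; rewrite mul1r divr1.
have [g cg gP] := normal_convergence e0 se (@series_term_cont c) (fun sigma x => ce x sigma).
have Ig : L1_fun mu (g : borel G -> E) by exact: cont_L1.
have Ifg : L1_fun mu (fun x : borel G => -1 *: g x + f x) by exact: L1_lin.
have gcoef sigma i j : pairing mu (fun x => Num.conj (dual_mx x j i)) g = c sigma i j.
  apply/eqP; rewrite -subr_eq0; apply/eqP; apply: rnorm_small_eq0 => eps eps0.
  (* By orthogonality a partial sum that contains [sigma] has exactly the coefficient [c sigma i j],
     and it is uniformly close to [g]. *)
  have [Y /fsubsetP/(_ sigma (fset11 _)) sY gY] := gP [fset sigma]%fset eps eps0.
  pose u x := \sum_(tau <- Y) series_term c tau x.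
  have cu : continuous u by apply: continuous_bigsum => tau; exact: series_term_cont.
  have cD : ccont (fun x => Num.conj (dual_mx (sigma := sigma) x j i)).
    by apply: ccont_conj; exact: dual_mx_cont.
  have -> : c sigma i j = pairing mu (fun x => Num.conj (dual_mx x j i)) u.
    have -> : pairing mu (fun x => Num.conj (dual_mx (sigma := sigma) x j i)) u =
      haarI mu (fun x => \sum_(tau <- Y)
        Num.conj (dual_mx (sigma := sigma) x j i) *: series_term c tau x).
      by congr bochner_integral; apply/funext => x; rewrite scaler_sumr.
    rewrite haarI_bigsum// => [|tau]; last first.
      by apply: continuous_scalev => //; exact: series_term_cont.
    rewrite (bigD1_seq sigma sY (fset_uniq _))/= big1 ?addr0 => [|tau /negbTE ts].
      by rewrite [RHS]pairing_series_term eqxx.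
    by rewrite [LHS]pairing_series_term ts.
  have cgD : continuous (fun x => Num.conj (dual_mx (sigma := sigma) x j i) *: g x).
    exact: continuous_scalev.
  have cuD : continuous (fun x => Num.conj (dual_mx (sigma := sigma) x j i) *: u x).
    exact: continuous_scalev.
  rewrite [X in rnorm X](_ : _ = haarI mu (fun x =>
    Num.conj (dual_mx (sigma := sigma) x j i) *: g x -
    Num.conj (dual_mx (sigma := sigma) x j i) *: u x)); last by rewrite haarIB.
  apply: (haarI_bound cG); first exact: continuous_sub.
  move=> x; rewrite -scalerBr rnormZ cabs_conj -[leRHS]mul1r.
  rewrite ler_pM ?rnorm_ge0 ?cabs_ge0//; last exact: gY.
  rewrite cabs_le_sqr// expr1n -(rep_mx_row_le (@dual_basisP _ _ Gh sigma) x j).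
  by rewrite (bigD1 i)//= lerDl sumr_ge0// => k _; exact: sqr_ge0.
exists g; split => //.
- have : {ae mu, forall x : borel G, -1 *: g x + f x = 0}.
    apply: (fourier_uniqueness cG hG mu_haar (Gh := Gh) Ifg) => sigma j i.
    have cD : ccont (fun x => Num.conj (dual_mx (sigma := sigma) x j i)).
      by apply: ccont_conj; exact: dual_mx_cont.
    apply: bochner_integralE.
    have := is_bochner_integral_linear (-1) (is_pairing cG cD Ig) (is_pairing cG cD If).
    rewrite gcoef /c fourier_basis scaleN1r addNr.
    congr (is_bochner_integral _ _ _); apply/funext => x.
    by rewrite scalerDr !scalerA mulrC.
  by apply: filterS => x; rewrite scaleN1r addrC => /eqP; rewrite subr_eq0 => /eqP.
move=> x.
have finesum (h : Gh -> R) : (forall sigma, 0 <= h sigma) ->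
    (\esum_(sigma in [set: Gh]) (h sigma)%:E < +oo)%E ->
    forall X : {fset Gh}, \sum_(sigma <- X) h sigma <=
      fine (\esum_(sigma in [set: Gh]) (h sigma)%:E)%E.
  move=> h0 sh X; rewrite -lee_fin fineK ?sum_fset_le_esum//.
  by rewrite ge0_fin_numE// esum_ge0// => sigma _; rewrite lee_fin.
have fine0 (h : Gh -> R) : (forall sigma, 0 <= h sigma) ->
    0 <= fine (\esum_(sigma in [set: Gh]) (h sigma)%:E)%E.
  by move=> h0; rewrite fine_ge0// esum_ge0// => sigma _; rewrite lee_fin.
(* For each [t] the partial sums obey the bound, and so does [g] because [eps] is arbitrary; [t] is
   chosen only afterwards. *)
apply: ler_sqrtM_AMGM; [exact: fine0|exact: fine0|exact: rnorm_ge0|].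
move=> t t0; apply/ler_addgt0Pr => eps eps0.
have [Y _ gY] := gP fset0 eps eps0.
rewrite -[g x](subrK (\sum_(sigma <- Y) series_term c sigma x)).
rewrite (le_trans (rnormD _ _))// addrC lerD//; last exact: gY.
rewrite (le_trans (rnorm_sum _ _ _))//.
apply: (@le_trans _ _ (\sum_(sigma <- Y) 2^-1 * (t * a sigma + b sigma / t))).
  by apply: ler_sum => sigma _; exact: termle.
rewrite -mulr_sumr ler_wpM2l// big_split/= -mulr_sumr -mulr_suml.
by rewrite lerD// ?ler_pM2l ?ler_pM2r ?invr_gt0// finesum.
Qed.

End FourierSeries.

Theorem theorem3p7 (R : realType) (G : topGroupType)
  (G_compact : compact [set: G]) (G_hausdorff : hausdorff_space G)
  (mu : probability (borel G) R) (mu_haar : haar_probability mu)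
  (Gh : unitaryDual R G) (E : completeNormedModType R[i])
  (gamma : Gh -> R) (gamma_ge0 : forall sigma, 0 <= gamma sigma)
  (s : R) (s_ge0 : 0 <= s)
  (summable_dim : (\esum_(sigma in [set: Gh])
     ((dual_dim sigma)%:R ^+ 3 / (1 + gamma sigma ^+ 2) `^ s)%:E < +oo)%E) :
  continuously_embedded_in_C mu
    (sobolev mu gamma s : set (G -> E)) (sobolev_norm mu gamma s).
Proof.
have w0 sigma : 0 < (1 + gamma sigma ^+ 2) `^ s.
  by rewrite powR_gt0// ltr_wpDr// sqr_ge0.
set A := fine (\esum_(sigma in [set: Gh])
  ((dual_dim sigma)%:R ^+ 3 / (1 + gamma sigma ^+ 2) `^ s)%:E)%E.
have key (f : G -> E) : sobolev mu gamma s f -> exists g : G -> E,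
    [/\ continuous g, {ae mu, forall x : borel G, f x = g x} &
      forall x, ((rnorm (g x))%:E <= (Num.sqrt A)%:E * sobolev_norm mu gamma s f)%E].
  rewrite /sobolev /sobolev_norm /=; set B := (\esum_(_ in _) _)%E.
  move=> [/L2_L1 If sB].
  have B0 : (0 <= B)%E.
    apply: esum_ge0 => sigma _; rewrite lee_fin mulr_ge0//.
      by rewrite mulr_ge0// ltW.
    by apply: sumr_ge0 => i _; apply: sumr_ge0 => j _; exact: sqr_ge0.
  have Bfin : B \is a fin_num by rewrite -sqrte_fin_num// ge0_fin_numE// sqrte_ge0.
  have Boo : (B < +oo)%E by rewrite -ge0_fin_numE.
  have [g [cg fg gB]] := fourier_series G_compact G_hausdorff mu_haar w0 summable_dim If Boo.
  exists g; split => // x; rewrite -(fineK Bfin) /= -EFinM lee_fin.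
  exact: gB.
split; first by move=> f /key[g [cg fg _]]; exists g.
exists (Num.sqrt A); first exact: sqrtr_ge0.
move=> f g Ff cg fg; have [h [ch fh hB]] := key f Ff.
have -> : g = h.
  apply: (continuous_ae_eq G_compact mu_haar cg ch).
  by apply: filterS2 fg fh => x <-.
by apply: ge_ereal_sup => _ [x _ <-]; exact: hB.
Qed.
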